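(* Let $\Omega\subset\mathbb{R}^d$ be a compact set with Lipschitz boundary satisfying an interior cone condition. Let $\Psi,\Phi$ be correlation functions on $\mathbb{R}^d$ with spectral densities $f_\Psi,f_\Phi$ such that, for some constants $c_2\ge c_1>0$, $c_4\ge c_3>0$ and $\nu_0,\nu>0$, for all $\omega\in\mathbb{R}^d$, $$c_1(1+\|\omega\|^2)^{-(\nu_0+d/2)}\le f_\Psi(\omega)\le c_2(1+\|\omega\|^2)^{-(\nu_0+d/2)},\qquad c_3(1+\|\omega\|^2)^{-(\nu+d/2)}\le f_\Phi(\omega)\le c_4(1+\|\omega\|^2)^{-(\nu+d/2)}.$$ Let $Z$ be a stationary Gaussian process on $\mathbb{R}^d$ with mean zero and covariance $\mathrm{Cov}(Z(x),Z(x'))=\sigma^2\Psi(x-x')$, $\sigma^2>0$, and let $1\le p<\infty$. Suppose $\nu>\nu_0$. Then there exist constants $C_1,C_2>0$ and $h_0\in(0,1]$, such that for any design $X\subset\Omega$ with $h_{X,\Omega}\le h_0$ and any $t>0$, with probability at least $1-\exp\{-t^2/(C_1\sigma^2h_{X,\Omega}^{2\nu_0}\rho_{X,\Omega}^{2(\nu-\nu_0)})\}$, $$\|Z-\mathcal{I}_{\Phi,X}Z\|_{L_p(\Omega)}\le C_2\,\sigma\, h_{X,\Omega}^{\nu_0}\rho_{X,\Omega}^{\nu-\nu_0}+t.$$ Here the constants $C_1,C_2$ depend only on $\Omega,p,\Phi$ and $\Psi$ (including $\nu$ and $\nu_0$).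
   Context: A correlation function is a continuous, integrable, symmetric, positive definite function $\Psi$ on $\mathbb{R}^d$ (i.e. $(x,x')\mapsto\Psi(x-x')$ is a positive definite kernel) with $\Psi(0)=1$; its spectral density $f_\Psi$ is the function with $\Psi(x)=\int_{\mathbb{R}^d}e^{i\omega^Tx}f_\Psi(\omega)\,d\omega$. $\|\cdot\|$ is the Euclidean norm. The Gaussian process $Z$ is taken with almost surely continuous sample paths. A set $\Omega$ satisfies an interior cone condition if there exist an angle $\alpha\in(0,\pi/2)$ and a radius $R>0$ such that for every $x\in\Omega$ there is a unit vector $\xi(x)$ such that the cone $\{x+\lambda y:y\in\mathbb{R}^d,\|y\|=1,y^T\xi(x)\ge\cos\alpha,\lambda\in[0,R]\}$ is contained in $\Omega$. A design is a finite set $X=\{x_1,\ldots,x_n\}\subset\Omega$ of distinct points ($n\ge2$, so that $q_X$ is defined). Fill distance: $h_{X,\Omega}=\sup_{x\in\Omega}\inf_{x_j\in X}\|x-x_j\|$. Separation radius: $q_X=\min_{1\le j\ne k\le n}\|x_j-x_k\|/2$. Mesh ratio: $\rho_{X,\Omega}=h_{X,\Omega}/q_X$. The kriging interpolant with imposed correlation $\Phi$ is $\mathcal{I}_{\Phi,X}Z(x)=r_\Phi^T(x)K_\Phi^{-1}Y$, where $r_\Phi(x)=(\Phi(x-x_1),\ldots,\Phi(x-x_n))^T$, $K_\Phi=(\Phi(x_j-x_k))_{jk}$ and $Y=(Z(x_1),\ldots,Z(x_n))^T$. The norm is $\|g\|_{L_p(\Omega)}=(\int_\Omega|g(x)|^p\,dx)^{1/p}$.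 *)

(* Defs.v *)
From HB Require Import structures.
From mathcomp Require Import all_boot all_order all_algebra.
From mathcomp Require Import all_classical all_reals all_analysis.
Set Implicit Arguments.
Unset Strict Implicit.
Unset Printing Implicit Defensive.
Import Order.TTheory GRing.Theory Num.Theory.
Import numFieldNormedType.Exports.
Local Open Scope classical_set_scope.
Local Open Scope ring_scope.

(* Points of R^d are row vectors 'rV[R]_d.  Their library norm is the maximum
   norm (which induces the usual topology), so the Euclidean norm is defined
   separately. *)

Definition dotp {R : realType} {d : nat} (x y : 'rV[R]_d) : R :=
  \sum_i x 0 i * y 0 i.

Definition enorm {R : realType} {d : nat} (x : 'rV[R]_d) : R :=
  Num.sqrt (dotp x x).

(* The measurable structure on R^n is the product of the Borel sigma-algebras
   of the coordinates, following the library's instance for n.-tuple. *)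

Definition rV_display : measure_display. Proof. exact. Qed.

Definition rV_coord {R : realType} {n : nat} (i : 'I_n) (x : 'rV[R]_n) : R :=
  x 0 i.

Section measurable_rV.
Context {R : realType} {n : nat}.

Let coords : 'I_n -> 'rV[R]_n -> measurableTypeR R := @rV_coord R n.

Let rV_set0 : g_sigma_preimage coords set0.
Proof. exact: sigma_algebra0. Qed.

Let rV_setC A : g_sigma_preimage coords A -> g_sigma_preimage coords (~` A).
Proof. exact: sigma_algebraC. Qed.

Let rV_bigcup (F : (set 'rV[R]_n)^nat) :
  (forall i, g_sigma_preimage coords (F i)) ->
  g_sigma_preimage coords (\bigcup_i (F i)).
Proof. exact: sigma_algebra_bigcup. Qed.

HB.instance Definition _ := @isMeasurable.Build rV_display 'rV[R]_n
  (g_sigma_preimage coords) rV_set0 rV_setC rV_bigcup.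

End measurable_rV.

Lemma measurable_rV_coord {R : realType} {n : nat} (i : 'I_n) :
  measurable_fun [set: 'rV[R]_n] (rV_coord i : _ -> measurableTypeR R).
Proof.
move=> _ Y mY; rewrite setTI; apply: sub_sigma_algebra => /=.
rewrite -bigcup_seq/=; exists i => /=; first by rewrite mem_index_enum.
by exists Y => //; rewrite setTI.
Qed.

Lemma measurable_fun_rVP {d} {T : measurableType d} {R : realType} {n : nat}
    (f : T -> 'rV[R]_n) :
  (forall i, measurable_fun [set: T]
     ((rV_coord i : _ -> measurableTypeR R) \o f)) ->
  measurable_fun [set: T] f.
Proof.
move=> mf.
suff : g_sigma_preimage
    (fun i => (rV_coord i : _ -> measurableTypeR R) \o f) `<=` measurable.
  by rewrite g_sigma_preimage_comp => prefS _ A mA; apply: prefS; exists A.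
apply: smallest_sub; first exact: sigma_algebra_measurable.
case: n => [|n] in f mf *; first by rewrite big_ord0.
rewrite -bigcup_mkord_ord; apply: bigcup_sub => i Ii.
by move=> A [B mB <-]; exact: mf.
Qed.

(* The identification of R * R^n with R^(n+1). *)

Definition consv {R : realType} {n : nat} (u : R * 'rV[R]_n) : 'rV[R]_n.+1 :=
  \row_i (if unlift ord0 i is Some j then u.2 0 j else u.1).

Definition unconsv {R : realType} {n : nat} (v : 'rV[R]_n.+1) :
    R * 'rV[R]_n := (v 0 ord0, \row_i v 0 (lift ord0 i)).

Lemma consvK {R : realType} {n : nat} : cancel (@consv R n) unconsv.
Proof.
move=> [a v]; rewrite /consv /unconsv; congr pair.
  by rewrite mxE unlift_none.
by apply/rowP => i; rewrite !mxE liftK.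
Qed.

Lemma unconsvK {R : realType} {n : nat} : cancel (@unconsv R n) consv.
Proof.
move=> v; apply/rowP => i; rewrite mxE /unconsv /=.
by case: unliftP => [j ->|->//]; rewrite mxE.
Qed.

Lemma measurable_consv {R : realType} {n : nat} :
  measurable_fun [set: measurableTypeR R * 'rV[R]_n] consv.
Proof.
apply: measurable_fun_rVP => i.
case: (unliftP ord0 i) => [j|] ->.
  rewrite [X in measurable_fun _ X](_ : _ = (rV_coord j) \o snd); last first.
    by apply/funext => -[a v]; rewrite /rV_coord /consv /= mxE liftK.
  exact: measurableT_comp (measurable_rV_coord j) measurable_snd.
rewrite [X in measurable_fun _ X](_ : _ = fst); first exact: measurable_fst.
by apply/funext => -[a v]; rewrite /rV_coord /consv /= mxE unlift_none.
Qed.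

Lemma measurable_unconsv {R : realType} {n : nat} :
  measurable_fun [set: 'rV[R]_n.+1]
    (unconsv : _ -> measurableTypeR R * 'rV[R]_n).
Proof.
apply/measurable_fun_pairP; split; first exact: measurable_rV_coord.
apply: measurable_fun_rVP => i.
rewrite [X in measurable_fun _ X](_ : _ = rV_coord (lift ord0 i)).
  exact: measurable_rV_coord.
by apply/funext => v; rewrite /rV_coord /= mxE.
Qed.

Section lebesgue_step.
Local Open Scope ereal_scope.
Context {R : realType} {n : nat}
  (mu : {sigma_finite_measure set 'rV[R]_n -> \bar R}).

Definition lebesgue_step : set 'rV[R]_n.+1 -> \bar R :=
  pushforward (@lebesgue_measure R \x mu)
    (consv : measurableTypeR R * 'rV[R]_n -> 'rV[R]_n.+1).

Let step0 : lebesgue_step set0 = 0.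
Proof. by apply: measure0; exact: measurable_consv. Qed.

Let step_ge0 A : 0 <= lebesgue_step A.
Proof. by apply: measure_ge0; exact: measurable_consv. Qed.

Let step_sigma_additive : semi_sigma_additive lebesgue_step.
Proof.
by apply: measure_semi_sigma_additive; exact: measurable_consv.
Qed.

HB.instance Definition _ := isMeasure.Build _ _ _ lebesgue_step
  step0 step_ge0 step_sigma_additive.

Let step_sigma_finite : sigma_finite setT lebesgue_step.
Proof.
have /sigma_finiteP[F [FT ndF Foo]] := sigma_finiteT (@lebesgue_measure R).
have /sigma_finiteP[G [GT ndG Goo]] := sigma_finiteT mu.
exists (fun k => unconsv @^-1` (F k `*` G k)).
  rewrite -preimage_bigcup -(preimage_setT unconsv) -setXTT FT GT.
  congr (_ @^-1` _); rewrite predeqE => -[x y]; split.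
    move=> [/= [p _ Fpx] [q _ Gqy]]; exists (maxn p q) => //; split.
    - by move: x Fpx; exact/subsetPset/ndF/leq_maxl.
    - by move: y Gqy; exact/subsetPset/ndG/leq_maxr.
  by move=> [p _ []/= ? ?]; split; exists p.
move=> k; have [mFk Fk] := Foo k; have [mGk Gk] := Goo k; split.
  rewrite -[X in measurable X]setTI.
  by apply: measurable_unconsv => //; exact: measurableX.
rewrite /lebesgue_step /pushforward -comp_preimage.
rewrite (_ : unconsv \o consv = id); last by apply/funext => u; exact: consvK.
by rewrite preimage_id product_measure1E// lte_mul_pinfty// ge0_fin_numE.
Qed.

HB.instance Definition _ := Measure_isSigmaFinite.Build _ _ _ lebesgue_step
  step_sigma_finite.

End lebesgue_step.

(* Lebesgue measure on R^n, as an iterated product. *)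
Fixpoint lebesgue_rV (R : realType) (n : nat) :
    {sigma_finite_measure set 'rV[R]_n -> \bar R} :=
  match n with
  | 0 => dirac (0 : 'rV[R]_0)
  | k.+1 => lebesgue_step (lebesgue_rV R k)
  end.

Lemma lebesgue_rV_box (R : realType) (n : nat)
    (A : 'I_n -> set (measurableTypeR R)) :
  (forall i, measurable (A i)) ->
  (lebesgue_rV R n [set x : 'rV[R]_n | forall i, A i (x 0%R i)] =
   \prod_(i < n) lebesgue_measure (A i))%E.
Proof.
elim: n A => [|n IHn] A mA.
  by rewrite big_ord0 /= diracE mem_set//= => -[].
have mB : measurable [set x : 'rV[R]_n | forall i, A (lift ord0 i) (x 0 i)].
  rewrite (_ : [set _ | _] = \bigcap_(i in [set: 'I_n])
      (rV_coord i @^-1` A (lift ord0 i))); last first.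
    by apply/seteqP; split => [x Ax i _|x Ax i]; [exact: Ax|exact: (Ax i I)].
  apply: fin_bigcap_measurable => // i _; rewrite -[X in measurable X]setTI.
  exact: measurable_rV_coord.
rewrite big_ord_recl -IHn//= /lebesgue_step /pushforward.
rewrite (_ : _ @^-1` _ =
    A ord0 `*` [set x : 'rV[R]_n | forall i, A (lift ord0 i) (x 0 i)]).
  exact: product_measure1E.
apply/seteqP; split => -[a v] /=.
  move=> Aav; split => [|i]; first by have := Aav ord0; rewrite mxE unlift_none.
  by have := Aav (lift ord0 i); rewrite mxE liftK.
by move=> [Aa Av] i; rewrite mxE; case: unliftP => [j|] ->.
Qed.

(* The topological notions below refer to the library topology of 'rV[R]_d. *)

(* Near each boundary point, in suitable orthonormal coordinates, the set is
   the region on or above the graph of a Lipschitz function of the d - 1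
   coordinates other than the j-th. *)
Definition lipschitz_boundary {R : realType} {d : nat} (Omega : set 'rV[R]_d) :=
  forall x, closure Omega x -> closure (~` Omega) x ->
  exists (Q : 'M[R]_d) (j : 'I_d) (gamma : 'rV[R]_d.-1 -> R) (L r : R),
    [/\ Q *m Q^T = 1%:M,
        forall u v, `|gamma u - gamma v| <= L * enorm (u - v),
        0 < r &
        forall y, enorm (y - x) < r ->
          (Omega y <-> gamma (col' j (y *m Q)) <= (y *m Q) 0 j)].

Definition interior_cone_condition {R : realType} {d : nat}
    (Omega : set 'rV[R]_d) :=
  exists alpha r : R,
    [/\ 0 < alpha, alpha < pi / 2, 0 < r &
        forall x, Omega x -> exists xi : 'rV[R]_d, enorm xi = 1 /\
          forall (y : 'rV[R]_d) (lambda : R),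
            enorm y = 1 -> cos alpha <= dotp y xi -> 0 <= lambda <= r ->
            Omega (x + lambda *: y)].

Definition pos_def_kernel {R : realType} {d : nat}
    (k : 'rV[R]_d -> 'rV[R]_d -> R) :=
  forall (n : nat) (x : 'I_n -> 'rV[R]_d) (a : 'I_n -> R),
    injective x -> (exists i, a i != 0) ->
    0 < \sum_i \sum_j a i * a j * k (x i) (x j).

Definition correlation_function {R : realType} {d : nat}
    (Psi : 'rV[R]_d -> R) :=
  [/\ continuous Psi,
      (lebesgue_rV R d).-integrable [set: 'rV[R]_d] (EFin \o Psi),
      forall x, Psi (- x) = Psi x,
      pos_def_kernel (fun x x' => Psi (x - x')) &
      Psi 0 = 1].

(* Psi x = \int exp(i w.x) f(w) dw, split into its real and imaginary parts. *)
Definition spectral_density {R : realType} {d : nat}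
    (Psi f : 'rV[R]_d -> R) :=
  (lebesgue_rV R d).-integrable [set: 'rV[R]_d] (EFin \o f) /\
  forall x,
    \int[lebesgue_rV R d]_w (cos (dotp w x) * f w) = Psi x /\
    \int[lebesgue_rV R d]_w (sin (dotp w x) * f w) = 0.

Definition design {R : realType} {d n : nat} (Omega : set 'rV[R]_d)
    (X : 'I_n -> 'rV[R]_d) :=
  [/\ (2 <= n)%N, injective X & forall j, Omega (X j)].

Definition fill_distance {R : realType} {d n : nat} (Omega : set 'rV[R]_d)
    (X : 'I_n -> 'rV[R]_d) : R :=
  sup [set inf [set enorm (x - X j) | j in [set: 'I_n]] | x in Omega].

Definition separation_radius {R : realType} {d n : nat}
    (X : 'I_n -> 'rV[R]_d) : R :=
  inf [set enorm (X jk.1 - X jk.2) | jk in [set jk : 'I_n * 'I_n | jk.1 != jk.2]]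
    / 2.

Definition mesh_ratio {R : realType} {d n : nat} (Omega : set 'rV[R]_d)
    (X : 'I_n -> 'rV[R]_d) : R :=
  fill_distance Omega X / separation_radius X.

(* [g] is the sampled function: kriging Phi X g interpolates the values of g
   on X. *)
Definition kriging {R : realType} {d n : nat} (Phi : 'rV[R]_d -> R)
    (X : 'I_n -> 'rV[R]_d) (g : 'rV[R]_d -> R) (x : 'rV[R]_d) : R :=
  let r : 'cV[R]_n := \col_j Phi (x - X j) in
  let K : 'M[R]_n := \matrix_(j, k) Phi (X j - X k) in
  let Y : 'cV[R]_n := \col_j g (X j) in
  (r^T *m invmx K *m Y) 0 0.

Definition Lp_norm {R : realType} {d : nat} (Omega : set 'rV[R]_d) (p : R)
    (g : 'rV[R]_d -> R) : \bar R :=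
  Lnorm (lebesgue_rV R d) p%:E ((EFin \o g) \_ Omega).

(* The law N(m, s^2), including the degenerate case s = 0, in which the
   library's normal_prob is not the Dirac mass. *)
Definition normal_law {R : realType} (m s : R) : set R -> \bar R :=
  if s == 0 then \d_m else normal_prob m s.

Definition gaussian_rv {disp} {T : measurableType disp} {R : realType}
    (P : probability T R) (V : T -> R) :=
  exists m s : R, 0 <= s /\
    forall B : set R, measurable B -> P (V @^-1` B) = normal_law m s B.

(* All finite-dimensional marginals are (possibly degenerate) multivariate
   normal. *)
Definition gaussian_process {disp} {T : measurableType disp} {R : realType}
    {d : nat} (P : probability T R) (Z : 'rV[R]_d -> {RV P >-> R}) :=
  forall (n : nat) (x : 'I_n -> 'rV[R]_d) (a : 'I_n -> R),
    gaussian_rv P (fun w => \sum_i a i * Z (x i) w).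

(* Stationarity is contained in the last two clauses: for a Gaussian process
   the mean and the covariance determine the law. *)
Definition stationary_gaussian_process {disp} {T : measurableType disp}
    {R : realType} {d : nat} (P : probability T R) (sigma : R)
    (Psi : 'rV[R]_d -> R) (Z : 'rV[R]_d -> {RV P >-> R}) :=
  [/\ gaussian_process Z,
      {ae P, forall w, continuous (fun x => Z x w)},
      forall x, ('E_P[Z x] = 0)%E &
      forall x x', covariance P (Z x) (Z x') = (sigma ^+ 2 * Psi (x - x'))%:E].

(* Stated through a measurable subevent, since {w | Q w} need not belong to
   the sigma-algebra of a space that is not complete. *)
Definition with_probability_ge {disp} {T : measurableType disp} {R : realType}
    (P : probability T R) (a : R) (Q : T -> Prop) :=
  exists E : set T,
    [/\ measurable E, forall w, E w -> Q w & (a%:E <= P E)%E].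

(* Main.v *)
Require Import Defs.
From HB Require Import structures.
From mathcomp Require Import all_boot all_order all_algebra.
From mathcomp Require Import all_classical all_reals all_analysis.
From mathcomp Require Import measurable_realfun ring lra zify.
Set Implicit Arguments.
Unset Strict Implicit.
Unset Printing Implicit Defensive.
Import Order.TTheory GRing.Theory Num.Theory.
Import numFieldNormedType.Exports.
Local Open Scope classical_set_scope.
Local Open Scope ring_scope.

(** The prediction error at a point x is the Gaussian variable
    Z x - sum_j u_j Z (X j), where u = u(x) are the kriging weights of Phi, and
    the spectral representation turns its variance into sigma^2 times
      int |E(w)|^2 fPsi(w) dw,   E(w) = e^{i w.x} - sum_j u_j e^{i w.X_j}.
    Write h, q and rho for the fill distance, separation radius and mesh ratio.
    Everything rests on the bound C h^{2 nu0} rho^{2 (nu - nu0)} for this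
    integral, uniformly in x [kriging_variance_bound].

    The weights u minimize the same integral with fPhi instead of fPsi.
    Comparing them with weights that reproduce e^{i w.x} to order m in h |w|
    from nearby design points [design_reproduction] gives
    int |E|^2 fPhi <= C h^{2 nu} [power_function_bound].  Below a frequency of
    order 1/q one has fPsi <= C q^{-2 (nu - nu0)} fPhi, and the contribution
    C q^{-2 (nu - nu0)} h^{2 nu} is exactly the claimed rate.  Above it, fPhi is
    too small to control fPsi, and the structure of E takes over: seen through
    a frequency window of width at least of order 1/q, exponentials with
    q-separated nodes are almost orthogonal [laplace_trigsq_bounds].  Used on
    dyadic windows this bounds the high-frequency part by C q^{2 nu0} (1 + |u|^2)
    [high_frequency_bound]; used at the single scale 1/q in the other direction
    it bounds |u|^2 by C rho^{2 nu}, because E is already known to be small in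
    the weight of Phi [coef_bound].  The product is again the claimed rate.

    The window is exp (- |w|_1 / L): its Fourier transform is the explicit product
    of Cauchy kernels [integral_laplace_cos], whose off-diagonal sums over
    separated points are small, and it decays faster than any Sobolev weight.

    For the norm, let v^2 bound the variance of the error g(x) on Omega.  Then
    exp (g(x)^2 / (48 v^2)) has bounded expectation [gaussian_exp_moment], hence
    so has its integral over Omega.  By Markov that integral is at most of order
    exp (s^2 / (8 * 48 v^2)) except with exponentially small probability, and a
    pointwise inequality between |g|^p and the exponential [powR_exp_bound]
    turns this into a bound of order s for the L_p norm [Lp_tail].  Taking s to be
    a large multiple of v plus a multiple of t gives the theorem. *)

(** * Fourier transform of the Laplace density *)

(** Folding onto a half-line brings the integral within reach of the
    fundamental theorem of calculus for nonnegative integrands on [0, +oo[. *)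
Lemma integralT_fold (R : realType) (f : R -> R) :
  (forall x, 0 <= f x) -> continuous f ->
  (\int[@lebesgue_measure R]_x (f x)%:E =
   \int[@lebesgue_measure R]_(x in `[0%R, +oo[) (f x)%:E +
   \int[@lebesgue_measure R]_(x in `[0%R, +oo[) (f (- x))%:E)%E.
Proof.
move=> f0 cf.
have mf : measurable_fun [set: R] f.
  exact: measurable_realfun.continuous_measurable_fun.
rewrite -(setUv (`[0%R, +oo[ : set R)) ge0_integral_setU//=; last 4 first.
- exact: measurableC.
- by rewrite setUv; exact/measurable_EFinP.
- by move=> x _; rewrite lee_fin.
- exact/disj_setPCl.
congr (_ + _)%E.
rewrite setCitvr integral_itv_bndo_bndc; last exact/measurable_EFinP/measurable_funTS.
rewrite -{1}oppr0 ge0_integration_by_substitutionNy//.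
exact: continuous_subspaceT.
Qed.

(** The summand 1 keeps the integrand nonnegative; the contribution of
    expR (- (s w)) alone is subtracted again in [integral_exp_abs_cos]. *)
Lemma exp_cos_antiderivative (R : realType) (s x th w : R) : 0 < s ->
  is_derive w 1 (fun w => - (s^-1 * expR (- (s * w)))
     + (s ^+ 2 + x ^+ 2)^-1 *
       (expR (- (s * w)) * (x * sin (x * w + th) - s * cos (x * w + th))))
   (expR (- (s * w)) * (1 + cos (x * w + th))).
Proof.
move=> s0.
have h0 : is_derive w 1 (fun w => - (s * w)) (- s).
  by apply: is_derive_eq; rewrite /GRing.scale/= mulr1.
have h1 := @is_derive1_comp R expR (fun w => - (s * w)) w _ _ _ h0.
have g0 : is_derive w 1 (fun w => x * w + th) x.
  by apply: is_derive_eq; rewrite /GRing.scale/= mulr1 addr0.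
have h2 := @is_derive1_comp R sin (fun w => x * w + th) w _ _ _ g0.
have h3 := @is_derive1_comp R cos (fun w => x * w + th) w _ _ _ g0.
rewrite /comp/= in h1 h2 h3.
have sx : s ^+ 2 + x ^+ 2 != 0.
  by rewrite gt_eqF// ltr_wpDr ?sqr_ge0// exprn_gt0.
apply: is_derive_eq; rewrite /GRing.scale/=.
field.
by rewrite sx gt_eqF.
Qed.

Lemma integral_exp_cos_half (R : realType) (s x th : R) : 0 < s ->
  (\int[@lebesgue_measure R]_(w in `[0%R, +oo[)
     (expR (- (s * w)) * (1 + cos (x * w + th)))%:E =
   (s^-1 + (s ^+ 2 + x ^+ 2)^-1 * (s * cos th - x * sin th))%:E)%E.
Proof.
move=> s0.
set F := (fun w => - (s^-1 * expR (- (s * w)))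
     + (s ^+ 2 + x ^+ 2)^-1 *
       (expR (- (s * w)) * (x * sin (x * w + th) - s * cos (x * w + th)))).
have dF w := @exp_cos_antiderivative R s x th w s0.
have cF : continuous F.
  move=> w; apply/differentiable_continuous/derivable1_diffP.
  by have [] := dF w.
rewrite (@ge0_continuous_FTC2y R _ F 0 0).
- by rewrite -EFinB /F !mulr0 oppr0 expR0 !add0r; congr (_%:E); ring.
- by move=> w _; rewrite mulr_ge0 ?expR_ge0// -lerBlDl sub0r cos_geN1.
- apply: continuous_subspaceT => w.
  apply: cvgM.
    apply: continuous_comp; last exact: continuous_expR.
    by apply: cvgN; apply: cvgM; [exact: cvg_cst|exact: cvg_id].
  apply: cvgD; first exact: cvg_cst.
  apply: continuous_comp; last exact: continuous_cos.
  apply: cvgD; last exact: cvg_cst.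
  by apply: cvgM; [exact: cvg_cst|exact: cvg_id].
- have cexp : expR (- (s * w)) @[w --> +oo] --> 0.
    apply: (@cvg_comp _ _ _ (fun w => s * w) (fun w => expR (- w))).
      exact: (gt0_cvgMry s0 cvg_id).
    exact: cvgr_expR.
  pose C := s^-1 + (s ^+ 2 + x ^+ 2)^-1 * (`|x| + s).
  apply: (@squeeze_cvgr _ _ _ _ (fun w => - (C * expR (- (s * w))))
     (fun w => C * expR (- (s * w)))).
  + apply: nearW => w; rewrite -ler_norml /F.
    have e0 := expR_ge0 (- (s * w)).
    apply: le_trans (ler_normD _ _) _; rewrite normrN /C mulrDl lerD//.
      by rewrite ger0_norm// mulr_ge0// invr_ge0 ltW.
    rewrite !normrM -mulrA ger0_norm ?invr_ge0 ?addr_ge0 ?sqr_ge0//.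
    rewrite ler_wpM2l ?invr_ge0 ?addr_ge0 ?sqr_ge0//.
    rewrite (ger0_norm e0) mulrC ler_wpM2r//.
    apply: le_trans (ler_normB _ _) _; rewrite !normrM lerD//.
      by rewrite ler_piMr// ler_norml sin_geN1 sin_le1.
    by rewrite (gtr0_norm s0) ler_piMr ?(ltW s0)// ler_norml cos_geN1 cos_le1.
  + by rewrite -(oppr0) -(mulr0 C); apply: cvgN; apply: cvgM => //; exact: cvg_cst.
  + by rewrite -(mulr0 C); apply: cvgM => //; exact: cvg_cst.
- by move=> w _; have [] := dF w.
- by apply: cvg_at_right_filter; exact: cF.
- move=> w _; rewrite derive1E; exact: derive_val.
Qed.

Lemma integral_exp_abs_cos1 (R : realType) (s x th : R) : 0 < s ->
  (\int[@lebesgue_measure R]_w (expR (- (s * `|w|)) * (1 + cos (x * w + th)))%:E =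
   (2 / s + 2 * s / (s ^+ 2 + x ^+ 2) * cos th)%:E)%E.
Proof.
move=> s0.
have sx : s ^+ 2 + x ^+ 2 != 0.
  by rewrite gt_eqF// ltr_wpDr ?sqr_ge0// exprn_gt0.
rewrite integralT_fold; last 2 first.
- by move=> w; rewrite mulr_ge0 ?expR_ge0// -lerBlDl sub0r cos_geN1.
- move=> w; apply: cvgM.
    apply: continuous_comp; last exact: continuous_expR.
    by apply: cvgN; apply: cvgM; [exact: cvg_cst|exact: norm_continuous].
  apply: cvgD; first exact: cvg_cst.
  apply: continuous_comp; last exact: continuous_cos.
  apply: cvgD; last exact: cvg_cst.
  by apply: cvgM; [exact: cvg_cst|exact: cvg_id].
transitivity ((\int[@lebesgue_measure R]_(w in `[0%R, +oo[)
     (expR (- (s * w)) * (1 + cos (x * w + th)))%:E +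
  \int[@lebesgue_measure R]_(w in `[0%R, +oo[)
     (expR (- (s * w)) * (1 + cos ((- x) * w + th)))%:E)%E).
  congr (_ + _)%E; apply: eq_integral => w; rewrite inE/= in_itv/= andbT => w0.
    by rewrite ger0_norm.
  by rewrite normrN ger0_norm// mulrN mulNr.
rewrite !integral_exp_cos_half// -EFinD; congr (_%:E).
by rewrite sqrrN; field; rewrite sx gt_eqF.
Qed.

Lemma measurable_exp_abs (R : realType) (s : R) :
  measurable_fun [set: R] (fun w : R => expR (- (s * `|w|))).
Proof.
apply: continuous_measurable_fun => w.
apply: continuous_comp; last exact: continuous_expR.
by apply: cvgN; apply: cvgM; [exact: cvg_cst|exact: norm_continuous].
Qed.

Lemma integral_exp_abs (R : realType) (s : R) : 0 < s ->
  (\int[@lebesgue_measure R]_w (expR (- (s * `|w|)))%:E = (2 / s)%:E)%E.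
Proof.
move=> s0; have := @integral_exp_abs_cos1 R s 0 (pi / 2) s0.
rewrite cos_pihalf mulr0 addr0 => <-; apply: eq_integral => w _.
by rewrite mul0r add0r cos_pihalf addr0 mulr1.
Qed.

Lemma integrable_exp_abs (R : realType) (s : R) : 0 < s ->
  (@lebesgue_measure R).-integrable [set: R]
    (EFin \o (fun w : R => expR (- (s * `|w|)))).
Proof.
move=> s0; apply/integrableP; split.
  by apply/measurable_EFinP; exact: measurable_exp_abs.
rewrite (_ : integral _ _ _ = (2 / s)%:E) ?ltry//.
rewrite -(integral_exp_abs s0); apply: eq_integral => w _ /=.
by rewrite ger0_norm ?expR_ge0.
Qed.

Lemma integral_exp_abs_cos (R : realType) (s x th : R) : 0 < s ->
  (\int[@lebesgue_measure R]_w (expR (- (s * `|w|)) * cos (x * w + th))%:E =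
   (2 * s / (s ^+ 2 + x ^+ 2) * cos th)%:E)%E.
Proof.
move=> s0.
have i1 := integrable_exp_abs s0.
have mc : measurable_fun [set: R] (fun w : R => cos (x * w + th)).
  apply: continuous_measurable_fun => w.
  apply: continuous_comp; last exact: continuous_cos.
  apply: cvgD; last exact: cvg_cst.
  by apply: cvgM; [exact: cvg_cst|exact: cvg_id].
have i2 : (@lebesgue_measure R).-integrable [set: R]
    (EFin \o (fun w : R => expR (- (s * `|w|)) * (1 + cos (x * w + th)))).
  apply/integrableP; split.
    apply/measurable_EFinP; apply: measurable_funM; first exact: measurable_exp_abs.
    exact: measurable_funD.
  rewrite (_ : integral _ _ _ = (2 / s + 2 * s / (s ^+ 2 + x ^+ 2) * cos th)%:E) ?ltry//.
  rewrite -(integral_exp_abs_cos1 x th s0); apply: eq_integral => w _ /=.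
  by rewrite ger0_norm// mulr_ge0 ?expR_ge0// -lerBlDl sub0r cos_geN1.
transitivity (\int[@lebesgue_measure R]_w
  ((expR (- (s * `|w|)) * (1 + cos (x * w + th)))%:E - (expR (- (s * `|w|)))%:E))%E.
  by apply: eq_integral => w _; rewrite -EFinB; congr (_%:E); ring.
rewrite integralB_EFin// integral_exp_abs_cos1// integral_exp_abs// -EFinB.
by congr (_%:E); ring.
Qed.

(** With the 1-norm the window exp (- s |w|_1) is a product of functions of one
    coordinate, so that its Fourier transform factors. *)
Definition norm1 {R : realType} {d : nat} (w : 'rV[R]_d) : R :=
  \sum_i `|w 0 i|.

Definition laplace {R : realType} {d : nat} (s : R) (w : 'rV[R]_d) : R :=
  expR (- (s * norm1 w)).

Lemma measurable_norm1 (R : realType) (d : nat) :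
  measurable_fun [set: 'rV[R]_d] (@norm1 R d).
Proof.
apply: measurable_sum => i; apply: measurableT_comp => //.
exact: measurable_rV_coord.
Qed.

Lemma measurable_dotp (R : realType) (d : nat) (x : 'rV[R]_d) :
  measurable_fun [set: 'rV[R]_d] (fun w => dotp w x).
Proof.
apply: measurable_sum => i; apply: measurable_funM => //.
exact: measurable_rV_coord.
Qed.

Lemma measurable_laplace (R : realType) (d : nat) (s : R) :
  measurable_fun [set: 'rV[R]_d] (@laplace R d s).
Proof.
apply: measurableT_comp => //; apply: measurableT_comp => //.
by apply: measurable_funM => //; exact: measurable_norm1.
Qed.

Lemma laplace_ge0 (R : realType) (d : nat) (s : R) (w : 'rV[R]_d) :
  0 <= laplace s w.
Proof. exact: expR_ge0. Qed.

Lemma measurable_cos (R : realType) : measurable_fun [set: R] (@cos R).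
Proof. exact: continuous_measurable_fun (@continuous_cos R). Qed.

Lemma measurable_sin (R : realType) : measurable_fun [set: R] (@sin R).
Proof. exact: continuous_measurable_fun (@continuous_sin R). Qed.

Lemma ge0_integral_rVS (R : realType) (n : nat) (f : 'rV[R]_n.+1 -> \bar R) :
  measurable_fun [set: 'rV[R]_n.+1] f -> (forall x, 0 <= f x)%E ->
  (\int[lebesgue_rV R n.+1]_x f x =
   \int[@lebesgue_measure R]_a \int[lebesgue_rV R n]_v f (consv (a, v)))%E.
Proof.
move=> mf f0.
rewrite [LHS](@ge0_integral_pushforward _ _ _ _ _ _ measurable_consv)//=.
rewrite preimage_setT fubini_tonelli1//.
by apply: measurableT_comp => //; exact: measurable_consv.
Qed.

Lemma integral_rVS (R : realType) (n : nat) (f : 'rV[R]_n.+1 -> \bar R) :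
  (lebesgue_rV R n.+1).-integrable [set: 'rV[R]_n.+1] f ->
  (\int[lebesgue_rV R n.+1]_x f x =
   \int[@lebesgue_measure R]_a \int[lebesgue_rV R n]_v f (consv (a, v)))%E.
Proof.
move=> intf; have mf := measurable_int _ intf.
have intfc : ((@lebesgue_measure R \x lebesgue_rV R n)%E).-integrable
    [set: measurableTypeR R * 'rV[R]_n] (f \o consv).
  apply/integrableP; split.
    by apply: measurableT_comp => //; exact: measurable_consv.
  move/integrableP: (intf) => [_]; apply: le_lt_trans.
  rewrite [leRHS](@ge0_integral_pushforward _ _ _ _ _ _ measurable_consv)//=.
  exact: measurableT_comp.
rewrite [LHS](@integral_pushforward _ _ _ _ _ _ measurable_consv)//=.
by rewrite preimage_setT -integral12_prod_meas1.
Qed.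

Lemma norm1_consv (R : realType) (n : nat) (a : R) (v : 'rV[R]_n) :
  norm1 (consv (a, v)) = `|a| + norm1 v.
Proof.
rewrite /norm1 big_ord_recl !mxE unlift_none; congr (_ + _).
by apply: eq_bigr => i _; rewrite mxE liftK.
Qed.

Lemma dotp_consv (R : realType) (n : nat) (a : R) (v : 'rV[R]_n)
    (x : 'rV[R]_n.+1) :
  dotp (consv (a, v)) x = x 0 ord0 * a + dotp v (\row_i x 0 (lift ord0 i)).
Proof.
rewrite /dotp big_ord_recl !mxE unlift_none mulrC; congr (_ + _).
by apply: eq_bigr => i _; rewrite !mxE liftK.
Qed.

Lemma laplace_consv (R : realType) (n : nat) (s a : R) (v : 'rV[R]_n) :
  laplace s (consv (a, v)) = expR (- (s * `|a|)) * laplace s v.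
Proof. by rewrite /laplace norm1_consv mulrDr opprD expRD. Qed.

Lemma integral_laplace (R : realType) (d : nat) (s : R) : 0 < s ->
  (\int[lebesgue_rV R d]_w (laplace s w)%:E = ((2 / s) ^+ d)%:E)%E.
Proof.
move=> s0; elim: d => [|n IHn].
  rewrite /= integral_dirac//=; last by apply/measurable_EFinP; exact: measurable_laplace.
  by rewrite diracT mul1e /laplace /norm1 big_ord0 mulr0 oppr0 expR0.
rewrite ge0_integral_rVS; last 2 first.
- by apply/measurable_EFinP; exact: measurable_laplace.
- by move=> w; rewrite lee_fin laplace_ge0.
transitivity (\int[@lebesgue_measure R]_a (((2 / s) ^+ n)%:E * (expR (- (s * `|a|)))%:E))%E.
  apply: eq_integral => a _; rewrite -IHn muleC.
  under eq_integral => v _ do rewrite laplace_consv EFinM.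
  rewrite ge0_integralZl_EFin ?expR_ge0//.
    by move=> v _; rewrite lee_fin laplace_ge0.
  by apply/measurable_EFinP; exact: measurable_laplace.
rewrite ge0_integralZl_EFin//=.
- by rewrite integral_exp_abs// -EFinM exprSr.
- by apply/measurable_EFinP; exact: measurable_exp_abs.
- by rewrite exprn_ge0// divr_ge0// ltW.
Qed.

Lemma integrable_laplace (R : realType) (d : nat) (s : R) : 0 < s ->
  (lebesgue_rV R d).-integrable [set: 'rV[R]_d] (EFin \o laplace s).
Proof.
move=> s0; apply/integrableP; split.
  by apply/measurable_EFinP; exact: measurable_laplace.
rewrite (_ : integral _ _ _ = ((2 / s) ^+ d)%:E) ?ltry//.
rewrite -(integral_laplace d s0); apply: eq_integral => w _ /=.
by rewrite ger0_norm// laplace_ge0.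
Qed.

Lemma integrable_laplaceM (R : realType) (d : nat) (s c : R) (f : 'rV[R]_d -> R) :
  0 < s -> measurable_fun [set: 'rV[R]_d] f -> (forall w, `|f w| <= c) ->
  (lebesgue_rV R d).-integrable [set: 'rV[R]_d]
    (EFin \o (fun w => laplace s w * f w)).
Proof.
move=> s0 mf fc.
apply: (@le_integrable _ _ _ _ _ _ _ (EFin \o (fun w => c * laplace s w))) => //.
- apply/measurable_EFinP; apply: measurable_funM => //; exact: measurable_laplace.
- move=> w _; rewrite /= lee_fin normrM (ger0_norm (laplace_ge0 _ _)) mulrC.
  apply: le_trans (ler_norm _).
  by rewrite ler_wpM2r ?laplace_ge0.
- have := integrableZl measurableT c (integrable_laplace d s0).
  by apply: eq_integrable => // w _ /=; rewrite EFinM.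
Qed.

(** The phase th makes the induction on the dimension close: integrating out the
    last coordinates leaves a cosine in the first one, with a new phase. *)
Lemma integral_laplace_cos (R : realType) (d : nat) (s th : R) (x : 'rV[R]_d) :
  0 < s ->
  (\int[lebesgue_rV R d]_w (laplace s w * cos (dotp w x + th))%:E =
   (\prod_i (2 * s / (s ^+ 2 + x 0 i ^+ 2)) * cos th)%:E)%E.
Proof.
move=> s0.
have mc n (y : 'rV[R]_n) t : measurable_fun [set: 'rV[R]_n] (fun w => cos (dotp w y + t)).
  apply: measurableT_comp; first exact: measurable_cos.
  by apply: measurable_funD => //; exact: measurable_dotp.
have bc n (y : 'rV[R]_n) t w : `|cos (dotp w y + t)| <= 1.
  by rewrite ler_norml cos_geN1 cos_le1.
elim: d x th => [|n IHn] x th.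
  rewrite /= integral_dirac//=; last first.
    by apply/measurable_EFinP; apply: measurable_funM; [exact: measurable_laplace|exact: mc].
  by rewrite diracT mul1e /laplace /norm1 /dotp !big_ord0 mulr0 oppr0 expR0 add0r.
rewrite integral_rVS; last exact: integrable_laplaceM (bc _ _ _).
set x' : 'rV[R]_n := \row_i x 0 (lift ord0 i).
pose P := \prod_i (2 * s / (s ^+ 2 + x' 0 i ^+ 2)).
transitivity (\int[@lebesgue_measure R]_a
  (P%:E * (expR (- (s * `|a|)) * cos (x 0 ord0 * a + th))%:E))%E.
  apply: eq_integral => a _.
  transitivity (\int[lebesgue_rV R n]_v ((expR (- (s * `|a|)))%:E *
     (laplace s v * cos (dotp v x' + (x 0 ord0 * a + th)))%:E))%E.
    apply: eq_integral => v _; rewrite -EFinM laplace_consv dotp_consv.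
    by congr (_%:E); rewrite mulrA; congr (_ * cos _); rewrite addrA (addrC (dotp _ _)).
  rewrite integralZl//; last exact: integrable_laplaceM (bc _ _ _).
  by rewrite IHn -!EFinM; congr (_%:E); rewrite mulrCA.
rewrite integralZl//; last first.
  apply: le_integrable (integrable_exp_abs s0) => //.
  - apply/measurable_EFinP; apply: measurable_funM; first exact: measurable_exp_abs.
    apply: measurableT_comp; first exact: measurable_cos.
    by apply: measurable_funD => //; apply: measurable_funM.
  - move=> w _; rewrite /= lee_fin normrM (ger0_norm (expR_ge0 _)) ler_piMr ?expR_ge0//.
    by rewrite ler_norml cos_geN1 cos_le1.
rewrite integral_exp_abs_cos// -EFinM big_ord_recl; congr (_%:E).
rewrite mulrCA mulrA /P; congr (_ * _ * _).
by apply: eq_bigr => i _; rewrite mxE.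
Qed.

(** * Quadratic forms of a kernel and their spectral representation *)

(** The square modulus of sum_j a_j e^{i w.X_j}. *)
Definition trigsq {R : realType} {d n : nat} (a : 'I_n -> R)
    (X : 'I_n -> 'rV[R]_d) (w : 'rV[R]_d) : R :=
  (\sum_j a j * cos (dotp w (X j))) ^+ 2 + (\sum_j a j * sin (dotp w (X j))) ^+ 2.

Definition quadf {R : realType} {d n : nat} (k : 'rV[R]_d -> R) (a : 'I_n -> R)
    (X : 'I_n -> 'rV[R]_d) : R :=
  \sum_i \sum_j a i * a j * k (X i - X j).

Lemma dotpBr (R : realType) (d : nat) (w x y : 'rV[R]_d) :
  dotp w (x - y) = dotp w x - dotp w y.
Proof. by rewrite /dotp -sumrB; apply: eq_bigr => i _; rewrite !mxE mulrBr. Qed.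

Lemma trigsqE (R : realType) (d n : nat) (a : 'I_n -> R) (X : 'I_n -> 'rV[R]_d) w :
  trigsq a X w = \sum_i \sum_j a i * a j * cos (dotp w (X i - X j)).
Proof.
rewrite /trigsq !expr2 !big_distrlr/= -big_split/=; apply: eq_bigr => i _.
rewrite -big_split/=; apply: eq_bigr => j _; rewrite dotpBr cosB; ring.
Qed.

Lemma trigsq_ge0 (R : realType) (d n : nat) (a : 'I_n -> R) (X : 'I_n -> 'rV[R]_d) w :
  0 <= trigsq a X w.
Proof. by rewrite addr_ge0 ?sqr_ge0. Qed.

Lemma measurable_trigsq (R : realType) (d n : nat) (a : 'I_n -> R) (X : 'I_n -> 'rV[R]_d) :
  measurable_fun [set: 'rV[R]_d] (trigsq a X).
Proof.
apply: measurable_funD; apply: measurable_funX; apply: measurable_sum => i;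
  apply: measurable_funM => //; apply: measurableT_comp.
- exact: measurable_cos.
- exact: measurable_dotp.
- exact: measurable_sin.
- exact: measurable_dotp.
Qed.

(** This is how kernels meet frequencies: expanding the square modulus gives the
    cosines of the differences of the nodes, whose integrals are the kernel. *)
Lemma integral_trigsq (R : realType) (d : nat) (f k : 'rV[R]_d -> R) :
  (lebesgue_rV R d).-integrable [set: 'rV[R]_d] (EFin \o f) ->
  (forall x, \int[lebesgue_rV R d]_w (cos (dotp w x) * f w)%:E = (k x)%:E)%E ->
  forall (n : nat) (a : 'I_n -> R) (X : 'I_n -> 'rV[R]_d),
  (\int[lebesgue_rV R d]_w (trigsq a X w * f w)%:E = (quadf k a X)%:E)%E.
Proof.
move=> intf fk n a X.
have intc x : (lebesgue_rV R d).-integrable [set: 'rV[R]_d]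
    (fun w => (cos (dotp w x) * f w)%:E).
  apply: le_integrable (intf) => //.
    apply/measurable_EFinP; apply: measurable_funM.
      by apply: measurableT_comp; [exact: measurable_cos|exact: measurable_dotp].
    by apply/measurable_EFinP; exact: measurable_int intf.
  move=> w _ /=; rewrite lee_fin normrM ler_piMl//.
  by rewrite ler_norml cos_geN1 cos_le1.
transitivity (\int[lebesgue_rV R d]_w \sum_i \sum_j
   ((a i * a j)%:E * (cos (dotp w (X i - X j)) * f w)%:E))%E.
  apply: eq_integral => w _; rewrite trigsqE mulr_suml -sumEFin.
  apply: eq_bigr => i _; rewrite mulr_suml -sumEFin; apply: eq_bigr => j _.
  by rewrite -EFinM; congr (_%:E); ring.
rewrite integral_sum//=; last first.
  by move=> i; apply: integrable_sum => // j _; exact: integrableZl.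
rewrite /quadf -sumEFin; apply: eq_bigr => i _.
rewrite integral_sum//=; last by move=> j; exact: integrableZl.
rewrite -sumEFin; apply: eq_bigr => j _.
by rewrite integralZl// fk -EFinM.
Qed.

Lemma integral_trigsq_spectral (R : realType) (d n : nat) (Psi f : 'rV[R]_d -> R)
  (a : 'I_n -> R) (X : 'I_n -> 'rV[R]_d) :
  spectral_density Psi f ->
  (\int[lebesgue_rV R d]_w (trigsq a X w * f w)%:E = (quadf Psi a X)%:E)%E.
Proof.
move=> [intf fPsi]; apply: integral_trigsq => // x.
have [<- _] := fPsi x; rewrite /Rintegral fineK//.
apply: integrable_fin_num => //.
apply: le_integrable (intf) => //.
  apply/measurable_EFinP; apply: measurable_funM.
    by apply: measurableT_comp; [exact: measurable_cos|exact: measurable_dotp].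
  by apply/measurable_EFinP; exact: measurable_int intf.
move=> w _ /=; rewrite lee_fin normrM ler_piMl//.
by rewrite ler_norml cos_geN1 cos_le1.
Qed.

(** The Fourier transform of the window exp (- |w|_1 / L), normalized to be 1 at
    the origin. *)
Definition cauchy_prod {R : realType} {d : nat} (L : R) (y : 'rV[R]_d) : R :=
  \prod_i (1 + (L * y 0 i) ^+ 2)^-1.

Lemma integral_laplace_trigsq (R : realType) (d n : nat) (L : R)
  (a : 'I_n -> R) (X : 'I_n -> 'rV[R]_d) : 0 < L ->
  (\int[lebesgue_rV R d]_w (laplace L^-1 w * trigsq a X w)%:E =
   ((2 * L) ^+ d * quadf (cauchy_prod L) a X)%:E)%E.
Proof.
move=> L0.
transitivity (\int[lebesgue_rV R d]_w (trigsq a X w * laplace L^-1 w)%:E)%E.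
  by apply: eq_integral => w _; rewrite mulrC.
have Li : 0 < L^-1 by rewrite invr_gt0.
rewrite (@integral_trigsq R d (laplace L^-1) (fun x => (2 * L) ^+ d * cauchy_prod L x)).
- rewrite /quadf mulr_sumr; congr (_%:E); apply: eq_bigr => i _.
  by rewrite mulr_sumr; apply: eq_bigr => j _; ring.
- exact: integrable_laplace.
- move=> x; transitivity (\int[lebesgue_rV R d]_w (laplace L^-1 w * cos (dotp w x + 0))%:E)%E.
    by apply: eq_integral => w _; rewrite addr0 mulrC.
  rewrite integral_laplace_cos// cos0 mulr1; congr (_%:E).
  transitivity (\prod_i ((2 * L) * (1 + (L * x 0 i) ^+ 2)^-1)); last first.
    by rewrite big_split/= prodr_const card_ord.
  apply: eq_bigr => i _.
  have p1 : 1 + (L * x 0 i) ^+ 2 != 0 by rewrite gt_eqF// ltr_wpDr ?sqr_ge0.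
  field.
  by rewrite p1 gt_eqF.
Qed.

(** * Trigonometric sums with separated nodes *)

Section cells.
Context {R : realType}.
Implicit Types (eta L c : R) (m : int).

(** Rounding to the nearest multiple of eta.  The nearest-integer convention
    guarantees that a coordinate in cell m <> 0 has size at least |m| eta / 2,
    which fails for the floor. *)
Definition cell eta (y : R) : int := Num.floor (y / eta + 2^-1).

Definition cell_bound c m : R := if m == 0 then 1 else c / (m%:~R ^+ 2).

Lemma cell_dist eta y : 0 < eta ->
  (cell eta y)%:~R - 2^-1 <= y / eta < (cell eta y)%:~R + 2^-1.
Proof.
move=> eta0; have /andP[h1 h2] := real_floor_itv (num_real (y / eta + 2^-1)).
rewrite /cell; move: h2; rewrite intrD => h2; apply/andP; split; lra.
Qed.

Lemma cell_inj eta y z : 0 < eta -> cell eta y = cell eta z -> `|y - z| < eta.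
Proof.
move=> eta0 yz; have /andP[y1 y2] := cell_dist y eta0.
have /andP[z1 z2] := cell_dist z eta0.
rewrite yz in y1 y2.
have : `|y / eta - z / eta| < 1 by rewrite ltr_norml; apply/andP; split; lra.
by rewrite -mulrBl normrM (gtr0_norm (x := eta^-1)) ?invr_gt0// ltr_pdivrMr// mul1r.
Qed.

Lemma cell_boundP eta L y : 0 < eta -> 0 < L ->
  (1 + (L * y) ^+ 2)^-1 <= cell_bound (4 / (L * eta) ^+ 2) (cell eta y).
Proof.
move=> eta0 L0; rewrite /cell_bound; case: eqVneq => [_|m0].
  by rewrite invf_le1 ?lerDl ?sqr_ge0// ltr_wpDr ?sqr_ge0.
set m := cell eta y in m0 *.
have Le : 0 < (L * eta) ^+ 2 by rewrite exprn_gt0// mulr_gt0.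
have m1 : (1 : R) <= `|m%:~R|.
  by rewrite -intr_norm ler1z -gtz0_ge1 normr_gt0.
have my : `|m%:~R| / 2 <= `|y / eta|.
  have /andP[y1 y2] := cell_dist y eta0; rewrite -/m in y1 y2.
  have h : `|m%:~R - y / eta| <= 2^-1 by rewrite ler_norml; apply/andP; split; lra.
  have := ler_normD (m%:~R - y / eta) (y / eta); rewrite subrK.
  by move: m1 h; lra.
have m2 : 0 < m%:~R ^+ 2 :> R by rewrite exprn_even_gt0//= intr_eq0.
rewrite -[leRHS]invrK lef_pV2 ?posrE ?ltr_wpDr ?sqr_ge0//; last first.
  by rewrite invr_gt0 divr_gt0// divr_gt0.
have -> : (L * y) ^+ 2 = (L * eta) ^+ 2 * `|y / eta| ^+ 2.
  by rewrite real_normK ?num_real//; field; rewrite gt_eqF.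
have : (`|m%:~R| / 2) ^+ 2 <= `|y / eta| ^+ 2 by rewrite lerXn2r ?nnegrE ?divr_ge0.
rewrite expr_div_n real_normK ?num_real// => h.
have := ler_wpM2l (ltW Le) h.
set A := (L * eta) ^+ 2 in Le *; set M := m%:~R ^+ 2 in m2 *.
rewrite (_ : (_ / _ / _)^-1 = A * (M / 2 ^+ 2)); first lra.
by field; rewrite !gt_eqF.
Qed.

(** Telescoping 1 / m^2 <= 2 (1 / m - 1 / (m + 1)). *)
Lemma sum_cell_bound c (N : nat) : 0 <= c ->
  \sum_(a < (N + N).+1) cell_bound c (a%:Z - N%:Z) <= 1 + 4 * c * (1 - N.+1%:R^-1).
Proof.
move=> c0; elim: N => [|N IHN].
  by rewrite big_ord1/= subrr /cell_bound eqxx invr1 subrr mulr0 addr0.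
rewrite addSn addnS big_ord_recl big_ord_recr/=.
rewrite (eq_bigr (fun a : 'I_(N + N).+1 => cell_bound c (a%:Z - N%:Z))); last first.
  by move=> a _; congr cell_bound; rewrite /= /bump; lia.
have -> : cell_bound c (0%N%:Z - N.+1%:Z) = c / N.+1%:R ^+ 2.
  rewrite /cell_bound; case: eqVneq => [|_]; first lia.
  by rewrite sub0r mulrNz sqrrN.
have -> : cell_bound c ((bump 0 (N + N).+1)%:Z - N.+1%:Z) = c / N.+1%:R ^+ 2.
  rewrite /cell_bound; case: eqVneq => [|_]; first by rewrite /bump; lia.
  by rewrite (_ : _ - _ = N.+1%:Z)//; rewrite /bump; lia.
have h0 (k : R) : 1 <= k -> 2 / k ^+ 2 <= 4 * (k^-1 - (k + 1)^-1).
  move=> k1; rewrite -subr_ge0 (_ : _ - _ = 2 * (k - 1) / (k ^+ 2 * (k + 1))); last first.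
    by field; apply/andP; split; rewrite gt_eqF//; lra.
  rewrite divr_ge0//; first by rewrite mulr_ge0// subr_ge0.
  by rewrite mulr_ge0 ?sqr_ge0// addr_ge0//; lra.
have h : 2 / N.+1%:R ^+ 2 <= 4 * (N.+1%:R^-1 - N.+2%:R^-1) :> R.
  by rewrite -[N.+2%:R]natr1; apply: h0; rewrite ler1n.
have := ler_wpM2l c0 h; move: IHN; set S := \sum_(_ < _) _.
move: (N.+1%:R^-1) (N.+2%:R^-1) (N.+1%:R ^+ 2)^-1 S => u v y S; lra.
Qed.

End cells.

Lemma expr1D_le (R : realType) (d : nat) (u : R) : 0 <= u -> 4 * (d%:R * u) <= 1 ->
  (1 + u) ^+ d <= 3 / 2.
Proof.
move=> u0 du.
have h : (1 + u) ^+ d <= expR (d%:R * u).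
  rewrite expRM_natl; apply: lerXn2r; rewrite ?nnegrE ?expR_ge0 ?expR_ge1Dx//.
  by rewrite addr_ge0.
apply: le_trans h _.
have h1 : expR (d%:R * u) * expR (- (d%:R * u)) = 1 by rewrite -expRD subrr expR0.
have h2 := expR_ge1Dx (- (d%:R * u)).
have h3 := expR_ge0 (d%:R * u).
by nra.
Qed.

(** Separated points lie in different cells, so the sum is dominated by the sum of
    the product bound over all nonzero cells, that is by (1 + 4 c)^d - 1 with
    c = 4 / (L eta)^2. The sum over each coordinate includes the cell 0: only
    the whole multi-index is nonzero. *)
Lemma cauchy_prod_offdiag (R : realType) (d n : nat) (X : 'I_n -> 'rV[R]_d) (eta L : R) :
  0 < eta -> 0 < L -> 256 * d%:R <= (L * eta) ^+ 2 ->
  (forall j k, j != k -> exists i, eta <= `|X j 0 i - X k 0 i|) ->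
  forall j, \sum_(k | k != j) cauchy_prod L (X j - X k) <= 2^-1.
Proof.
move=> eta0 L0 hL sep j.
pose m (k : 'I_n) (i : 'I_d) : int := cell eta (X j 0 i - X k 0 i).
have Le : 0 < (L * eta) ^+ 2 by rewrite exprn_gt0// mulr_gt0.
have [c cE c0] : exists2 c : R, c = 4 / (L * eta) ^+ 2 & 0 <= c.
  by exists (4 / (L * eta) ^+ 2); rewrite // divr_ge0// ltW.
pose N : nat := \sum_k \sum_i `|m k i|%N.
have mN k i : (`|m k i| <= N)%N.
  by rewrite /N (bigD1 k)//= (bigD1 i)//= -addnA leq_addr.
pose g (k : 'I_n) : {ffun 'I_d -> 'I_(N + N).+1} := [ffun i => inord (absz (m k i + N%:Z)%R)].
have gE k i : (g k i)%:Z - N%:Z = m k i.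
  rewrite ffunE inordK; have := mN k i; lia.
have ginj : injective g.
  move=> k k' gg; apply/eqP/negPn/negP => /sep[i] h.
  have : cell eta (X j 0 i - X k 0 i) = cell eta (X j 0 i - X k' 0 i).
    by rewrite -/(m k i) -/(m k' i) -gE -[RHS]gE gg.
  move/(cell_inj eta0); rewrite ltNge => /negP; apply; rewrite distrC.
  by rewrite (_ : _ - _ = X k 0 i - X k' 0 i)//; ring.
pose B (f : {ffun 'I_d -> 'I_(N + N).+1}) := \prod_i cell_bound c ((f i)%:Z - N%:Z).
have cb0 z : 0 <= cell_bound c z.
  by rewrite /cell_bound; case: ifP => // _; rewrite divr_ge0// sqr_ge0.
have B0 f : 0 <= B f by apply: prodr_ge0.
have gj : B (g j) = 1.
  rewrite /B big1// => i _; rewrite gE /m subrr /cell mul0r add0r /cell_bound.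
  rewrite (_ : Num.floor _ = 0)// (@floor_def _ _ 0)//; apply/andP; split; lra.
have step k : cauchy_prod L (X j - X k) <= B (g k).
  apply: ler_prod => i _; rewrite invr_ge0 addr_ge0 ?sqr_ge0//= gE !mxE.
  by rewrite cE; exact: cell_boundP.
apply: (@le_trans _ _ (\sum_(k | k != j) B (g k))); first exact: ler_sum.
have tot : \sum_k B (g k) <= \sum_f B f.
  have -> : \sum_k B (g k) = \sum_(f in (g @: [set: 'I_n])%SET) B f.
    rewrite big_imset/=; last by move=> ? ? _ _; exact: ginj.
    by apply: eq_bigl => k; rewrite inE.
  rewrite [leRHS](bigID (fun f => f \in (g @: [set: 'I_n])%SET))/= lerDl.
  by apply: sumr_ge0.
rewrite -(lerD2l (B (g j))) -(bigD1 (P := xpredT) (F := fun k => B (g k)) j)//= gj.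
apply: le_trans tot _.
rewrite /B -(bigA_distr_bigA (fun i (a : 'I_(N+N).+1) => cell_bound c (a%:Z - N%:Z))).
rewrite prodr_const card_ord.
have cS := @sum_cell_bound R c N c0.
apply: (@le_trans _ _ ((1 + 4 * c) ^+ d)).
  apply: lerXn2r; rewrite ?nnegrE ?sumr_ge0 ?addr_ge0 ?mulr_ge0//.
  by apply: le_trans cS _; rewrite lerD2l ler_piMr ?mulr_ge0// gerBl invr_ge0.
apply: le_trans (@expr1D_le R d (4 * c) _ _) _; rewrite ?mulr_ge0//; last lra.
rewrite cE -(ler_pM2r Le) (_ : _ * _ = 64 * d%:R).
  have d0 : 0 <= d%:R :> R by [].
  by lra.
by field; rewrite !gt_eqF.
Qed.

(** Schur's test: by symmetry of the kernel the off-diagonal part is at most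
    the largest off-diagonal row sum times the square norm of a. *)
Lemma quadf_cauchy_prod (R : realType) (d n : nat) (X : 'I_n -> 'rV[R]_d)
    (eta L : R) (a : 'I_n -> R) :
  0 < eta -> 0 < L -> 256 * d%:R <= (L * eta) ^+ 2 ->
  (forall j k, j != k -> exists i, eta <= `|X j 0 i - X k 0 i|) ->
  `|quadf (cauchy_prod L) a X - \sum_j a j ^+ 2| <= 2^-1 * \sum_j a j ^+ 2.
Proof.
move=> eta0 L0 hL sep.
pose K j k := cauchy_prod L (X j - X k).
have K0 j k : 0 <= K j k.
  by apply: prodr_ge0 => i _; rewrite invr_ge0 addr_ge0// sqr_ge0.
have KC j k : K j k = K k j.
  by apply: eq_bigr => i _; rewrite -(opprB (X k)) mxE mulrN sqrrN.
have K1 j : K j j = 1.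
  by rewrite /K subrr /cauchy_prod big1// => i _; rewrite mxE mulr0 expr0n addr0 invr1.
have -> : quadf (cauchy_prod L) a X - \sum_j a j ^+ 2 =
    \sum_j \sum_(k | k != j) a j * a k * K j k.
  rewrite /quadf -sumrB; apply: eq_bigr => j _.
  by rewrite (bigD1 j)//= -/(K j j) K1 mulr1 -expr2 addrAC subrr add0r.
apply: le_trans (ler_norm_sum _ _ _) _.
apply: (@le_trans _ _ (\sum_j \sum_(k | k != j) (2^-1 * a j ^+ 2 * K j k + 2^-1 * a k ^+ 2 * K j k))).
  apply: ler_sum => j _; apply: le_trans (ler_norm_sum _ _ _) _.
  apply: ler_sum => k _; rewrite -mulrDl normrM (ger0_norm (K0 _ _)) ler_wpM2r//.
  rewrite normrM -mulrDr -[a j ^+ 2]real_normK ?num_real// -[a k ^+ 2]real_normK ?num_real//.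
  have := sqr_ge0 (`|a j| - `|a k|); rewrite sqrrB; lra.
have S1 : \sum_j \sum_(k | k != j) 2^-1 * a j ^+ 2 * K j k <= 2^-1 * (2^-1 * \sum_j a j ^+ 2).
  rewrite !mulr_sumr; apply: ler_sum => j _; rewrite -mulr_sumr -mulrA.
  rewrite ler_pM2l// mulrC ler_wpM2r ?sqr_ge0//; exact: cauchy_prod_offdiag sep _.
have S2 : \sum_j \sum_(k | k != j) 2^-1 * a k ^+ 2 * K j k =
          \sum_j \sum_(k | k != j) 2^-1 * a j ^+ 2 * K j k.
  rewrite (exchange_big_dep xpredT)//=; apply: eq_bigr => k _.
  by apply: eq_big => [j|j _]; [rewrite eq_sym|rewrite KC].
under eq_bigr do rewrite big_split/=.
by rewrite big_split/= S2; move: S1; lra.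
Qed.

(** Exponentials with separated nodes behave like an orthogonal system in the
    window of width L as soon as L times the separation is large. *)
Lemma laplace_trigsq_bounds (R : realType) (d n : nat) (X : 'I_n -> 'rV[R]_d)
    (eta L : R) (a : 'I_n -> R) :
  0 < eta -> 0 < L -> 256 * d%:R <= (L * eta) ^+ 2 ->
  (forall j k, j != k -> exists i, eta <= `|X j 0 i - X k 0 i|) ->
  let J := (\int[lebesgue_rV R d]_w (laplace L^-1 w * trigsq a X w)%:E)%E in
  (((2 * L) ^+ d * (2^-1 * \sum_j a j ^+ 2))%:E <= J /\
   J <= ((2 * L) ^+ d * (2 * \sum_j a j ^+ 2))%:E)%E.
Proof.
move=> eta0 L0 hL sep J; rewrite /J integral_laplace_trigsq// !lee_fin.
have := quadf_cauchy_prod a eta0 L0 hL sep.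
have s0 : 0 <= \sum_j a j ^+ 2 by apply: sumr_ge0 => j _; exact: sqr_ge0.
rewrite ler_norml => /andP[h1 h2].
by split; rewrite ler_pM2l ?exprn_gt0 ?mulr_gt0//; move: h1 h2; lra.
Qed.

(** * The Sobolev weight at high frequencies *)

(** The spectral profile of smoothness nu, for which H^(nu + d/2) is the
    native space. *)
Definition sobolev_weight {R : realType} {d : nat} (nu : R) (w : 'rV[R]_d) : R :=
  (1 + enorm w ^+ 2) `^ (- (nu + d%:R / 2)).

Lemma enormE (R : realType) (d : nat) (w : 'rV[R]_d) :
  enorm w ^+ 2 = \sum_i w 0 i ^+ 2.
Proof.
rewrite /enorm sqr_sqrtr; last by apply: sumr_ge0 => i _; rewrite -expr2 sqr_ge0.
by apply: eq_bigr => i _; rewrite expr2.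
Qed.

Lemma enorm_ge0 (R : realType) (d : nat) (w : 'rV[R]_d) : 0 <= enorm w.
Proof. exact: sqrtr_ge0. Qed.

Lemma norm1_ge0 (R : realType) (d : nat) (w : 'rV[R]_d) : 0 <= norm1 w.
Proof. exact: sumr_ge0. Qed.

Lemma norm1_sqr_le (R : realType) (d : nat) (w : 'rV[R]_d) :
  norm1 w ^+ 2 <= d%:R * enorm w ^+ 2.
Proof.
rewrite enormE /norm1 expr2 big_distrlr/=.
apply: (@le_trans _ _ (\sum_(i < d) \sum_(j < d) (2^-1 * w 0 i ^+ 2 + 2^-1 * w 0 j ^+ 2))).
  apply: ler_sum => i _; apply: ler_sum => j _.
  rewrite -[w 0 i ^+ 2]real_normK ?num_real// -[w 0 j ^+ 2]real_normK ?num_real//.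
  have := sqr_ge0 (`|w 0 i| - `|w 0 j|); rewrite sqrrB; lra.
rewrite (eq_bigr (fun i => d%:R * (2^-1 * w 0 i ^+ 2) + \sum_(j < d) 2^-1 * w 0 j ^+ 2)).
  rewrite big_split/= sumr_const card_ord -mulr_natl -!mulr_sumr.
  by move: (\sum_(i < d) _) => S; lra.
by move=> i _; rewrite big_split; congr (_ + _); rewrite sumr_const card_ord mulr_natl.
Qed.

Lemma enorm_sqr_le (R : realType) (d : nat) (w : 'rV[R]_d) :
  enorm w ^+ 2 <= norm1 w ^+ 2.
Proof.
rewrite enormE /norm1 [leRHS]expr2 mulr_suml; apply: ler_sum => i _.
rewrite -[w 0 i ^+ 2]real_normK ?num_real// expr2 ler_wpM2l//.
by rewrite (bigD1 i)//= lerDl sumr_ge0.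
Qed.

Lemma powRN_le (R : realType) (x y a : R) : 0 < x -> x <= y -> 0 <= a ->
  y `^ (- a) <= x `^ (- a).
Proof.
move=> x0 xy a0; have y0 := lt_le_trans x0 xy.
rewrite !powRN lef_pV2 ?posrE ?powR_gt0// ge0_ler_powR ?nnegrE// ltW//.
Qed.

Lemma sobolev_weight_ge0 (R : realType) (d : nat) (nu : R) (w : 'rV[R]_d) :
  0 <= sobolev_weight nu w.
Proof. exact: powR_ge0. Qed.

Lemma sobolev_weight_le (R : realType) (d : nat) (nu r : R) (w : 'rV[R]_d) :
  (0 < d)%N -> 0 < nu -> 0 < r -> r <= norm1 w ->
  sobolev_weight nu w <= d%:R `^ (nu + d%:R / 2) * r `^ (- (2 * nu)) / r ^+ d.
Proof.
move=> d0 nu0 r0 rw; have dR : 0 < d%:R :> R by rewrite ltr0n.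
have a0 : 0 <= nu + d%:R / 2 by rewrite addr_ge0 ?divr_ge0// ltW.
apply: (@le_trans _ _ ((r ^+ 2 / d%:R) `^ (- (nu + d%:R / 2)))).
  apply: powRN_le => //; first by rewrite divr_gt0// exprn_gt0.
  rewrite ler_pdivrMr// mulrC; apply: (@le_trans _ _ (norm1 w ^+ 2)).
    by rewrite lerXn2r ?nnegrE ?norm1_ge0// ltW.
  apply: le_trans (norm1_sqr_le w) _; rewrite ler_wpM2l ?ler0n//; lra.
rewrite powRM ?invr_ge0 ?ler0n ?exprn_ge0 ?(ltW r0)//.
rewrite mulrC -powR_inv1 ?ler0n// -powRrM mulN1r opprK -mulrA ler_wpM2l ?powR_ge0//.
rewrite -powR_mulrn ?(ltW r0)// -powRrM -powR_mulrn ?(ltW r0)// -powRN -powRD; last first.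
  by rewrite (gt_eqF r0) implybT.
rewrite (_ : 2%:R * _ = - (2 * nu) - d%:R)//; lra.
Qed.

Lemma measurable_enorm_sqr (R : realType) (d : nat) :
  measurable_fun [set: 'rV[R]_d] (fun w : 'rV[R]_d => enorm w ^+ 2).
Proof.
rewrite [X in measurable_fun _ X](_ : _ = (fun w : 'rV[R]_d => \sum_i w 0 i ^+ 2)); last first.
  by apply/funext => w; rewrite enormE.
apply: measurable_sum => i; apply: measurable_funX; exact: measurable_rV_coord.
Qed.

Lemma measurable_sobolev_weight (R : realType) (d : nat) (nu : R) :
  measurable_fun [set: 'rV[R]_d] (@sobolev_weight R d nu).
Proof.
apply: (measurableT_comp (measurable_powR _)).
by apply: measurable_funD => //; exact: measurable_enorm_sqr.
Qed.

Lemma dyadic_shell (R : realType) (L r : R) : 0 < L -> L < r ->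
  exists k, 2 ^+ k * L < r <= 2 ^+ k.+1 * L.
Proof.
move=> L0 Lr.
have ex : exists k, r <= 2 ^+ k.+1 * L.
  exists (Num.truncn (r / L)); rewrite -ler_pdivrMr//.
  apply: le_trans (ltW (truncnS_gt _)) _.
  by rewrite -natrX ler_nat ltnW// ltn_expl.
case: (ex_minnP ex) => -[|k] hk kmin; [exists 0%N|exists k.+1].
  by rewrite expr0 mul1r Lr hk.
rewrite hk andbT ltNge; apply/negP => /kmin; by rewrite ltnn.
Qed.

(** Dyadic decomposition: on the shell 2^k L < |w|_1 <= 2^(k+1) L the Sobolev
    weight is of order (2^k L)^(- 2 nu - d) while the window of width 2^(k+1) L is
    at least 1/e, so each shell contributes (2^k L)^(- 2 nu) and the series is
    geometric. *)
Lemma high_frequency_bound (R : realType) (d : nat) (nu : R) :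
  (0 < d)%N -> 0 < nu -> exists2 C : R, 0 < C &
  forall (S : 'rV[R]_d -> R) (B L : R),
    measurable_fun [set: 'rV[R]_d] S -> (forall w, 0 <= S w) -> 0 <= B -> 0 < L ->
    (forall K, L <= K ->
      (\int[lebesgue_rV R d]_w (laplace K^-1 w * S w)%:E <= (B * (2 * K) ^+ d)%:E)%E) ->
    (\int[lebesgue_rV R d]_(w in [set w | (L < norm1 w)%R])
       (S w * sobolev_weight nu w)%:E <= (C * B * L `^ (- (2 * nu)))%:E)%E.
Proof.
move=> d0 nu0.
pose q : R := 2 `^ (- (2 * nu)).
have q0 : 0 < q by rewrite powR_gt0.
have q1 : q < 1.
  rewrite /q powRN invf_lt1 ?powR_gt0//.
  have := @gt0_ltr_powR R (2 * nu) _ 1 2; rewrite powR1; apply; rewrite ?nnegrE//.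
    by rewrite mulr_gt0.
  by rewrite ltr1n.
pose A : R := d%:R `^ (nu + d%:R / 2).
have A0 : 0 < A by rewrite powR_gt0// ltr0n.
(* q is the ratio of the geometric series over the shells. *)
pose C := expR 1 * A * 4 ^+ d / (1 - q).
have q1' : 0 < 1 - q by rewrite subr_gt0.
exists C; first by rewrite divr_gt0// !mulr_gt0 ?expR_gt0 ?exprn_gt0.
move=> S B L mS S0 B0 L0 hB.
pose c k := expR 1 * A * (2 ^+ k * L) `^ (- (2 * nu)) / (2 ^+ k * L) ^+ d.
have kL k : 0 < 2 ^+ k * L by rewrite mulr_gt0// exprn_gt0.
have c0 k : 0 <= c k by rewrite divr_ge0 ?mulr_ge0 ?expR_ge0 ?powR_ge0 ?exprn_ge0// ltW.
pose F k w := (c k * (laplace (2 ^+ k.+1 * L)^-1 w * S w))%:E.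
have F0 k w : (0 <= F k w)%E by rewrite lee_fin; apply: mulr_ge0 => //; rewrite mulr_ge0// laplace_ge0.
have mF k : measurable_fun [set: 'rV[R]_d] (F k).
  apply/measurable_EFinP; apply: measurable_funM => //; apply: measurable_funM => //.
  exact: measurable_laplace.
have mD : measurable [set w : 'rV[R]_d | L < norm1 w].
  rewrite (_ : [set w | _] = [set: 'rV[R]_d] `&` (norm1 @^-1` `]L, +oo[)).
    by apply: (measurable_norm1 measurableT); exact: measurable_itv.
  by rewrite setTI; apply/seteqP; split => w /=; rewrite in_itv/= andbT.
have pw w : L < norm1 w -> ((S w * sobolev_weight nu w)%:E <= \sum_(0 <= k <oo) F k w)%E.
  move=> Lw; have [k /andP[k1 k2]] := dyadic_shell L0 Lw.
  apply: (@le_trans _ _ (F k w)); last first.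
    have h : (\sum_(0 <= i < k.+1) F i w <= \sum_(0 <= k <oo) F k w)%E.
      by apply: nneseries_lim_ge => *; exact: F0.
    apply: le_trans h; rewrite big_nat_recr//= leeDr//.
    by apply: sume_ge0.
  rewrite lee_fin mulrA mulrC ler_wpM2r//.
  have h1 := sobolev_weight_le d0 nu0 (kL k) (ltW k1).
  apply: le_trans h1 _; rewrite /c -/A.
  set P := _ `^ _; set Y := _ ^+ d; set e := laplace _ _.
  have -> : expR 1 * A * P / Y * e = A * P / Y * (expR 1 * e) by ring.
  rewrite ler_peMr//.
    by rewrite divr_ge0 ?mulr_ge0 ?powR_ge0 ?exprn_ge0 ?(ltW A0) ?(ltW (kL _)).
  rewrite /e /laplace -expRD -[leLHS]expR0 ler_expR subr_ge0.
  by rewrite mulrC ler_pdivrMr// mul1r.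
have intF k : (\int[lebesgue_rV R d]_w F k w <= (expR 1 * A * 4 ^+ d * B * L `^ (- (2 * nu)) * q ^+ k)%:E)%E.
  rewrite /F; under eq_integral do rewrite EFinM.
  rewrite ge0_integralZl_EFin//; last 2 first.
  - by move=> w _; rewrite lee_fin mulr_ge0 ?laplace_ge0.
  - by apply/measurable_EFinP; apply: measurable_funM => //; exact: measurable_laplace.
  apply: (@le_trans _ _ ((c k)%:E * (B * (2 * (2 ^+ k.+1 * L)) ^+ d)%:E)%E).
    rewrite lee_wpmul2l ?lee_fin//; apply: hB.
    by rewrite ler_peMl ?(ltW L0)// exprn_ege1// ler1n.
  rewrite -EFinM lee_fin /c.
  rewrite powRM ?exprn_ge0 ?(ltW L0)//.
  have -> : (2 ^+ k) `^ (- (2 * nu)) = q ^+ k.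
    by rewrite -powR_mulrn// powRAC powR_mulrn// ltW.
  have -> : 2 * (2 ^+ k.+1 * L) = 4 * (2 ^+ k * L) by rewrite exprS; ring.
  rewrite [(4 * _) ^+ d]exprMn le_eqVlt; apply/orP; left; apply/eqP.
  have : (2 ^+ k * L) ^+ d != 0 by rewrite expf_neq0// gt_eqF.
  move: (_ ^+ d) (4 ^+ d) (q ^+ k) (L `^ _) => Y y4 Q P Y0; by field.
apply: (@le_trans _ _ (\int[lebesgue_rV R d]_w \sum_(0 <= k <oo) F k w)%E).
  apply: (@le_trans _ _ (\int[lebesgue_rV R d]_(w in [set w | (L < norm1 w)%R]) \sum_(0 <= k <oo) F k w)%E).
    apply: ge0_le_integral => //=.
    - by move=> w _; rewrite lee_fin mulr_ge0// sobolev_weight_ge0.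
    - apply/measurable_EFinP/measurable_funTS; apply: measurable_funM => //.
      exact: measurable_sobolev_weight.
    - by apply/measurable_funTS; apply: ge0_emeasurable_sum.
  apply: ge0_subset_integral => //=.
  - by apply: ge0_emeasurable_sum.
  - by move=> w _; apply: nneseries_ge0.
rewrite integral_nneseries//.
apply: lime_le.
  by apply: is_cvg_nneseries => k _ _; apply: integral_ge0.
apply: nearW => n.
apply: le_trans (lee_sum _ (fun k _ => intF k)) _.
rewrite sumEFin lee_fin -mulr_sumr.
have gs : \sum_(0 <= k < n) q ^+ k <= (1 - q)^-1.
  have := @geometric_seriesE R 1 q; rewrite (lt_eqF q1) => /(_ isT) /(congr1 (fun f => f n)).
  rewrite /series/= (eq_bigr (fun k => q ^+ k)); last by move=> k _; rewrite /geometric/= mul1r.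
  move=> ->; rewrite mul1r ler_piMl ?invr_ge0 ?(ltW q1')// gerBl exprn_ge0// ltW//.
apply: le_trans (ler_wpM2l _ gs) _; last by rewrite /C le_eqVlt; apply/orP; left; apply/eqP; ring.
by rewrite !mulr_ge0 ?expR_ge0 ?powR_ge0 ?exprn_ge0// ltW.
Qed.

(** * Reproducing exponentials from points near a grid *)

(** The derivative of cos (u + th) is cos (u + (th + pi / 2)), so the induction on
    the order runs through all phases and covers the sine as well. *)
Lemma cos_taylor (R : realType) (m : nat) (th : R) :
  exists2 p : {poly R}, (size p <= m)%N &
    forall u, `|cos (u + th) - p.[u]| <= `|u| ^+ m.
Proof.
elim: m th => [|m IHm] th.
  exists 0; rewrite ?size_poly0// => u.
  by rewrite horner0 subr0 expr0 ler_norml cos_geN1 cos_le1.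
have [p sp hp] := IHm (th + pi / 2).
pose P : {poly R} := \poly_(i < m.+1) (if i is k.+1 then p`_k / k.+1%:R else cos th).
exists P; first exact: size_poly.
have P' : P^`() = p.
  apply/polyP => i; rewrite coef_deriv coef_poly ltnS.
  case: ltnP => im; last by rewrite mul0rn nth_default// (leq_trans sp).
  by rewrite -[LHS]mulr_natr mulfVK// pnatr_eq0.
have P0 : P.[0] = cos th by rewrite horner_coef0 coef_poly.
pose f (u : R) := cos (u + th) - P.[u].
have df (u : R) : is_derive u (1 : R) f (cos (u + (th + pi / 2)) - p.[u]).
  have g0 : is_derive u (1 : R) (fun u : R => u + th) 1.
    by apply: is_derive_eq; rewrite addr0.
  have g1 := @is_derive1_comp R cos (fun u => u + th) u _ _ _ g0.
  have g2 := is_derive_poly P u; rewrite /comp/= in g1.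
  apply: is_derive_eq; rewrite P' mulr1 addrA cosDpihalf//.
have cf : continuous f.
  by move=> u; apply/differentiable_continuous/derivable1_diffP; have [] := df u.
have f0 : f 0 = 0 by rewrite /f add0r P0 subrr.
have bound u v : `|v| <= `|u| -> `|(cos (v + (th + pi / 2)) - p.[v]) * u| <= `|u| ^+ m.+1.
  move=> vu; rewrite normrM exprSr ler_wpM2r//; apply: le_trans (hp v) _.
  by rewrite lerXn2r ?nnegrE.
move=> u; rewrite -/(f u).
have [u0|u0] := leP 0 u.
  have [v] := MVT_segment u0 (fun x _ => df x) (continuous_subspaceT cf).
  rewrite in_itv/= f0 !subr0 => /andP[v0 vu] ->; apply: bound.
  by rewrite !ger0_norm.
have [v] := MVT_segment (ltW u0) (fun x _ => df x) (continuous_subspaceT cf).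
rewrite in_itv/= f0 !sub0r => /andP[v0 vu] fE.
rewrite -normrN fE mulrN normrN; apply: bound.
by rewrite !ler0_norm ?(ltW u0)// lerN2.
Qed.

Lemma lagrange_basis (R : realType) (m : nat) : (0 < m)%N ->
  exists2 l : 'I_m -> {poly R},
    (forall i j : 'I_m, (l i).[j%:R] = (i == j)%:R) &
    forall p : {poly R}, (size p <= m)%N ->
      forall t, p.[t] = \sum_(i < m) p.[i%:R] * (l i).[t].
Proof.
move=> m0; have inj : injective (fun i : nat => i%:R : R).
  by move=> i j /eqP; rewrite eqr_nat => /eqP.
exists (fun i => tnth (qpoly.lagrange m (fun i : nat => i%:R : R)) i).
  by move=> i j; exact: qpoly.lagrange_sample.
move=> p sp t; rewrite [in LHS](qpoly.lagrange_gen m0 inj sp) horner_sum.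
by apply: eq_bigr => i _; rewrite hornerM hornerC.
Qed.

Section tensor_lagrange.
Context {R : realType} {d m : nat} (l : 'I_m -> {poly R}).

Local Notation multi := {ffun 'I_d -> 'I_m}.

(** The Lagrange basis on the grid.  In this basis the generalized Vandermonde
    matrix of the grid is the identity, so that for perturbed grid points it is
    close to the identity and its inverse is bounded. *)
Definition tensor_basis (b : multi) (y : 'rV[R]_d) : R := \prod_i (l (b i)).[y 0 i].

Definition grid_point (b : multi) : 'rV[R]_d := \row_i (b i)%:R.

Hypothesis lE : forall i j : 'I_m, (l i).[j%:R] = (i == j)%:R.
Hypothesis lgen : forall p : {poly R}, (size p <= m)%N ->
      forall t, p.[t] = \sum_(i < m) p.[i%:R] * (l i).[t].

Lemma tensor_basis_grid b g : tensor_basis b (grid_point g) = (b == g)%:R.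
Proof.
rewrite /tensor_basis; case: eqVneq => [->|bg].
  by rewrite big1// => i _; rewrite mxE lE eqxx.
have [i bgi] : exists i, b i != g i.
  by apply/existsP; rewrite -negb_forall; apply: contra bg => /eqfunP h; apply/eqP/ffunP.
by rewrite (bigD1 i)//= mxE lE (negPf bgi) mul0r.
Qed.

Lemma tensor_interpolation_prod (p : 'I_d -> {poly R}) (y : 'rV[R]_d) :
  (forall i, (size (p i) <= m)%N) ->
  \prod_i (p i).[y 0 i] = \sum_b tensor_basis b y * \prod_i (p i).[grid_point b 0 i].
Proof.
move=> sp; rewrite (eq_bigr (fun i => \sum_(a < m) (p i).[a%:R] * (l a).[y 0 i])); last first.
  by move=> i _; exact: lgen.
rewrite bigA_distr_bigA/=; apply: eq_bigr => b _.
rewrite big_split/= mulrC; congr (_ * _).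
by apply: eq_bigr => i _; rewrite mxE.
Qed.

(** Expanding (w.y)^k over maps from the k factors to the coordinates writes it
    as a combination of products of univariate monomials of degree at most k. *)
Lemma tensor_interpolation_ridge (p : {poly R}) w y : (size p <= m)%N ->
  p.[dotp w y] = \sum_b tensor_basis b y * p.[dotp w (grid_point b)].
Proof.
move=> sp.
have pow k : (k < m)%N ->
    dotp w y ^+ k = \sum_b tensor_basis b y * dotp w (grid_point b) ^+ k.
  move=> km.
  have expand (z : 'rV[R]_d) : dotp w z ^+ k =
      \sum_(f : {ffun 'I_k -> 'I_d}) (\prod_j w 0 (f j)) *
        \prod_i ('X^#|[pred j | f j == i]|).[z 0 i].
    rewrite -[in LHS](card_ord k) -prodr_const /dotp bigA_distr_bigA/=.
    apply: eq_bigr => f _; rewrite big_split/=; congr (_ * _).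
    rewrite (partition_big f xpredT)//=; apply: eq_bigr => i _.
    rewrite hornerXn (eq_bigr (fun=> z 0 i)); last by move=> j /eqP ->.
    by rewrite prodr_const.
  rewrite expand; under [RHS]eq_bigr do rewrite expand mulr_sumr.
  rewrite exchange_big/=; apply: eq_bigr => f _.
  rewrite tensor_interpolation_prod; last first.
    move=> i; rewrite size_polyXn; apply: leq_ltn_trans km.
    by rewrite -[leqRHS](card_ord k) max_card.
  by rewrite mulr_sumr; apply: eq_bigr => b _; rewrite mulrCA.
rewrite horner_coef (eq_bigr (fun i : 'I_(size p) => \sum_b tensor_basis b y * (p`_i * dotp w (grid_point b) ^+ i))).
  rewrite exchange_big/=; apply: eq_bigr => b _.
  by rewrite horner_coef mulr_sumr.
move=> i _; rewrite pow; last exact: leq_trans sp.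
by rewrite mulr_sumr; apply: eq_bigr => b _; rewrite mulrCA.
Qed.

End tensor_lagrange.

(** The a priori bound behind [near_identity_solve]: u differs from its image by
    at most half of its own norm. *)
Lemma near_identity_norm (R : realType) (I : finType) (M : I -> I -> R) (tau : R) :
  (forall i j, `|M i j - (i == j)%:R| <= tau) -> #|I|%:R * tau <= 2^-1 ->
  forall u : I -> R, \sum_i `|u i| <= 2 * \sum_j `|\sum_i u i * M i j|.
Proof.
move=> hM htau u; set s := \sum_i `|u i|.
have s0 : 0 <= s by apply: sumr_ge0.
have pw j : `|u j| <= `|\sum_i u i * M i j| + \sum_i `|u i| * tau.
  have -> : u j = \sum_i u i * M i j - \sum_i u i * (M i j - (i == j)%:R).
    rewrite -sumrB (bigD1 j)//= eqxx big1 => [|i /negPf ij]; last by rewrite ij subr0 subrr.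
    by rewrite addr0 -mulrBr opprB addrC subrK mulr1.
  apply: le_trans (ler_normB _ _) _; rewrite lerD2l.
  apply: le_trans (ler_norm_sum _ _ _) _; apply: ler_sum => i _.
  by rewrite normrM ler_wpM2l.
have : s <= \sum_j (`|\sum_i u i * M i j| + \sum_i `|u i| * tau).
  by apply: ler_sum => j _; exact: pw.
rewrite big_split/= sumr_const -mulr_suml -/s -[(s * tau) *+ _]mulr_natl.
have : s * (#|I|%:R * tau) <= s * 2^-1 by rewrite ler_wpM2l.
rewrite mulrCA; lra.
Qed.

Lemma near_identity_solve (R : realType) (I : finType) (M : I -> I -> R) (tau : R) :
  (forall i j, `|M i j - (i == j)%:R| <= tau) -> #|I|%:R * tau <= 2^-1 ->
  forall v : I -> R, exists2 u : I -> R, (forall j, \sum_i u i * M i j = v j) &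
     \sum_i `|u i| <= 2 * \sum_j `|v j|.
Proof.
move=> hM htau v.
pose A : 'M[R]_#|I| := \matrix_(a, b) M (enum_val a) (enum_val b).
pose f (w : 'rV[R]_#|I|) (i : I) := w 0 (enum_rank i).
have mulE w j : (w *m A) 0 (enum_rank j) = \sum_i f w i * M i j.
  rewrite mxE [RHS](reindex (@enum_val I xpredT)); last first.
    by apply: onW_bij; exact: enum_val_bij.
  by apply: eq_bigr => a _; rewrite mxE /f enum_valK enum_rankK.
have Au : A \in unitmx.
  rewrite -row_free_unit -kermx_eq0; apply/eqP/row_matrixP => a; rewrite row0.
  set w := row a _.
  have wA : w *m A = 0 by rewrite /w -row_mul mulmx_ker row0.
  have := near_identity_norm hM htau (f w).
  rewrite [X in _ <= 2 * X]big1 ?mulr0; last first.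
    by move=> j _; rewrite -mulE wA mxE normr0.
  move=> h; apply/rowP => b; rewrite [RHS]mxE.
  have fb : f w (enum_val b) = w 0 b by rewrite /f enum_valK.
  rewrite -fb; apply/eqP; rewrite -normr_le0; apply: le_trans h.
  by rewrite (bigD1 (enum_val b))//= lerDl sumr_ge0.
pose w := (\row_b v (enum_val b)) *m invmx A.
have uv j : \sum_i f w i * M i j = v j.
  by rewrite -mulE mulmxKV// mxE enum_rankK.
exists (f w) => //; apply: le_trans (near_identity_norm hM htau (f w)) _.
by under eq_bigr do rewrite uv.
Qed.

Lemma horner_bounded (R : realType) (p : {poly R}) (r : R) :
  exists2 B, 0 <= B & forall t, `|t| <= r -> `|p.[t]| <= B.
Proof.
exists (\sum_(i < size p) `|p`_i| * `|r| ^+ i).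
  by apply: sumr_ge0 => i _; rewrite mulr_ge0// exprn_ge0.
move=> t tr; rewrite horner_coef; apply: le_trans (ler_norm_sum _ _ _) _.
apply: ler_sum => i _; rewrite normrM normrX ler_wpM2l// lerXn2r ?nnegrE//.
by apply: le_trans tr (ler_norm _).
Qed.

Lemma tensor_basis_bounded (R : realType) (d m : nat) (l : 'I_m -> {poly R}) (r : R) :
  exists2 B, 0 <= B & forall (b : {ffun 'I_d -> 'I_m}) (z : 'rV[R]_d),
    (forall i, `|z 0 i| <= r) -> `|tensor_basis l b z| <= B.
Proof.
have /choice[B hB] : forall a : 'I_m, exists B,
    0 <= B /\ forall t, `|t| <= r -> `|(l a).[t]| <= B.
  by move=> a; have [B B0 h] := horner_bounded (l a) r; exists B.
pose C := 1 + \sum_a B a.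
have C1 : 1 <= C by rewrite lerDl sumr_ge0// => a _; case: (hB a).
exists (C ^+ d); first by rewrite exprn_ge0// (le_trans ler01).
move=> b z hz; rewrite /tensor_basis normr_prod -[X in _ ^+ X]card_ord -prodr_const.
apply: ler_prod => i _; rewrite normr_ge0/=; case: (hB (b i)) => B0 h.
apply: le_trans (h _ (hz i)) _; rewrite /C (bigD1 (b i))//= addrCA lerDl.
by rewrite addr_ge0// sumr_ge0// => a _; case: (hB a).
Qed.

Lemma finite_modulus (R : realType) (I : finType) (P : I -> R -> Prop) :
  (forall i e e', 0 < e' -> e' <= e -> P i e -> P i e') ->
  (forall i, exists2 e, 0 < e & P i e) -> exists2 e, 0 < e & forall i, P i e.
Proof.
move=> mono ex.
have /choice[e he] : forall i, exists e, 0 < e /\ P i e.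
  by move=> i; have [e e0 h] := ex i; exists e.
pose s := 1 + \sum_i (e i)^-1.
have si i : (e i)^-1 <= s.
  rewrite /s (bigD1 i)//= addrCA lerDl addr_ge0// sumr_ge0// => j _.
  by rewrite invr_ge0 ltW//; case: (he j).
have s0 : 0 < s.
  by rewrite ltr_wpDr// sumr_ge0// => j _; rewrite invr_ge0 ltW//; case: (he j).
exists s^-1; first by rewrite invr_gt0.
move=> i; have [e0 h] := he i; apply: mono h; first by rewrite invr_gt0.
by rewrite -[leRHS]invrK lef_pV2 ?posrE ?invr_gt0.
Qed.

Lemma tensor_basis_continuous (R : realType) (d m : nat) (l : 'I_m -> {poly R})
  (b : {ffun 'I_d -> 'I_m}) : continuous (tensor_basis l b : 'rV[R]_d -> R).
Proof.
rewrite /tensor_basis; elim: (index_enum _) => [|i s IHs] y.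
  by under eq_fun do rewrite big_nil; exact: cst_continuous.
under eq_fun do rewrite big_cons.
apply: (@continuousM _ _ (fun y : 'rV[R]_d => (l (b i)).[y 0 i])); last exact: IHs.
apply: (@continuous_comp _ _ _ (fun y : 'rV[R]_d => y 0 i) (horner (l (b i)))).
  exact: coord_continuous.
exact: continuous_horner.
Qed.

Lemma norm_dotp_le (R : realType) (d : nat) (w z : 'rV[R]_d) (r : R) :
  (forall i, `|z 0 i| <= r) -> `|dotp w z| <= norm1 w * r.
Proof.
move=> hz; apply: le_trans (ler_norm_sum _ _ _) _; rewrite /norm1 mulr_suml.
by apply: ler_sum => i _; rewrite normrM ler_wpM2l.
Qed.

(** The weights solve sum_b u_b L_c(y_b) = L_c(z) for every element L_c of the
    tensor Lagrange basis, a system close to the identity.  They therefore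
    reproduce the Taylor polynomial of cos (w.y + th), of degree less than m in
    w.y, and only the Taylor remainders at z and at the y_b are left. *)
Lemma local_reproduction (R : realType) (d m : nat) (r : R) : (0 < m)%N ->
  exists eps A : R, [/\ 0 < eps, 0 < A &
    forall (y : {ffun 'I_d -> 'I_m} -> 'rV[R]_d) (z : 'rV[R]_d),
      (forall b i, `|y b 0 i - (b i)%:R| <= eps) -> (forall i, `|z 0 i| <= r) ->
      exists2 u : {ffun 'I_d -> 'I_m} -> R, \sum_b `|u b| <= A &
        forall w th, `|cos (dotp w z + th) - \sum_b u b * cos (dotp w (y b) + th)|
          <= A * norm1 w ^+ m].
Proof.
move=> m0; have [l lE lgen] := lagrange_basis R m0.
pose I := {ffun 'I_d -> 'I_m}.
(* Entrywise distance to the identity that still allows the system to be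
   solved with a bounded inverse. *)
pose tau : R := (2 * #|{: I}|%:R + 1)^-1.
have N0 : 0 <= #|{: I}|%:R :> R by [].
have tau0 : 0 < tau by rewrite invr_gt0 ltr_wpDl// mulr_ge0.
have Ntau : #|{: I}|%:R * tau <= 2^-1.
  rewrite /tau ler_pdivrMr; last by rewrite ltr_wpDl// mulr_ge0.
  by move: N0; lra.
have [e0 e00 he0] : exists2 e, 0 < e & forall p : I * I, forall y : 'rV[R]_d,
    (forall i, `|y 0 i - (p.1 i)%:R| <= e) ->
    `|tensor_basis l p.2 y - (p.1 == p.2)%:R| <= tau.
  apply: finite_modulus.
    by move=> p e e' _ e'e h y hy; apply: h => i; apply: le_trans (hy i) e'e.
  move=> [g b]/=.
  have := @tensor_basis_continuous R d m l b (grid_point g).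
  move/cvgrPdist_le => /(_ _ tau0) /nbhs_ballP[e /= e0 he].
  exists (e / 2); first by rewrite divr_gt0.
  move=> y hy; have := he y; rewrite (tensor_basis_grid lE) distrC eq_sym; apply.
  by split=> // i j; rewrite ord1 -ball_normE /ball_/= mxE distrC; apply: le_lt_trans (hy j) _; lra.
have [B B0 hB] := @tensor_basis_bounded R d m l r.
pose eps := Num.min e0 1.
pose A1 := 2 * (#|{: I}|%:R * B).
have A10 : 0 <= A1 by rewrite !mulr_ge0.
pose A := 1 + A1 + `|r| ^+ m + A1 * (m.+1)%:R ^+ m.
have Pr : 0 <= `|r| ^+ m by rewrite exprn_ge0.
have Pk : 0 <= A1 * (m.+1)%:R ^+ m by rewrite mulr_ge0// exprn_ge0.
exists eps, A; split.
- by rewrite lt_min e00/=.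
- by rewrite ltr_wpDr ?mulr_ge0 ?exprn_ge0// ltr_wpDr ?exprn_ge0// ltr_wpDr.
move=> y z hy hz.
have hM (g b : I) : `|tensor_basis l b (y g) - (g == b)%:R| <= tau.
  by apply: (he0 (g, b)) => i; apply: le_trans (hy g i) _; rewrite ge_min lexx.
have [u uE ub] := near_identity_solve hM Ntau (fun b => tensor_basis l b z).
have uA1 : \sum_b `|u b| <= A1.
  apply: le_trans ub _; rewrite ler_wpM2l// mulr_natl -sumr_const.
  by apply: ler_sum => b _; apply: hB.
exists u; first by apply: le_trans uA1 _; rewrite /A; move: Pr Pk A10; lra.
move=> w th; have [p sp hp] := cos_taylor m th.
have rep : p.[dotp w z] = \sum_b u b * p.[dotp w (y b)].
  rewrite (tensor_interpolation_ridge lgen _ _ sp).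
  under [RHS]eq_bigr do rewrite (tensor_interpolation_ridge lgen _ _ sp) mulr_sumr.
  rewrite exchange_big/=; apply: eq_bigr => b _; rewrite -uE mulr_suml.
  by apply: eq_bigr => g _; rewrite mulrA.
have -> : cos (dotp w z + th) - \sum_b u b * cos (dotp w (y b) + th) =
   (cos (dotp w z + th) - p.[dotp w z]) -
   \sum_b u b * (cos (dotp w (y b) + th) - p.[dotp w (y b)]).
  under [X in _ = _ - X]eq_bigr do rewrite mulrBr.
  by rewrite sumrB -rep; ring.
apply: le_trans (ler_normB _ _) _.
have n0 := norm1_ge0 w.
apply: (@le_trans _ _ (norm1 w ^+ m * `|r| ^+ m + A1 * (norm1 w ^+ m * m.+1%:R ^+ m))).
  apply: lerD.
    apply: le_trans (hp _) _; rewrite -exprMn lerXn2r ?nnegrE ?mulr_ge0//.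
    by apply: norm_dotp_le => i; apply: le_trans (hz i) (ler_norm _).
  apply: le_trans (ler_norm_sum _ _ _) _.
  apply: (@le_trans _ _ (\sum_b `|u b| * (norm1 w ^+ m * m.+1%:R ^+ m))).
    apply: ler_sum => b _; rewrite normrM ler_wpM2l//; apply: le_trans (hp _) _.
    rewrite -exprMn lerXn2r ?nnegrE ?mulr_ge0//; apply: norm_dotp_le => i.
    rewrite -(subrK (b i)%:R (y b 0 i)); apply: le_trans (ler_normD _ _) _.
    rewrite -natr1 addrC lerD//; first by rewrite ger0_norm// ler_nat ltnW.
    by apply: le_trans (hy b i) _; rewrite ge_min lexx orbT.
  by rewrite -mulr_suml ler_wpM2r// mulr_ge0// exprn_ge0.
have := exprn_ge0 m n0; move: Pr Pk A10; rewrite /A.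
move: (_ ^+ m) (_ ^+ m) (norm1 w ^+ m) => s k t; nra.
Qed.

(** * Designs in a domain with an interior cone condition *)

Section euclidean.
Context {R : realType} {d : nat}.
Implicit Types (x y e xi : 'rV[R]_d) (a t : R).

Lemma dotpDl x y e : dotp (x + y) e = dotp x e + dotp y e.
Proof. by rewrite /dotp -big_split/=; apply: eq_bigr => i _; rewrite mxE mulrDl. Qed.

Lemma dotpZl a x e : dotp (a *: x) e = a * dotp x e.
Proof. by rewrite /dotp mulr_sumr; apply: eq_bigr => i _; rewrite mxE mulrA. Qed.

Lemma dotpC x y : dotp x y = dotp y x.
Proof. by apply: eq_bigr => i _; rewrite mulrC. Qed.

Lemma enorm_dotp x : enorm x ^+ 2 = dotp x x.
Proof. by rewrite enormE; apply: eq_bigr => i _; rewrite expr2. Qed.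

Lemma enormZ a x : enorm (a *: x) = `|a| * enorm x.
Proof.
by rewrite /enorm dotpZl dotpC dotpZl mulrA -expr2 sqrtrM ?sqr_ge0// sqrtr_sqr.
Qed.

Lemma coord_le_enorm x i : `|x 0 i| <= enorm x.
Proof.
rewrite -(@ler_pXn2r _ 2) ?nnegrE ?enorm_ge0// enormE real_normK ?num_real//.
by rewrite (bigD1 i)//= lerDl sumr_ge0// => j _; exact: sqr_ge0.
Qed.

Lemma enorm_le_norm1 x : enorm x <= norm1 x.
Proof. by rewrite -(@ler_pXn2r _ 2) ?nnegrE ?enorm_ge0 ?norm1_ge0// enorm_sqr_le. Qed.

(** The Cauchy-Schwarz inequality for a unit vector: x minus its projection on xi
    has nonnegative square norm. *)
Lemma norm_dotp_unit x xi : enorm xi = 1 -> `|dotp x xi| <= enorm x.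
Proof.
move=> xi1; rewrite -(@ler_pXn2r _ 2) ?nnegrE ?enorm_ge0// real_normK ?num_real//.
rewrite enorm_dotp; set c := dotp x xi.
have : 0 <= dotp (x + (- c) *: xi) (x + (- c) *: xi).
  by rewrite -enorm_dotp sqr_ge0.
rewrite !(dotpDl, dotpZl) ![dotp _ (_ + _)]dotpC !(dotpDl, dotpZl).
rewrite (dotpC xi x) -/c -(enorm_dotp xi) xi1; nra.
Qed.

Lemma enorm_add_unit t x xi : enorm xi = 1 -> enorm (t *: xi + x) <= `|t| + enorm x.
Proof.
move=> xi1; have e0 := enorm_ge0 x.
rewrite -(@ler_pXn2r _ 2) ?nnegrE ?enorm_ge0 ?addr_ge0//.
rewrite enorm_dotp !(dotpDl, dotpZl) ![dotp _ (_ + _)]dotpC !(dotpDl, dotpZl).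
rewrite (dotpC xi x) -(enorm_dotp xi) xi1 -enorm_dotp sqrrD real_normK ?num_real//.
have : t * dotp x xi <= `|t| * enorm x.
  apply: le_trans (ler_norm _) _; rewrite normrM ler_wpM2l//; exact: norm_dotp_unit.
lra.
Qed.

End euclidean.

(** A ball around an axis point at distance tau from the apex is contained in the
    cone if its radius is tau (1 - cos alpha) / (1 + cos alpha).  It is there that
    an axis-parallel grid can be placed, whatever the direction of the cone. *)
Lemma cone_near_axis (R : realType) (d : nat) (Omega : set 'rV[R]_d) (alpha r tau : R)
    (x xi e : 'rV[R]_d) :
  0 < cos alpha < 1 -> enorm xi = 1 ->
  (forall (y : 'rV[R]_d) (lambda : R),
     enorm y = 1 -> cos alpha <= dotp y xi -> 0 <= lambda <= r ->
     Omega (x + lambda *: y)) ->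
  0 < tau -> 2 * tau <= r ->
  enorm e <= (1 - cos alpha) / (1 + cos alpha) * tau ->
  Omega (x + (tau *: xi + e)).
Proof.
move=> /andP[c0 c1] xi1 cone tau0 taur he.
set c := cos alpha in c0 c1 cone he.
have e0 := enorm_ge0 e.
have he' : (1 + c) * enorm e <= (1 - c) * tau.
  have := ler_wpM2l (_ : 0 <= 1 + c) he; rewrite mulrA mulrCA mulfV ?mulr1; last first.
    by rewrite gt_eqF// addr_gt0.
  by apply; rewrite addr_ge0// ltW.
have et : enorm e < tau by nra.
pose v := tau *: xi + e.
have vt : enorm v <= tau + enorm e.
  by have := enorm_add_unit tau e xi1; rewrite gtr0_norm.
have vxi : tau - enorm e <= dotp v xi.
  rewrite dotpDl dotpZl -enorm_dotp xi1 expr1n mulr1 lerD2l lerNl.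
  by have := norm_dotp_unit e xi1; rewrite ler_norml => /andP[]; lra.
have v0 : 0 < enorm v.
  have := norm_dotp_unit v xi1; have := ler_norm (dotp v xi).
  by move: vxi et; lra.
have vE : v = enorm v *: ((enorm v)^-1 *: v).
  by rewrite scalerA mulfV ?scale1r// gt_eqF.
rewrite -/v [X in x + X]vE.
apply: cone.
- by rewrite enormZ gtr0_norm ?invr_gt0// mulVf// gt_eqF.
- rewrite dotpZl mulrC ler_pdivlMr//.
  have : c * enorm v <= c * (tau + enorm e) by rewrite ler_wpM2l// ltW.
  by move: he' vxi; lra.
- by rewrite enorm_ge0/=; move: vt et taur; lra.
Qed.

Lemma compact_coord_bounded (R : realType) (d : nat) (Omega : set 'rV[R]_d) :
  compact Omega -> exists D : R, forall x i, Omega x -> `|x 0 i| <= D.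
Proof.
move=> /compact_bounded[M [_ hM]]; exists (M + 1) => x i Ox.
apply: (@le_trans _ _ `|x|); last by apply: hM Ox; rewrite ltrDl.
by rewrite /Num.norm/= mx_normrE; apply: (le_bigmax _ (fun ij : 'I_1 * 'I_d => `|x ij.1 ij.2|) (0, i)).
Qed.

Section designs.
Context {R : realType} {d n : nat} (Omega : set 'rV[R]_d) (X : 'I_n -> 'rV[R]_d).

Let dists x := [set enorm (x - X j) | j in [set: 'I_n]].

Let dists_lb x : lbound (dists x) 0.
Proof. by move=> _ [j _ <-]; exact: enorm_ge0. Qed.

Lemma fill_distance_near y : compact Omega -> design Omega X -> Omega y ->
  exists j, enorm (y - X j) <= fill_distance Omega X.
Proof.
move=> cO [n2 _ XO] Oy.
pose j0 : 'I_n := Ordinal (ltnW n2).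
have [D hD] := compact_coord_bounded cO.
pose j := [arg min_(j < j0) enorm (y - X j)]%O; exists j.
apply: (@le_trans _ _ (inf (dists y))).
  apply: lb_le_inf; first by exists (enorm (y - X j0)), j0.
  by move=> _ [k _ <-]; rewrite /j; case: arg_minP => // i _; apply.
apply: ub_le_sup; last by exists y.
exists (d%:R * (D + D)) => _ [x Ox <-].
apply: (@le_trans _ _ (enorm (x - X j0))).
  by apply: ge_inf; [exists 0; exact: dists_lb|exists j0].
apply: le_trans (enorm_le_norm1 _) _.
rewrite mulr_natl -[X in _ *+ X]card_ord -sumr_const; apply: ler_sum => i _.
by rewrite !mxE; apply: le_trans (ler_normB _ _) _; rewrite lerD// hD.
Qed.

Lemma separation_radius_le j k : j != k ->
  2 * separation_radius X <= enorm (X j - X k).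
Proof.
move=> jk; rewrite /separation_radius mulrCA mulfV// mulr1.
apply: ge_inf; last by exists (j, k).
by exists 0 => _ [? _ <-]; exact: enorm_ge0.
Qed.

Lemma separation_radius_gt0 : design Omega X -> 0 < separation_radius X.
Proof.
move=> [n2 Xinj _]; rewrite /separation_radius divr_gt0//.
pose I := ('I_n * 'I_n)%type.
have [e e0 he] : exists2 e, 0 < e &
    forall p : I, p.1 != p.2 -> e <= enorm (X p.1 - X p.2).
  apply: finite_modulus.
    by move=> p e e' _ e'e h /h; exact: le_trans.
  move=> [j k]/=; have [->|jk] := eqVneq j k; first by exists 1.
  exists (enorm (X j - X k)) => //.
  rewrite lt_neqAle enorm_ge0 andbT eq_sym; apply: contra jk => /eqP h.
  apply/eqP/Xinj/rowP => i; apply/eqP; rewrite -subr_eq0 -normr_le0.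
  by have := coord_le_enorm (X j - X k) i; rewrite h !mxE.
apply: lt_le_trans e0 _; apply: lb_le_inf.
  pose j0 : 'I_n := Ordinal (ltnW n2); pose j1 : 'I_n := Ordinal n2.
  by exists (enorm (X j0 - X j1)), (j0, j1).
by move=> _ [p pn <-]; exact: he.
Qed.

(** The product kernel sees separation coordinate by coordinate: some coordinate
    carries at least the fraction 1/d of the Euclidean distance. *)
Lemma separated_coord : design Omega X -> (0 < d)%N -> forall j k, j != k ->
  exists i, 2 * separation_radius X / d%:R <= `|X j 0 i - X k 0 i|.
Proof.
move=> des d0 j k jk; apply: contrapT => /forallNP h.
have dR : 0 < d%:R :> R by rewrite ltr0n.
have := separation_radius_le jk; apply/negP; rewrite -ltNge.
apply: le_lt_trans (enorm_le_norm1 _) _.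
have -> : 2 * separation_radius X = \sum_(i < d) (2 * separation_radius X / d%:R).
  by rewrite sumr_const card_ord -[RHS]mulr_natr divfK// gt_eqF.
apply: ltr_sum; first by apply/hasP; exists (Ordinal d0) => //; rewrite mem_index_enum.
by move=> i _; rewrite !mxE ltNge; apply/negP; exact: h.
Qed.

End designs.

Lemma cos_acute (R : realType) (alpha : R) : 0 < alpha -> alpha < pi / 2 ->
  0 < cos alpha < 1.
Proof.
move=> a0 a1; have p0 := @pi_gt0 R.
rewrite cos_gt0_pihalf ?a1 ?andbT; last by lra.
by rewrite -[ltRHS]cos0 ltr_cos// in_itv/= ?lexx ?(ltW a0) ?(ltW p0)//; lra.
Qed.

(** If q were larger than h, a point at distance between h and q from X_0 on the
    axis of the cone would be farther than h from every design point. *)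
Lemma separation_le_fill (R : realType) (d : nat) (Omega : set 'rV[R]_d) :
  compact Omega -> interior_cone_condition Omega ->
  exists2 h0 : R, 0 < h0 & forall n (X : 'I_n -> 'rV[R]_d), design Omega X ->
    fill_distance Omega X <= h0 -> separation_radius X <= fill_distance Omega X.
Proof.
move=> cO [alpha [r [a0 a1 r0 cone]]]; have ca := cos_acute a0 a1.
exists (r / 4); first by rewrite divr_gt0.
move=> n X des hr; rewrite leNgt; apply/negP => hq.
set h := fill_distance Omega X in hr hq; set q := separation_radius X in hq.
have q0 : 0 < q := separation_radius_gt0 des.
have [tau [tau0 htau tauq taur]] : exists tau, [/\ 0 < tau, h < tau, tau <= q & 2 * tau <= r].
  exists (Num.min q (r / 2)); split.
  - by rewrite lt_min q0 divr_gt0.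
  - by rewrite lt_min hq/=; lra.
  - by rewrite ge_min lexx.
  - have : Num.min q (r / 2) <= r / 2 by rewrite ge_min lexx orbT.
    by lra.
have [n2 Xinj XO] := des.
pose j0 : 'I_n := Ordinal (ltnW n2).
have [xi [xi1 hxi]] := cone _ (XO j0).
have e0 : enorm (0 : 'rV[R]_d) = 0.
  by rewrite -(scale0r (0 : 'rV[R]_d)) enormZ normr0 mul0r.
have Oy : Omega (X j0 + (tau *: xi + 0)).
  apply: (cone_near_axis ca xi1 hxi tau0 taur); rewrite e0.
  by move: ca => /andP[c0 c1]; rewrite mulr_ge0 ?(ltW tau0)// divr_ge0; lra.
have [j hj] := fill_distance_near cO des Oy; rewrite -/h addr0 in hj.
have [jE|jn] := eqVneq j0 j.
  move: hj; rewrite -jE addrAC subrr add0r enormZ xi1 mulr1 gtr0_norm//.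
  by rewrite leNgt htau.
have := separation_radius_le X jn; rewrite -/q.
have -> : X j0 - X j = (- tau) *: xi + (X j0 + tau *: xi - X j).
  by apply/rowP => i; rewrite !mxE; ring.
have := enorm_add_unit (- tau) (X j0 + tau *: xi - X j) xi1.
rewrite normrN gtr0_norm//; lra.
Qed.

(** A grid of mesh proportional to h is placed around the axis of the cone at x,
    and every grid point is replaced by a design point within h of it.  In units of
    the mesh these are perturbed grid points, and x itself is at bounded
    distance. *)
Lemma design_reproduction (R : realType) (d m : nat) (Omega : set 'rV[R]_d) :
  (0 < m)%N -> compact Omega -> interior_cone_condition Omega ->
  exists A h0 : R, [/\ 0 < A, 0 < h0 &
    forall n (X : 'I_n -> 'rV[R]_d), design Omega X ->
      fill_distance Omega X <= h0 -> forall x, Omega x ->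
      exists2 u : 'I_n -> R, \sum_j `|u j| <= A &
        forall w th, `|cos (dotp w x + th) - \sum_j u j * cos (dotp w (X j) + th)|
          <= A * (fill_distance Omega X * norm1 w) ^+ m].
Proof.
move=> m0 cO Ocone; have [h1 h10 qh] := separation_le_fill cO Ocone.
have [alpha [r [a0 a1 r0 cone]]] := Ocone; have ca := cos_acute a0 a1.
pose c0 := (1 - cos alpha) / (1 + cos alpha).
have c00 : 0 < c0 by move: ca => /andP[? ?]; rewrite divr_gt0//; lra.
pose dm : R := d%:R * m%:R.
have dm0 : 0 <= dm by rewrite mulr_ge0.
(* The apex sits at distance kappa from the grid, in units of its mesh; the
   grid then fits into the ball of [cone_near_axis]. *)
pose kappa := dm / c0 + 1.
have k0 : 0 < kappa by rewrite ltr_wpDl// divr_ge0// ltW.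
have [eps [A [eps0 A0 rep]]] := @local_reproduction R d m kappa m0.
have em0 : 0 < eps ^- m by rewrite invr_gt0 exprn_gt0.
exists (A + A * eps ^- m), (Num.min h1 (r * eps / (2 * kappa))); split.
- by rewrite addr_gt0// mulr_gt0.
- by rewrite lt_min h10 divr_gt0// mulr_gt0.
move=> n X des; set h := fill_distance Omega X; rewrite le_min => /andP[hh1 hh2] x Ox.
have hgt0 : 0 < h by apply: lt_le_trans (qh _ _ des hh1); exact: separation_radius_gt0 des.
have [xi [xi1 hxi]] := cone _ Ox.
(* In units of delta, a design point within h of a grid point is a perturbation
   by at most eps. *)
pose delta := h / eps.
have delta0 : 0 < delta by rewrite divr_gt0.
pose tau := kappa * delta.
have tau0 : 0 < tau by rewrite mulr_gt0.
have taur : 2 * tau <= r.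
  move: hh2; rewrite ler_pdivlMr ?mulr_gt0// => hh2.
  rewrite /tau /delta -(ler_pM2r eps0).
  by rewrite (_ : _ * eps = h * (2 * kappa))//; field; rewrite gt_eqF.
pose c := x + tau *: xi.
have /choice[J hJ] : forall b : {ffun 'I_d -> 'I_m}, exists j,
    enorm (c + delta *: grid_point b - X j) <= h.
  move=> b; apply: fill_distance_near => //.
  rewrite /c -addrA; apply: (cone_near_axis ca xi1 hxi tau0 taur).
  rewrite -/c0 enormZ gtr0_norm// /tau mulrA [leRHS]mulrC ler_wpM2l ?(ltW delta0)//.
  apply: le_trans (enorm_le_norm1 _) _.
  apply: (@le_trans _ _ dm).
    rewrite /norm1 /dm mulr_natl -[X in _ *+ X]card_ord -sumr_const.
    by apply: ler_sum => i _; rewrite mxE ger0_norm// ler_nat ltnW.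
  by rewrite /kappa mulrDr mulr1 mulrC divfK ?gt_eqF// lerDl ltW.
pose y b := delta^-1 *: (X (J b) - c).
have hy b i : `|y b 0 i - (b i)%:R| <= eps.
  have -> : y b 0 i - (b i)%:R = - (delta^-1 * (c + delta *: grid_point b - X (J b)) 0 i).
    by rewrite !mxE; field; rewrite gt_eqF.
  rewrite normrN normrM gtr0_norm ?invr_gt0//.
  have := le_trans (coord_le_enorm _ i) (hJ b) => hi.
  apply: le_trans (ler_wpM2l _ hi) _; first by rewrite invr_ge0 ltW.
  by rewrite /delta invf_div divfK// gt_eqF.
have hz i : `|((- kappa) *: xi) 0 i| <= kappa.
  rewrite mxE normrM normrN (gtr0_norm k0) -[leRHS]mulr1 ler_wpM2l ?(ltW k0)//.
  by rewrite -xi1 coord_le_enorm.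
have [u uA hu] := rep y _ hy hz.
(* Several grid points may be served by the same design point. *)
exists (fun j => \sum_(b | J b == j) u b).
  apply: (@le_trans _ _ (\sum_b `|u b|)).
    rewrite [leRHS](partition_big J xpredT)//=; apply: ler_sum => j _.
    exact: ler_norm_sum.
  by apply: le_trans uA _; rewrite lerDl mulr_ge0 ?ltW.
move=> w th; have := hu (delta *: w) (th + dotp w c).
have dz : dotp (delta *: w) (- kappa *: xi) + (th + dotp w c) = dotp w x + th.
  rewrite dotpZl [dotp w (_ *: _)]dotpC dotpZl [dotp w c]dotpC /c dotpDl dotpZl.
  rewrite [dotp x w]dotpC /tau; ring.
have dy b : dotp (delta *: w) (y b) + (th + dotp w c) = dotp w (X (J b)) + th.
  rewrite dotpZl [dotp w (_ *: _)]dotpC dotpZl mulrA mulfV ?mul1r ?gt_eqF//.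
  by rewrite dotpC dotpBr; ring.
rewrite dz; under eq_bigr do rewrite dy.
have -> : \sum_j (\sum_(b | J b == j) u b) * cos (dotp w (X j) + th) =
    \sum_b u b * cos (dotp w (X (J b)) + th).
  rewrite [RHS](partition_big J xpredT)//=; apply: eq_bigr => j _.
  by rewrite mulr_suml; apply: eq_bigr => b /eqP ->.
move=> hb; apply: le_trans hb _.
have -> : norm1 (delta *: w) = delta * norm1 w.
  rewrite /norm1 mulr_sumr; apply: eq_bigr => i _.
  by rewrite mxE normrM gtr0_norm.
have n0 := norm1_ge0 w.
have -> : (delta * norm1 w) ^+ m = eps ^- m * (h * norm1 w) ^+ m.
  by rewrite -exprVn -exprMn /delta; congr (_ ^+ m); ring.
have P0 : 0 <= (h * norm1 w) ^+ m by rewrite exprn_ge0// mulr_ge0// ltW.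
by rewrite mulrA ler_wpM2r// lerDr ltW.
Qed.

(** * Kriging weights minimize the residual form *)

Definition kriging_weights {R : realType} {d n : nat} (Phi : 'rV[R]_d -> R)
    (X : 'I_n -> 'rV[R]_d) (x : 'rV[R]_d) (j : 'I_n) : R :=
  ((\col_j Phi (x - X j))^T *m
    invmx (\matrix_(j, k) Phi (X j - X k) : 'M[R]_n)) 0 j.

Lemma krigingE (R : realType) (d n : nat) (Phi : 'rV[R]_d -> R)
    (X : 'I_n -> 'rV[R]_d) g x :
  kriging Phi X g x = \sum_j kriging_weights Phi X x j * g (X j).
Proof. by rewrite /kriging mxE; apply: eq_bigr => j _; rewrite [in X in _ * X]mxE. Qed.

(** The prediction error is the combination of the n + 1 values at x and at the
    design points with coefficients 1 and - u_j. *)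
Definition residual_coef {R : realType} {n : nat} (u : 'I_n -> R) (i : 'I_n.+1) : R :=
  if unlift ord0 i is Some j then - u j else 1.

Definition residual_pts {R : realType} {d n : nat} (x : 'rV[R]_d)
    (X : 'I_n -> 'rV[R]_d) (i : 'I_n.+1) : 'rV[R]_d :=
  if unlift ord0 i is Some j then X j else x.

Lemma sum_residual (R : realType) (d n : nat) (u : 'I_n -> R) x
    (X : 'I_n -> 'rV[R]_d) (F : 'rV[R]_d -> R) :
  \sum_i residual_coef u i * F (residual_pts x X i) = F x - \sum_j u j * F (X j).
Proof.
rewrite big_ord_recl /residual_coef /residual_pts unlift_none mul1r -sumrN.
by congr (_ + _); apply: eq_bigr => j _; rewrite liftK mulNr.
Qed.

Lemma quadf_residual (R : realType) (d n : nat) (k : 'rV[R]_d -> R) (u : 'I_n -> R) x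
    (X : 'I_n -> 'rV[R]_d) : (forall y, k (- y) = k y) ->
  quadf k (residual_coef u) (residual_pts x X) =
  k 0 - 2 * \sum_j u j * k (x - X j) + quadf k u X.
Proof.
move=> ke; rewrite /quadf.
transitivity (\sum_i residual_coef u i *
    (\sum_j residual_coef u j * k (residual_pts x X i - residual_pts x X j))).
  by apply: eq_bigr => i _; rewrite mulr_sumr; apply: eq_bigr => j _; rewrite mulrA.
under eq_bigr do rewrite (sum_residual u x X (fun y => k (_ - y))).
rewrite (sum_residual u x X (fun z => k (z - x) - \sum_j u j * k (z - X j))).
under [X in _ - X]eq_bigr do rewrite mulrBr mulr_sumr.
rewrite sumrB subrr opprB.
under [X in _ + (_ - X)]eq_bigr do rewrite -opprB ke.
under [X in _ + (X - _)]eq_bigr do under eq_bigr do rewrite mulrA.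
set A := \sum_i _; set B := \sum_i _; ring.
Qed.

Section minimality.
Context {R : realType} {d n : nat} (Phi : 'rV[R]_d -> R) (X : 'I_n -> 'rV[R]_d).
Hypotheses (Phi_even : forall x, Phi (- x) = Phi x)
  (Phi_pd : pos_def_kernel (fun x x' => Phi (x - x'))) (Xinj : injective X).

Let K : 'M[R]_n := \matrix_(j, k) Phi (X j - X k).

Lemma quadf_pos_def_ge0 (u : 'I_n -> R) : 0 <= quadf Phi u X.
Proof.
have [/existsP uE|/existsPn u0] := boolP [exists i, u i != 0].
  by apply: ltW; exact: Phi_pd.
rewrite /quadf big1// => i _; rewrite big1// => j _.
by have /negPn/eqP -> := u0 i; rewrite !mul0r.
Qed.

Lemma kernel_matrix_unit : K \in unitmx.
Proof.
rewrite -row_free_unit -kermx_eq0; apply/eqP/row_matrixP => a; rewrite row0.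
set w := row a _.
have wK : w *m K = 0 by rewrite /w -row_mul mulmx_ker row0.
have wq : quadf Phi (w 0) X = 0.
  have : (w *m K *m w^T) 0 0 = 0 by rewrite wK mul0mx mxE.
  move=> <-; rewrite mxE /quadf exchange_big/=; apply: eq_bigr => j _.
  rewrite !mxE mulr_suml; apply: eq_bigr => i _; rewrite !mxE; ring.
apply/rowP => b; rewrite [RHS]mxE; apply/eqP/negPn/negP => wb.
have : 0 < quadf Phi (w 0) X by apply: Phi_pd => //; exists b.
by rewrite wq ltxx.
Qed.

Lemma kriging_weights_normal x k :
  \sum_j kriging_weights Phi X x j * Phi (X j - X k) = Phi (x - X k).
Proof.
have := congr1 (fun M : 'rV[R]_n => M 0 k)
  (mulmxKV kernel_matrix_unit (\col_j Phi (x - X j))^T).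
rewrite !mxE => <-; apply: eq_bigr => j _; congr (_ * _).
by rewrite mxE.
Qed.

(** The weights solve the normal equations [kriging_weights_normal], so the form at
    u exceeds the form at the kriging weights by the kernel form of the
    difference. *)
Lemma kriging_weights_min x u :
  quadf Phi (residual_coef (kriging_weights Phi X x)) (residual_pts x X) <=
  quadf Phi (residual_coef u) (residual_pts x X).
Proof.
set v := kriging_weights Phi X x.
rewrite !quadf_residual//.
have key (f : 'I_n -> R) : \sum_j f j * Phi (x - X j) =
    \sum_i \sum_j v i * f j * Phi (X i - X j).
  rewrite exchange_big/=; apply: eq_bigr => j _.
  rewrite -kriging_weights_normal mulr_sumr; apply: eq_bigr => i _; rewrite -/v; ring.
have := quadf_pos_def_ge0 (fun i => u i - v i).
have -> : quadf Phi (fun i => u i - v i) X =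
    quadf Phi u X - 2 * (\sum_i \sum_j v i * u j * Phi (X i - X j)) + quadf Phi v X.
  have sw : \sum_i \sum_j v i * u j * Phi (X i - X j) = \sum_i \sum_j u i * v j * Phi (X i - X j).
    rewrite exchange_big/=; apply: eq_bigr => i _; apply: eq_bigr => j _.
    by rewrite -[X j - X i]opprB Phi_even; ring.
  rewrite mulr_natl mulr2n opprD {1}sw addrA -!sumrB -big_split/=; apply: eq_bigr => i _.
  rewrite -!sumrB -big_split/=; apply: eq_bigr => j _; ring.
rewrite !key -/(quadf Phi v X); lra.
Qed.

End minimality.

(** * The kriging residual for the imposed correlation *)

Lemma trigsq_residual (R : realType) (d n : nat) (u : 'I_n -> R) x
    (X : 'I_n -> 'rV[R]_d) w :
  trigsq (residual_coef u) (residual_pts x X) w =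
  (cos (dotp w x) - \sum_j u j * cos (dotp w (X j))) ^+ 2 +
  (sin (dotp w x) - \sum_j u j * sin (dotp w (X j))) ^+ 2.
Proof.
by rewrite /trigsq (sum_residual u x X (fun y => cos (dotp w y)))
  (sum_residual u x X (fun y => sin (dotp w y))).
Qed.

Lemma trigsq_residual_le (R : realType) (d n : nat) (u : 'I_n -> R) x
    (X : 'I_n -> 'rV[R]_d) w :
  trigsq (residual_coef u) (residual_pts x X) w <= 2 + 2 * trigsq u X w.
Proof.
rewrite trigsq_residual /trigsq; set c := \sum_j _; set s := \sum_j _.
have := cos2Dsin2 (dotp w x).
have := sqr_ge0 (cos (dotp w x) + c); have := sqr_ge0 (sin (dotp w x) + s).
lra.
Qed.

Lemma trigsq_le_residual (R : realType) (d n : nat) (u : 'I_n -> R) x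
    (X : 'I_n -> 'rV[R]_d) w :
  trigsq u X w <= 2 + 2 * trigsq (residual_coef u) (residual_pts x X) w.
Proof.
rewrite trigsq_residual /trigsq; set c := \sum_j _; set s := \sum_j _.
have := cos2Dsin2 (dotp w x).
have := sqr_ge0 (2 * cos (dotp w x) - c); have := sqr_ge0 (2 * sin (dotp w x) - s).
lra.
Qed.

Lemma sqr_norm_le (R : realType) (x a : R) : `|x| <= a -> x ^+ 2 <= a ^+ 2.
Proof.
move=> xa; rewrite -real_normK ?num_real// lerXn2r ?nnegrE//.
exact: le_trans xa.
Qed.

Lemma trigsq_residual_reproduction (R : realType) (d n m : nat) (u : 'I_n -> R) x
    (X : 'I_n -> 'rV[R]_d) w (b : R) :
  (forall th, `|cos (dotp w x + th) - \sum_j u j * cos (dotp w (X j) + th)| <= b) ->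
  trigsq (residual_coef u) (residual_pts x X) w <= 2 * b ^+ 2.
Proof.
move=> h; rewrite trigsq_residual.
have hc : (cos (dotp w x) - \sum_j u j * cos (dotp w (X j))) ^+ 2 <= b ^+ 2.
  apply: sqr_norm_le; have := h 0; rewrite addr0.
  by under eq_bigr do rewrite addr0.
have hs : (sin (dotp w x) - \sum_j u j * sin (dotp w (X j))) ^+ 2 <= b ^+ 2.
  apply: sqr_norm_le; have := h (- (pi / 2)); rewrite cosBpihalf.
  by under eq_bigr do rewrite cosBpihalf.
by move: hc hs; lra.
Qed.

Lemma measurable_norm1_le (R : realType) (d : nat) (L : R) :
  measurable [set w : 'rV[R]_d | norm1 w <= L].
Proof.
rewrite (_ : [set w | _] = [set: 'rV[R]_d] `&` (norm1 @^-1` `]-oo, L])).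
  by apply: (@measurable_norm1 R d measurableT); exact: measurable_itv.
by rewrite setTI; apply/seteqP; split => w /=; rewrite in_itv.
Qed.

Lemma integral_split_norm1 (R : realType) (d : nat) (L : R) (f : 'rV[R]_d -> R) :
  measurable_fun [set: 'rV[R]_d] f -> (forall w, 0 <= f w) ->
  (\int[lebesgue_rV R d]_w (f w)%:E =
   \int[lebesgue_rV R d]_(w in [set w | (norm1 w <= L)%R]) (f w)%:E +
   \int[lebesgue_rV R d]_(w in [set w | (L < norm1 w)%R]) (f w)%:E)%E.
Proof.
move=> mf f0.
have mA := @measurable_norm1_le R d L.
have CA : [set w : 'rV[R]_d | L < norm1 w] = ~` [set w | norm1 w <= L].
  by apply/seteqP; split => w /=; rewrite ltNge => /negP.
rewrite CA -ge0_integral_setU//=.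
- by rewrite setUv.
- exact: measurableC.
- by rewrite setUv; exact/measurable_EFinP.
- by move=> w _; rewrite lee_fin.
- exact/disj_setPCl.
Qed.

Lemma integral_low_le (R : realType) (d : nat) (L c : R) (f g : 'rV[R]_d -> R) :
  measurable_fun [set: 'rV[R]_d] f -> measurable_fun [set: 'rV[R]_d] g ->
  (forall w, 0 <= f w) -> (forall w, 0 <= g w) -> 0 <= c ->
  (forall w, norm1 w <= L -> f w <= c * g w) ->
  (\int[lebesgue_rV R d]_(w in [set w | (norm1 w <= L)%R]) (f w)%:E <=
   c%:E * \int[lebesgue_rV R d]_w (g w)%:E)%E.
Proof.
move=> mf mg f0 g0 c0 fg; have mA := @measurable_norm1_le R d L.
rewrite -ge0_integralZl_EFin//; last 2 first.
- by move=> w _; rewrite lee_fin.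
- exact/measurable_EFinP.
apply: (@le_trans _ _ (\int[lebesgue_rV R d]_(w in [set w | (norm1 w <= L)%R]) (c%:E * (g w)%:E))%E).
  apply: ge0_le_integral => //=.
  - by move=> w _; rewrite lee_fin.
  - by apply/measurable_EFinP/measurable_funTS.
  - by apply/measurable_EFinP/measurable_funTS; exact: measurable_funM.
apply: ge0_subset_integral => //=.
- by apply/measurable_EFinP; exact: measurable_funM.
- by move=> w _; rewrite lee_fin mulr_ge0.
Qed.

Lemma integral_le_scale (R : realType) (d : nat) (c : R) (f g : 'rV[R]_d -> R) :
  measurable_fun [set: 'rV[R]_d] f -> measurable_fun [set: 'rV[R]_d] g ->
  (forall w, 0 <= f w) -> (forall w, 0 <= g w) -> 0 <= c ->
  (forall w, f w <= c * g w) ->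
  (\int[lebesgue_rV R d]_w (f w)%:E <= c%:E * \int[lebesgue_rV R d]_w (g w)%:E)%E.
Proof.
move=> mf mg f0 g0 c0 fg.
rewrite -ge0_integralZl_EFin//; last 2 first.
- by move=> w _; rewrite lee_fin.
- exact/measurable_EFinP.
apply: ge0_le_integral => //=.
- by move=> w _; rewrite lee_fin.
- exact/measurable_EFinP.
- by apply/measurable_EFinP; exact: measurable_funM.
- by move=> w _; rewrite -EFinM lee_fin.
Qed.

(** It suffices to bound the residual of the weights of [design_reproduction].  It
    is O((h |w|)^m) with m >= nu + d/2, hence of order h^(2 nu + d) against the
    Sobolev weight on |w|_1 <= 1/h; beyond 1/h it is bounded. *)
Lemma power_function_bound (R : realType) (d : nat) (Omega : set 'rV[R]_d)
    (Phi fPhi : 'rV[R]_d -> R) (c4 nu : R) :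
  (0 < d)%N -> compact Omega -> interior_cone_condition Omega ->
  correlation_function Phi -> spectral_density Phi fPhi ->
  0 < nu -> 0 <= c4 ->
  (forall w, 0 <= fPhi w <= c4 * sobolev_weight nu w) ->
  exists C h0 : R, [/\ 0 < C, 0 < h0 &
    forall n (X : 'I_n -> 'rV[R]_d), design Omega X ->
      0 < fill_distance Omega X <= h0 -> forall x, Omega x ->
      quadf Phi (residual_coef (kriging_weights Phi X x)) (residual_pts x X)
       <= C * fill_distance Omega X `^ (2 * nu)].
Proof.
move=> d0 cO Ocone [_ _ Pe Ppd _] spec nu0 c40 fb.
pose a := nu + d%:R / 2.
have a0 : 0 < a by rewrite ltr_wpDr// divr_ge0.
(* The bound m >= a makes (h |w|)^(2 m) <= (h |w|)^(2 a) for h |w| <= 1. *)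
pose m := (Num.truncn a).+1.
have am : a <= m%:R by rewrite ltW// truncnS_gt.
have [A [h0 [A0 h00 rep]]] := @design_reproduction R d m Omega isT cO Ocone.
have [H H0 hH] := @high_frequency_bound R d nu d0 nu0.
pose b := 2 * (1 + A) ^+ 2.
have b0 : 0 < b by rewrite mulr_gt0// exprn_gt0// addr_gt0.
pose C1 := 2 * A ^+ 2 * d%:R `^ a * expR 1 * 2 ^+ d.
have C10 : 0 <= C1 by rewrite !mulr_ge0 ?expR_ge0 ?powR_ge0 ?exprn_ge0// ltW.
exists (c4 * (C1 + H * b) + 1), h0; split => //.
  by rewrite ltr_wpDl// mulr_ge0// addr_ge0// mulr_ge0// ltW.
move=> n X des; set h := fill_distance Omega X => /andP[hgt0 hh0] x Ox.
have [_ Xinj _] := des.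
have [u uA hu] := rep _ _ des hh0 x Ox.
apply: le_trans (kriging_weights_min Pe Ppd Xinj x u) _.
set T := trigsq (residual_coef u) (residual_pts x X).
have T0 w : 0 <= T w by exact: trigsq_ge0.
have mT : measurable_fun [set: 'rV[R]_d] T by exact: measurable_trigsq.
have Tsmall w : T w <= 2 * (A * (h * norm1 w) ^+ m) ^+ 2.
  by apply: (@trigsq_residual_reproduction _ _ _ m) => th; exact: hu.
have Tb w : T w <= b.
  apply: (@trigsq_residual_reproduction _ _ _ m) => th.
  apply: le_trans (ler_normB _ _) _; apply: lerD.
    by rewrite ler_norml cos_geN1 cos_le1.
  apply: le_trans (ler_norm_sum _ _ _) _; apply: le_trans uA; apply: ler_sum => j _.
  by rewrite normrM ler_piMr// ler_norml cos_geN1 cos_le1.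
pose W := @sobolev_weight R d nu.
have mW : measurable_fun [set: 'rV[R]_d] W by exact: measurable_sobolev_weight.
have W0 w : 0 <= W w by exact: sobolev_weight_ge0.
have mTW : measurable_fun [set: 'rV[R]_d] (fun w => T w * W w) by exact: measurable_funM.
have main : (\int[lebesgue_rV R d]_w (T w * W w)%:E <=
    ((C1 + H * b) * h `^ (2 * nu))%:E)%E.
  rewrite (@integral_split_norm1 R d h^-1)//; last by move=> w; rewrite mulr_ge0.
  rewrite mulrDl EFinD; apply: leeD.
    pose c := 2 * A ^+ 2 * d%:R `^ a * h `^ (2 * a) * expR 1.
    apply: le_trans (@integral_low_le R d h^-1 c _ (laplace h^-1^-1) mTW _ _ _ _ _) _.
    - exact: measurable_laplace.
    - by move=> w; rewrite mulr_ge0.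
    - by move=> w; exact: laplace_ge0.
    - by rewrite !mulr_ge0 ?powR_ge0 ?expR_ge0// ltW// exprn_gt0.
    - move=> w wh; rewrite invrK.
      have hw1 : h * norm1 w <= 1 by rewrite mulrC -ler_pdivlMr// div1r.
      have hw0 : 0 <= h * norm1 w by rewrite mulr_ge0 ?norm1_ge0// ltW.
      have sw0 : 0 < 1 + enorm w ^+ 2 by rewrite ltr_wpDr ?sqr_ge0.
      have p1 : ((h * norm1 w) ^+ m) ^+ 2 <= ((h * norm1 w) ^+ 2) `^ a.
        have [->|hwn0] := eqVneq (h * norm1 w) 0; first by rewrite !expr0n/= ?expr0n powR_ge0.
        rewrite -exprM mulnC exprM -powR_mulrn ?exprn_ge0//.
        by apply: ger_powR => //; rewrite exprn_ile1// andbT exprn_gt0// lt_neqAle eq_sym hwn0.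
      have p2 : ((h * norm1 w) ^+ 2) `^ a <= h `^ (2 * a) * d%:R `^ a * (1 + enorm w ^+ 2) `^ a.
        apply: (@le_trans _ _ ((h ^+ 2 * (d%:R * (1 + enorm w ^+ 2))) `^ a)).
          rewrite ge0_ler_powR ?nnegrE ?(ltW a0) ?exprn_ge0//.
            by rewrite mulr_ge0 ?exprn_ge0 ?mulr_ge0// ltW.
          rewrite exprMn ler_wpM2l ?exprn_ge0// ?(ltW hgt0)//.
          apply: le_trans (norm1_sqr_le w) _; rewrite ler_wpM2l//; lra.
        rewrite powRM ?exprn_ge0 ?mulr_ge0 ?(ltW hgt0) ?(ltW sw0)//.
        rewrite [(d%:R * _) `^ a]powRM ?(ltW sw0)//.
        by rewrite -[h ^+ 2]powR_mulrn ?(ltW hgt0)// -powRrM mulrA.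
      have p3 : (1 + enorm w ^+ 2) `^ a * W w = 1.
        by rewrite /W /sobolev_weight -/a powRN mulfV// gt_eqF// powR_gt0.
      have p4 : 1 <= expR 1 * laplace h w.
        by rewrite /laplace -expRD -[leLHS]expR0 ler_expR subr_ge0.
      apply: (@le_trans _ _ (2 * A ^+ 2 * d%:R `^ a * h `^ (2 * a))); last first.
        have y0 : 0 <= 2 * A ^+ 2 * d%:R `^ a * h `^ (2 * a).
          by apply: mulr_ge0; rewrite ?powR_ge0// mulr_ge0 ?powR_ge0// mulr_ge0// sqr_ge0.
        by have := ler_peMr y0 p4; rewrite /c (mulrA _ (expR 1)).
      have A2 : 0 <= 2 * A ^+ 2 by rewrite mulr_ge0// sqr_ge0.
      apply: (@le_trans _ _ (2 * A ^+ 2 * (h `^ (2 * a) * d%:R `^ a * (1 + enorm w ^+ 2) `^ a) * W w)).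
        rewrite ler_wpM2r//; apply: le_trans (Tsmall w) _.
        by rewrite exprMn [leLHS]mulrA ler_wpM2l//; apply: le_trans p1 p2.
      rewrite le_eqVlt; apply/orP; left; apply/eqP.
      by rewrite -[RHS]mulr1 -[X in _ = _ * X]p3; ring.
    rewrite invrK integral_laplace// -EFinM lee_fin /c /C1.
    have -> : h `^ (2 * a) = h `^ (2 * nu) * h ^+ d.
      rewrite -powR_mulrn ?(ltW hgt0)// -powRD ?(gt_eqF hgt0) ?implybT//.
      by congr (_ `^ _); rewrite /a; field.
    rewrite le_eqVlt; apply/orP; left; apply/eqP; rewrite expr_div_n.
    have : h ^+ d != 0 by rewrite expf_neq0// gt_eqF.
    move: (h ^+ d) (2 ^+ d) (h `^ _) (d%:R `^ _) => y z P Q y0; by field.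
  apply: le_trans (hH T b h^-1 mT T0 (ltW b0) _ _) _; first by rewrite invr_gt0.
    move=> L hL; have L0 : 0 < L by apply: lt_le_trans hL; rewrite invr_gt0.
    apply: le_trans (@integral_le_scale R d b _ (laplace L^-1) _ _ _ _ _ _) _.
    - by apply: measurable_funM => //; exact: measurable_laplace.
    - exact: measurable_laplace.
    - by move=> w; rewrite mulr_ge0// laplace_ge0.
    - by move=> w; exact: laplace_ge0.
    - exact: ltW.
    - by move=> w; rewrite mulrC ler_wpM2r// laplace_ge0.
    - by rewrite integral_laplace ?invr_gt0// -EFinM invrK.
  rewrite lee_fin -powR_inv1 ?(ltW hgt0)// -powRrM mulN1r opprK//.
rewrite -lee_fin -(integral_trigsq_spectral _ _ spec).
apply: (@le_trans _ _ (c4%:E * \int[lebesgue_rV R d]_w (T w * W w)%:E)%E).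
  have mf : measurable_fun [set: 'rV[R]_d] fPhi.
    by apply/measurable_EFinP; exact: measurable_int (proj1 spec).
  apply: integral_le_scale => //.
  - exact: measurable_funM.
  - by move=> w; rewrite mulr_ge0//; have /andP[] := fb w.
  - by move=> w; rewrite mulr_ge0.
  - by move=> w; rewrite mulrCA ler_wpM2l//; have /andP[] := fb w.
apply: le_trans (lee_wpmul2l _ main) _; first by rewrite lee_fin.
rewrite -EFinM lee_fin mulrA ler_wpM2r ?powR_ge0//; lra.
Qed.

(** * The kriging residual for the true correlation *)

Lemma powR_le_expR (R : realType) (b c t : R) : 0 < b -> 0 <= c -> 0 <= t ->
  (1 + c * t) `^ b <= (1 + c * b) `^ b * expR t.
Proof.
move=> b0 c0 t0.
have -> : expR t = expR (t / b) `^ b by rewrite -expRM divfK// gt_eqF.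
rewrite -powRM ?expR_ge0 ?addr_ge0 ?mulr_ge0 ?(ltW b0)//.
have tb : 0 <= t / b by rewrite divr_ge0// ltW.
have e1 := expR_ge1Dx (t / b).
have nn : 0 <= 1 + c * b by rewrite addr_ge0// mulr_ge0// ltW.
apply: ge0_ler_powR; rewrite ?nnegrE ?(ltW b0)//.
- by rewrite addr_ge0// mulr_ge0.
- by rewrite mulr_ge0// expR_ge0.
apply: (@le_trans _ _ ((1 + c * b) * (1 + t / b))); last by rewrite ler_wpM2l.
have : c * t = c * b * (t / b) by field; rewrite gt_eqF.
have : 0 <= c * b by rewrite mulr_ge0// ltW.
by move: tb; nra.
Qed.

Lemma integral_le_lin2 (R : realType) (d : nat) (c1 c2 : R) (f g1 g2 : 'rV[R]_d -> R) :
  measurable_fun [set: 'rV[R]_d] f -> measurable_fun [set: 'rV[R]_d] g1 ->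
  measurable_fun [set: 'rV[R]_d] g2 ->
  (forall w, 0 <= f w) -> (forall w, 0 <= g1 w) -> (forall w, 0 <= g2 w) ->
  0 <= c1 -> 0 <= c2 ->
  (forall w, f w <= c1 * g1 w + c2 * g2 w) ->
  (\int[lebesgue_rV R d]_w (f w)%:E <=
    c1%:E * \int[lebesgue_rV R d]_w (g1 w)%:E + c2%:E * \int[lebesgue_rV R d]_w (g2 w)%:E)%E.
Proof.
move=> mf mg1 mg2 f0 g10 g20 c10 c20 fg.
have m1 : measurable_fun [set: 'rV[R]_d] (fun w => (c1 * g1 w)%:E).
  by apply/measurable_EFinP; exact: measurable_funM.
have m2 : measurable_fun [set: 'rV[R]_d] (fun w => (c2 * g2 w)%:E).
  by apply/measurable_EFinP; exact: measurable_funM.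
have Zl c (g : 'rV[R]_d -> R) : 0 <= c -> measurable_fun [set: 'rV[R]_d] g ->
    (forall w, 0 <= g w) -> (c%:E * \int[lebesgue_rV R d]_w (g w)%:E =
    \int[lebesgue_rV R d]_w (c * g w)%:E)%E.
  move=> c0 mg g0; rewrite -ge0_integralZl_EFin//.
    by move=> w _; rewrite lee_fin.
  exact/measurable_EFinP.
rewrite !Zl//.
rewrite -ge0_integralD//.
- apply: ge0_le_integral => //=.
  + by move=> w _; rewrite lee_fin.
  + exact/measurable_EFinP.
  + exact: emeasurable_funD.
  + by move=> w _; rewrite -EFinD lee_fin.
- by move=> w _; rewrite lee_fin mulr_ge0.
- by move=> w _; rewrite lee_fin mulr_ge0.
Qed.

(** Exponential decay beats the Sobolev weight; as q <= 1, one has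
    1 + |w| <= (1 + q |w|) / q. *)
Lemma laplace_le_sobolev_weight (R : realType) (d : nat) (nu q c a : R) (w : 'rV[R]_d) :
  a = nu + d%:R / 2 -> 0 < a -> 0 < q <= 1 -> 0 < c ->
  laplace (c / q)^-1 w <= (1 + c * (2 * a)) `^ (2 * a) * q `^ (- (2 * a)) * sobolev_weight nu w.
Proof.
move=> aE a0 /andP[q0 q1] c0.
have N0 := norm1_ge0 w; set N := norm1 w in N0.
have sw0 : 0 < 1 + enorm w ^+ 2 by rewrite ltr_wpDr ?sqr_ge0.
have [t tE t0] : exists2 t, t = N / (c / q) & 0 <= t.
  by exists (N / (c / q)) => //; rewrite !divr_ge0// ltW.
have ct0 : 0 <= 1 + c * t by rewrite addr_ge0// mulr_ge0// ltW.
have lE : laplace (c / q)^-1 w = (expR t)^-1 by rewrite -expRN /laplace mulrC tE.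
have e0 : 0 < expR t by exact: expR_gt0.
rewrite lE /sobolev_weight -aE [X in _ <= _ * X]powRN ler_pdivlMr ?powR_gt0//.
rewrite mulrC ler_pdivrMr//.
have a20 : 0 < 2 * a by rewrite mulr_gt0.
apply: (@le_trans _ _ ((q^-1 * (1 + c * t)) `^ (2 * a))).
  rewrite powRrM powR_mulrn; last by rewrite mulr_ge0 ?invr_ge0 ?(ltW q0).
  rewrite ge0_ler_powR ?nnegrE ?(ltW a0) ?sqr_ge0 ?(ltW sw0)//.
  have -> : q^-1 * (1 + c * t) = q^-1 + N.
    by rewrite tE; field; rewrite !gt_eqF.
  have q1' : 1 <= q^-1 by rewrite invf_ge1.
  by have := enorm_sqr_le w; rewrite -/N; nra.
rewrite powRM ?invr_ge0 ?(ltW q0)//.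
rewrite -powR_inv1 ?(ltW q0)// -powRrM mulN1r mulrC.
rewrite mulrAC ler_wpM2r ?powR_ge0//.
by apply: powR_le_expR => //; exact: ltW.
Qed.

(** The sum over the nodes X is e^{i w.x} minus the residual, so the lower bound of
    [laplace_trigsq_bounds] at scale 1/q controls the coefficients by the mass of
    the window and by the residual.  Splitting off e^{i w.x} is what allows x
    to be arbitrarily close to a node. *)
Lemma coef_bound (R : realType) (d : nat) (nu : R) : (0 < d)%N -> 0 < nu ->
  exists2 C : R, 0 < C & forall (Omega : set 'rV[R]_d) n (X : 'I_n -> 'rV[R]_d),
    design Omega X -> separation_radius X <= 1 ->
    forall x (u : 'I_n -> R) p, 0 <= p ->
    (\int[lebesgue_rV R d]_w (trigsq (residual_coef u) (residual_pts x X) w *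
        sobolev_weight nu w)%:E <= p%:E)%E ->
    \sum_j u j ^+ 2 <= 4 + C * separation_radius X `^ (- (2 * nu)) * p.
Proof.
move=> d0 nu0; pose a := nu + d%:R / 2.
have a0 : 0 < a by rewrite ltr_wpDr// divr_ge0.
pose c : R := 8 * d%:R ^+ 2.
have dR : 0 < d%:R :> R by rewrite ltr0n.
have c0 : 0 < c by rewrite mulr_gt0// exprn_gt0.
pose G := (1 + c * (2 * a)) `^ (2 * a).
have G0 : 0 < G by rewrite powR_gt0// addr_gt0// !mulr_gt0.
have z0 : 0 < (2 * c) ^+ d by rewrite exprn_gt0// mulr_gt0.
exists (4 * G / (2 * c) ^+ d); first by rewrite divr_gt0// mulr_gt0.
move=> Omega n X des q1 x u p p0 hp.
have q0 := separation_radius_gt0 des; set q := separation_radius X in q0 q1 *.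
pose L := c / q; have L0 : 0 < L by rewrite divr_gt0.
have eta0 : 0 < 2 * q / d%:R by rewrite divr_gt0// mulr_gt0.
(* L = 8 d^2 / q turns the coordinatewise separation 2 q / d into
   L (2 q / d) = 16 d, and 256 d <= (16 d)^2. *)
have hL : 256 * d%:R <= (L * (2 * q / d%:R)) ^+ 2.
  have -> : L * (2 * q / d%:R) = 16 * d%:R by rewrite /L /c; field; rewrite !gt_eqF.
  have : 1 <= d%:R :> R by rewrite ler1n.
  by rewrite exprMn; nra.
have [lo _] := laplace_trigsq_bounds u eta0 L0 hL (separated_coord des d0).
set T := trigsq (residual_coef u) (residual_pts x X) in hp.
have mT : measurable_fun [set: 'rV[R]_d] T by exact: measurable_trigsq.
have T0 w : 0 <= T w by exact: trigsq_ge0.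
have mlap := @measurable_laplace R d L^-1.
have lap0 (w : 'rV[R]_d) : 0 <= laplace L^-1 w by exact: laplace_ge0.
have h1 : (\int[lebesgue_rV R d]_w (laplace L^-1 w * T w)%:E <= (G * q `^ (- (2 * a)) * p)%:E)%E.
  rewrite EFinM; apply: le_trans (lee_wpmul2l _ hp); last first.
    by rewrite lee_fin mulr_ge0 ?powR_ge0.
  apply: integral_le_scale.
  - exact: measurable_funM.
  - by apply: measurable_funM => //; exact: measurable_sobolev_weight.
  - by move=> w; rewrite mulr_ge0.
  - by move=> w; rewrite mulr_ge0 ?sobolev_weight_ge0.
  - by rewrite mulr_ge0 ?powR_ge0.
  - move=> w; rewrite mulrCA [leLHS]mulrC ler_wpM2l//.
    by apply: laplace_le_sobolev_weight => //; rewrite q0.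
have h2 : (\int[lebesgue_rV R d]_w (laplace L^-1 w * trigsq u X w)%:E <=
    (2 * (2 * L) ^+ d + 2 * (G * q `^ (- (2 * a)) * p))%:E)%E.
  apply: le_trans (@integral_le_lin2 R d 2 2 _ (laplace L^-1) (fun w => laplace L^-1 w * T w) _ _ _ _ _ _ _ _ _) _ => //.
  - by apply: measurable_funM => //; exact: measurable_trigsq.
  - exact: measurable_funM.
  - by move=> w; rewrite mulr_ge0// trigsq_ge0.
  - by move=> w; rewrite mulr_ge0.
  - move=> w; have := ler_wpM2l (lap0 w) (trigsq_le_residual u x X w); rewrite -/T; lra.
  rewrite integral_laplace ?invr_gt0// invrK [leRHS]EFinD [X in (_ <= X + _)%E]EFinM [X in (_ <= _ + X)%E]EFinM leeD2l//.
  by rewrite lee_wpmul2l// lee_fin.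
have := le_trans lo h2; rewrite lee_fin.
have -> : (2 * L) ^+ d = (2 * c) ^+ d / q ^+ d by rewrite /L mulrA expr_div_n.
have -> : q `^ (- (2 * a)) = q `^ (- (2 * nu)) / q ^+ d.
  rewrite -powR_mulrn ?(ltW q0)// -powRN -powRD ?(gt_eqF q0) ?implybT//.
  by congr (_ `^ _); rewrite /a; field.
have qd : 0 < q ^+ d by rewrite exprn_gt0.
move: (q `^ _) (\sum_j _) => Q U.
move: (q ^+ d) ((2 * c) ^+ d) qd z0 => y z y0 z0 h.
have : z / y * (2^-1 * U) * (2 * (y / z)) <= (2 * (z / y) + 2 * (G * (Q / y) * p)) * (2 * (y / z)).
  by rewrite ler_wpM2r// mulr_ge0// divr_ge0// ltW.
rewrite (_ : _ * (2^-1 * U) * _ = U); last by field; rewrite !gt_eqF.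
rewrite (_ : (_ + _) * _ = 4 + 4 * G / z * Q * p)//; field; rewrite !gt_eqF//.
Qed.

(** Up to frequency L, passing from smoothness nu to nu0 costs
    (1 + |w|^2)^(nu - nu0). *)
Lemma sobolev_weight_low (R : realType) (d : nat) (nu nu0 L : R) (w : 'rV[R]_d) :
  nu0 <= nu -> 1 <= L -> norm1 w <= L ->
  sobolev_weight nu0 w <= 2 `^ (nu - nu0) * L `^ (2 * (nu - nu0)) * sobolev_weight nu w.
Proof.
move=> nn L1 wL; have sw0 : 0 < 1 + enorm w ^+ 2 by rewrite ltr_wpDr ?sqr_ge0.
have L0 : 0 <= L by apply: le_trans L1.
rewrite /sobolev_weight.
have -> : - (nu0 + d%:R / 2) = (nu - nu0) + - (nu + d%:R / 2) by ring.
rewrite powRD ?(gt_eqF sw0) ?implybT// ler_wpM2r ?powR_ge0//.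
rewrite powRrM powR_mulrn// -powRM ?exprn_ge0//.
rewrite ge0_ler_powR ?nnegrE ?subr_ge0 ?(ltW sw0) ?mulr_ge0 ?exprn_ge0//.
have := enorm_sqr_le w; have n0 := norm1_ge0 w; nra.
Qed.

(** The frequencies are split at L = 8 d^2 / q. Below L the density fPsi is at most
    a constant times L^(2 (nu - nu0)) fPhi [sobolev_weight_low], so the error there is
    controlled by the one for Phi; above L it is controlled by [high_frequency_bound]
    with the bound [coef_bound] on the kriging coefficients. *)
Lemma kriging_variance_bound (R : realType) (d : nat) (Omega : set 'rV[R]_d)
    (Psi Phi fPsi fPhi : 'rV[R]_d -> R) (c2 c3 c4 nu0 nu : R) :
  (0 < d)%N -> compact Omega -> interior_cone_condition Omega ->
  correlation_function Phi ->
  spectral_density Psi fPsi -> spectral_density Phi fPhi ->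
  0 < nu0 -> nu0 < nu -> 0 < c2 -> 0 < c3 -> 0 < c4 ->
  (forall w, 0 <= fPsi w <= c2 * sobolev_weight nu0 w) ->
  (forall w, c3 * sobolev_weight nu w <= fPhi w <= c4 * sobolev_weight nu w) ->
  exists C h0 : R, [/\ 0 < C, 0 < h0 <= 1 &
    forall n (X : 'I_n -> 'rV[R]_d), design Omega X -> fill_distance Omega X <= h0 ->
     [/\ 0 < fill_distance Omega X, 0 < mesh_ratio Omega X &
      forall x, Omega x ->
      quadf Psi (residual_coef (kriging_weights Phi X x)) (residual_pts x X)
       <= C * (fill_distance Omega X `^ (2 * nu0) * mesh_ratio Omega X `^ (2 * (nu - nu0)))]].
Proof.
move=> d0 cO Ocone Pc specPsi specPhi nu00 nn c20 c30 c40 fPsib fPhib.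
have nu_gt0 : 0 < nu := lt_trans nu00 nn.
have W0 mu (w : 'rV[R]_d) : 0 <= sobolev_weight mu w by exact: sobolev_weight_ge0.
have mW mu := @measurable_sobolev_weight R d mu.
have fPhi_ge0 w : 0 <= fPhi w.
  by have /andP[+ _] := fPhib w; apply: le_trans; rewrite mulr_ge0// ltW.
have fPhib' w : 0 <= fPhi w <= c4 * sobolev_weight nu w.
  by rewrite fPhi_ge0/=; have /andP[] := fPhib w.
(* Cp, Cu and H are the constants of the three ingredients: residual in the
   weight of Phi, size of the coefficients, high frequencies. *)
have [Cp [h1 [Cp0 h10 pow]]] :=
  power_function_bound d0 cO Ocone Pc specPhi nu_gt0 (ltW c40) fPhib'.
have [h2 h20 qh] := separation_le_fill cO Ocone.
have [Cu Cu0 ub] := @coef_bound R d nu d0 nu_gt0.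
have [H H0 hH] := @high_frequency_bound R d nu0 d0 nu00.
pose P := Cp / c3.
have P0 : 0 < P by rewrite divr_gt0.
have [c cE] : exists c : R, c = 8 * d%:R ^+ 2 by eexists.
have d1 : 1 <= d%:R :> R by rewrite ler1n.
have dR0 : 0 < d%:R :> R by rewrite ltr0n.
have c1 : 1 <= c by rewrite cE; nra.
have c0 : 0 < c by apply: lt_le_trans c1.
pose low := 2 `^ (nu - nu0) * c `^ (2 * (nu - nu0)) * P.
pose high := H * (2 + 4 * (4 + Cu * P)) * c `^ (- (2 * nu0)).
have low0 : 0 <= low.
  by apply: mulr_ge0; [rewrite mulr_ge0 ?powR_ge0|exact: ltW].
have CuP0 : 0 < Cu * P by rewrite mulr_gt0.
have high0 : 0 <= high.
  rewrite mulr_ge0 ?powR_ge0// mulr_ge0 ?(ltW H0)//.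
  by move: CuP0; move: (Cu * P) => z; lra.
exists (c2 * (low + high) + 1), (Num.min (Num.min h1 h2) 1); split.
- by rewrite ltr_wpDl// mulr_ge0 ?addr_ge0// ltW.
- by rewrite !lt_min h10 h20 ltr01 ge_min lexx orbT.
move=> n X des; rewrite !le_min -andbA => /and3P[hh1 hh2 hle1].
have q0 := separation_radius_gt0 des; have qh' := qh _ _ des hh2.
have sepc := separated_coord des d0.
have uu := ub Omega n X des.
have pp := pow n X des.
rewrite /mesh_ratio; move: hh1 hh2 hle1 q0 qh' sepc uu pp.
move: (separation_radius X) (fill_distance Omega X) => q h.
move=> hh1 hh2 hle1 q0 qh' sepc uu pp.
have h0 : 0 < h by apply: lt_le_trans qh'.
have q1 : q <= 1 by apply: le_trans hle1.
split => //; first by rewrite divr_gt0.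
move=> x Ox; set u := kriging_weights Phi X x.
set T := trigsq (residual_coef u) (residual_pts x X).
have mT : measurable_fun [set: 'rV[R]_d] T by exact: measurable_trigsq.
have T0 w : 0 <= T w by exact: trigsq_ge0.
have mTW mu : measurable_fun [set: 'rV[R]_d] (fun w => T w * sobolev_weight mu w).
  exact: measurable_funM.
have TW0 mu w : 0 <= T w * sobolev_weight mu w by rewrite mulr_ge0.
pose h2nu := h `^ (2 * nu).
(* The lower bound on fPhi turns the form of Phi into a Sobolev norm of the
   residual. *)
have energy : (\int[lebesgue_rV R d]_w (T w * sobolev_weight nu w)%:E <= (P * h2nu)%:E)%E.
  have hpow : quadf Phi (residual_coef u) (residual_pts x X) <= Cp * h2nu.
    by apply: pp => //; rewrite h0.
  have mf : measurable_fun [set: 'rV[R]_d] fPhi.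
    by apply/measurable_EFinP; exact: measurable_int (proj1 specPhi).
  apply: le_trans (@integral_le_scale R d c3^-1 _ (fun w => T w * fPhi w) _ _ _ _ _ _) _ => //.
  - exact: measurable_funM.
  - by move=> w; rewrite mulr_ge0.
  - by rewrite invr_ge0 ltW.
  - move=> w; rewrite mulrCA ler_wpM2l// mulrC ler_pdivlMr// mulrC.
    by have /andP[] := fPhib w.
  rewrite (integral_trigsq_spectral _ _ specPhi) -EFinM lee_fin /P mulrAC mulrC.
  by rewrite ler_wpM2r// invr_ge0 ltW.
have h2nu0 : 0 <= h2nu by exact: powR_ge0.
have Ph0 : 0 <= P * h2nu by rewrite mulr_ge0// ltW.
have usq := uu q1 x u _ Ph0 energy.
pose L := c / q.
have L0 : 0 < L by rewrite divr_gt0.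
have L1 : 1 <= L by rewrite ler_pdivlMr// mul1r; apply: le_trans c1.
pose rho := h / q.
have rho0 : 0 < rho by rewrite divr_gt0.
have rho1 : 1 <= rho by rewrite ler_pdivlMr// mul1r.
set U := \sum_j _ in usq.
have U0 : 0 <= U by apply: sumr_ge0 => j _; exact: sqr_ge0.
(* Here 1 <= rho, that is q <= h, absorbs the additive constants. *)
have Ub : 2 + 4 * U <= (2 + 4 * (4 + Cu * P)) * rho `^ (2 * nu).
  have r1 : 1 <= rho `^ (2 * nu).
    rewrite -[leLHS](powRr0 rho); apply: ler_powR => //; exact: mulr_ge0 (ler0n _ 2) (ltW nu_gt0).
  have E : q `^ (- (2 * nu)) * h2nu = rho `^ (2 * nu).
    rewrite powRN -powR_inv1 ?powR_ge0// /h2nu /rho powRM ?invr_ge0 ?(ltW h0) ?(ltW q0)//.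
    by rewrite mulrC; congr (_ * _); rewrite -!powRrM -[q^-1]powR_inv1 ?(ltW q0)// -powRrM; congr (_ `^ _); ring.
  have E' : Cu * q `^ (- (2 * nu)) * (P * h2nu) = Cu * P * rho `^ (2 * nu).
    by rewrite -E; ring.
  move: usq; rewrite E'; move: r1; nra.
have main : (\int[lebesgue_rV R d]_w (T w * sobolev_weight nu0 w)%:E <=
   ((low + high) * (h `^ (2 * nu0) * rho `^ (2 * (nu - nu0))))%:E)%E.
  rewrite (@integral_split_norm1 R d L)// mulrDl EFinD; apply: leeD.
    pose lc := 2 `^ (nu - nu0) * L `^ (2 * (nu - nu0)).
    apply: le_trans (@integral_low_le R d L lc _ (fun w => T w * sobolev_weight nu w) _ _ _ _ _ _) _ => //.
    - by rewrite mulr_ge0 ?powR_ge0.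
    - by move=> w wL; rewrite mulrCA ler_wpM2l//; apply: sobolev_weight_low => //; exact: ltW.
    apply: le_trans (lee_wpmul2l _ energy) _; first by rewrite lee_fin mulr_ge0 ?powR_ge0.
    rewrite -EFinM lee_fin le_eqVlt; apply/orP; left; apply/eqP.
    rewrite /lc /low /L /h2nu /rho -powR_inv1 ?(ltW q0)//.
    rewrite !powRM ?powR_ge0 ?(ltW c0) ?(ltW h0)//.
    have -> : h `^ (2 * nu) = h `^ (2 * nu0) * h `^ (2 * (nu - nu0)).
      rewrite -powRD ?(gt_eqF h0) ?implybT//; congr (_ `^ _); ring.
    ring.
  have B0 : 0 <= 2 + 4 * U by rewrite addr_ge0// mulr_ge0.
  apply: le_trans (hH T _ L mT T0 B0 L0 _) _.
    move=> K LK; have K0 : 0 < K by apply: lt_le_trans LK.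
    have eta0 : 0 < 2 * q / d%:R by rewrite divr_gt0 ?mulr_gt0.
    have hK : 256 * d%:R <= (K * (2 * q / d%:R)) ^+ 2.
      have e : L * (2 * q / d%:R) = 16 * d%:R.
        by rewrite /L cE; field; rewrite !gt_eqF.
      have : 16 * d%:R <= K * (2 * q / d%:R) by rewrite -e ler_wpM2r// ltW.
      by move: (K * _) => k hk; nra.
    have [_ up] := laplace_trigsq_bounds u eta0 K0 hK sepc.
    apply: le_trans (@integral_le_lin2 R d 2 2 _ (laplace K^-1) (fun w => laplace K^-1 w * trigsq u X w) _ _ _ _ _ _ _ _ _) _ => //.
    - by apply: measurable_funM => //; exact: measurable_laplace.
    - exact: measurable_laplace.
    - by apply: measurable_funM; [exact: measurable_laplace|exact: measurable_trigsq].
    - by move=> w; rewrite mulr_ge0 ?laplace_ge0.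
    - by move=> w; exact: laplace_ge0.
    - by move=> w; rewrite mulr_ge0 ?laplace_ge0 ?trigsq_ge0.
    - move=> w; have := ler_wpM2l (laplace_ge0 K^-1 w) (trigsq_residual_le u x X w).
      by rewrite -/T; lra.
    rewrite integral_laplace ?invr_gt0// invrK.
    have -> : (2 + 4 * U) * (2 * K) ^+ d = 2 * (2 * K) ^+ d + 2 * ((2 * K) ^+ d * (2 * U)) by ring.
    rewrite [leRHS]EFinD [X in (_ <= X + _)%E]EFinM [X in (_ <= _ + X)%E]EFinM leeD2l//.
    by rewrite lee_wpmul2l// lee_fin.
  rewrite lee_fin.
  apply: (@le_trans _ _ (H * ((2 + 4 * (4 + Cu * P)) * rho `^ (2 * nu)) * L `^ (- (2 * nu0)))).
    by rewrite ler_wpM2r ?powR_ge0// ler_wpM2l// ltW.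
  rewrite le_eqVlt; apply/orP; left; apply/eqP.
  rewrite /high /L /rho -powR_inv1 ?(ltW q0)//.
  rewrite !powRM ?powR_ge0 ?(ltW c0) ?(ltW h0)// -!powRrM.
  have -> : h `^ (2 * nu) = h `^ (2 * nu0) * h `^ (2 * (nu - nu0)).
    rewrite -powRD ?(gt_eqF h0) ?implybT//; congr (_ `^ _); ring.
  have -> : q `^ (-1 * (2 * (nu - nu0))) = q `^ (-1 * (2 * nu)) * q `^ (-1 * - (2 * nu0)).
    rewrite -powRD ?(gt_eqF q0) ?implybT//; congr (_ `^ _); ring.
  ring.
rewrite -lee_fin -(integral_trigsq_spectral _ _ specPsi).
have mf : measurable_fun [set: 'rV[R]_d] fPsi.
  by apply/measurable_EFinP; exact: measurable_int (proj1 specPsi).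
apply: (@le_trans _ _ (c2%:E * \int[lebesgue_rV R d]_w (T w * sobolev_weight nu0 w)%:E)%E).
  apply: integral_le_scale => //.
  - exact: measurable_funM.
  - by move=> w; rewrite mulr_ge0//; have /andP[] := fPsib w.
  - exact: ltW.
  - by move=> w; rewrite mulrCA ler_wpM2l//; have /andP[] := fPsib w.
apply: le_trans (lee_wpmul2l _ main) _; first by rewrite lee_fin ltW.
rewrite -EFinM lee_fin -/rho; set Z := _ * rho `^ _.
have Z0 : 0 <= Z by rewrite mulr_ge0 ?powR_ge0.
by rewrite [leLHS]mulrA ler_wpM2r// lerDl.
Qed.

(** * Measurability on finite-dimensional space *)

Section caratheodory.
Context {R : realType} {d : nat} {disp} {T : measurableType disp}.

(** Rounding has countably many values, with measurable fibres, and converges to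
    the identity: it reduces topological statements to countable unions. *)
Definition rounding (n : nat) (x : 'rV[R]_d) : 'rV[R]_d :=
  \row_i ((Num.floor (x 0 i * n.+1%:R))%:~R / n.+1%:R).

Lemma rounding_dist (n : nat) (x : 'rV[R]_d) : `|rounding n x - x| <= n.+1%:R^-1.
Proof.
rewrite /Num.norm/= mx_normrE; apply/bigmax_leP; split; first by rewrite invr_ge0.
move=> [i j] _ /=; rewrite !mxE ord1.
have n0 : 0 < n.+1%:R :> R by [].
have /andP[f1 f2] := real_floor_itv (num_real (x 0 j * n.+1%:R)).
rewrite intrD in f2.
rewrite -(ler_pM2r n0) -[X in _ * X]ger0_norm// -normrM mulrBl divfK ?gt_eqF//.
rewrite mulVf ?gt_eqF//.
by rewrite ler_norml; apply/andP; split; lra.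
Qed.

Lemma rounding_cvg (x : 'rV[R]_d) : rounding n x @[n --> \oo] --> x.
Proof.
apply/cvgrPdist_le => e e0; near=> n.
rewrite distrC; apply: le_trans (rounding_dist n x) _.
near: n; have := near_infty_natSinv_lt (PosNum e0).
by apply: filterS => n /= /ltW.
Unshelve. all: by end_near. Qed.

Lemma measurable_rounding_cell (n : nat) (k : 'rV[int]_d) :
  measurable [set x : 'rV[R]_d | forall i, Num.floor (x 0 i * n.+1%:R) = k 0 i].
Proof.
rewrite (_ : [set _ | _] = \bigcap_(i in [set: 'I_d])
   (rV_coord i @^-1` `[(k 0 i)%:~R / n.+1%:R, (k 0 i + 1)%:~R / n.+1%:R[)); last first.
  have eqv (r : R) (z : int) : (Num.floor (r * n.+1%:R) = z) <->
      r \in `[z%:~R / n.+1%:R, (z + 1)%:~R / n.+1%:R[.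
    rewrite in_itv/= ler_pdivrMr// ltr_pdivlMr//; split=> [<-|/floor_def //].
    exact: real_floor_itv (num_real _).
  apply/seteqP; split => x /= h i; first by move=> _; apply/eqv; exact: h.
  by apply/eqv; exact: h.
apply: fin_bigcap_measurable => // i _; rewrite -[X in measurable X]setTI.
exact: measurable_rV_coord.
Qed.

(** Pointwise limit of f (rounding n x) w, which is measurable because rounding
    has countably many values. *)
Lemma measurable_caratheodory (f : 'rV[R]_d -> T -> R) :
  (forall w, continuous (f ^~ w)) -> (forall x, measurable_fun [set: T] (f x)) ->
  measurable_fun [set: 'rV[R]_d * T] (fun z => f z.1 z.2).
Proof.
move=> cf mf.
apply: (@measurable_fun_cvg _ _ _ _ (fun n z => f (rounding n z.1) z.2)); last first.
  move=> [x w] _ /=; apply: (cvg_comp (rounding ^~ x) (f ^~ w)); last exact: cf.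
  exact: rounding_cvg.
move=> n _ B mB; rewrite setTI.
(* pt k is the common rounding of the points of the cell with index k. *)
pose pt (k : 'rV[int]_d) : 'rV[R]_d := \row_i ((k 0 i)%:~R / n.+1%:R).
pose S (k : 'rV[int]_d) := [set x : 'rV[R]_d | forall i, Num.floor (x 0 i * n.+1%:R) = k 0 i]
   `*` (f (pt k) @^-1` B).
have -> : (fun z => f (rounding n z.1) z.2) @^-1` B =
    \bigcup_m (if unpickle m is Some k then S k else set0).
  apply/seteqP; split => [[x w]/= Bx|[x w]/= [m _]].
    exists (pickle (\row_i Num.floor (x 0 i * n.+1%:R) : 'rV[int]_d)) => //.
    rewrite pickleK; split => /=; first by move=> i; rewrite mxE.
    by rewrite (_ : pt _ = rounding n x)//; apply/rowP => i; rewrite !mxE.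
  case: unpickle => // k [/= xk Bk].
  by rewrite (_ : rounding n x = pt k)//; apply/rowP => i; rewrite !mxE xk.
apply: bigcupT_measurable => m; case: unpickle => // k.
apply: measurableX; first exact: measurable_rounding_cell.
by rewrite -[X in measurable X]setTI; exact: mf.
Qed.

End caratheodory.

Section closed_sets.
Context {R : realType} {d : nat}.

Lemma measurable_rounding_preimage (n : nat) (B : set 'rV[R]_d) :
  measurable [set x : 'rV[R]_d | B (rounding n x)].
Proof.
pose pt (k : 'rV[int]_d) : 'rV[R]_d := \row_i ((k 0 i)%:~R / n.+1%:R).
pose S (k : 'rV[int]_d) :=
  [set x : 'rV[R]_d | forall i, Num.floor (x 0 i * n.+1%:R) = k 0 i].
rewrite (_ : [set x | _] = \bigcup_m (if unpickle m is Some k then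
    if `[< B (pt k) >] then S k else set0 else set0)); last first.
  apply/seteqP; split => [x/= Bx|x/= [m _]].
    exists (pickle (\row_i Num.floor (x 0 i * n.+1%:R) : 'rV[int]_d)) => //.
    rewrite pickleK ifT; last first.
      apply/asboolP; rewrite (_ : pt _ = rounding n x)//.
      by apply/rowP => i; rewrite !mxE.
    by move=> i; rewrite mxE.
  case: unpickle => // k; case: ifPn => // /asboolP Bk xk.
  by rewrite (_ : rounding n x = pt k)//; apply/rowP => i; rewrite !mxE xk.
apply: bigcupT_measurable => m; case: unpickle => // k; case: ifP => // _.
exact: measurable_rounding_cell.
Qed.

(** A closed set consists of the points all of whose roundings are within the
    rounding error of it, and preimages under rounding of arbitrary sets are
    measurable. *)
Lemma closed_measurable_rV (A : set 'rV[R]_d) : closed A -> measurable A.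
Proof.
move=> clA.
pose B n := [set y : 'rV[R]_d | exists2 a, A a & `|y - a| <= n.+1%:R^-1].
rewrite (_ : A = \bigcap_n [set x | B n (rounding n x)]); last first.
  apply/seteqP; split => [x Ax n _ /=|x Bx]; first by exists x => //; exact: rounding_dist.
  apply: clA => U /nbhs_ballP[e /= e0 eU].
  have [n ne] : exists n, n.+1%:R^-1 < e / 2 :> R.
    have := near_infty_natSinv_lt (PosNum (divr_gt0 e0 (ltr0n R 2))).
    by move=> [N _ hN]; exists N; apply: (hN N) => /=.
  have [a Aa ha] := Bx n I; exists a; split => //; apply: eU.
  rewrite -ball_normE /ball_/=.
  have -> : x - a = (rounding n x - a) - (rounding n x - x) by apply/rowP => i; rewrite !mxE; ring.
  apply: le_lt_trans (ler_normB _ _) _.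
  apply: le_lt_trans (lerD ha (rounding_dist n x)) _; rewrite [ltRHS]splitr; exact: ltrD.
by apply: bigcapT_measurable => n; exact: measurable_rounding_preimage.
Qed.

Lemma compact_finite_volume (A : set 'rV[R]_d) : compact A ->
  exists2 M : R, 0 < M & (lebesgue_rV R d A <= M%:E)%E.
Proof.
move=> cA; have [D hD] := compact_coord_bounded cA.
have mA : measurable A.
  by apply: closed_measurable_rV; exact: compact_closed (@norm_hausdorff _ _) cA.
pose L := d%:R * D.
have i1 : 0 < (1 : R)^-1 by rewrite invr1.
exists (expR L * (2 / 1) ^+ d); first by rewrite mulr_gt0 ?expR_gt0 ?exprn_gt0.
rewrite EFinM -(integral_laplace d (ltr01 : 0 < (1 : R))).
rewrite -[leLHS]mul1e -integral_cst//.
apply: (@le_trans _ _ (\int[lebesgue_rV R d]_(w in [set w | (norm1 w <= L)%R]) 1%:E)%E).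
  apply: ge0_subset_integral => //; first exact: measurable_norm1_le.
  move=> x Ax; rewrite /norm1/= /L mulr_natl -[X in _ *+ X]card_ord -sumr_const.
  by apply: ler_sum => i _; exact: hD.
apply: (@integral_low_le R d L (expR L) (fun=> 1) (laplace 1)) => //.
- exact: measurable_laplace.
- by move=> w; exact: laplace_ge0.
- by move=> w wL; rewrite /laplace -expRD mul1r -[leLHS]expR0 ler_expR subr_ge0.
Qed.

End closed_sets.

(** * Exponential moments of Gaussian variables *)

Section density.
Import HBNNSimple.

(** The integral against nu is the supremum over simple functions below f, and for
    a simple function the density can be inserted level set by level set. *)
Lemma ge0_integral_density_le {disp} {T : measurableType disp} {R : realType}
    (nu mu : {measure set T -> \bar R}) (f g : T -> R) :
  measurable_fun [set: T] f -> measurable_fun [set: T] g ->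
  (forall x, 0 <= f x) -> (forall x, 0 <= g x) ->
  (forall A, measurable A -> nu A = \int[mu]_(x in A) (g x)%:E)%E ->
  (\int[nu]_x (f x)%:E <= \int[mu]_x (f x * g x)%:E)%E.
Proof.
move=> mf mg f0 g0 dens.
rewrite ge0_integralE//; last by move=> x _; rewrite lee_fin.
apply: ge_ereal_sup => _ [h /= hf <-].
have hfx x : h x <= f x by have := hf x; rewrite patch_setT lee_fin.
apply: (@le_trans _ _ (\int[mu]_x (h x * g x)%:E)%E); last first.
  apply: ge0_le_integral => //=.
  - by move=> x _; rewrite lee_fin mulr_ge0.
  - by apply/measurable_EFinP; exact: measurable_funM.
  - by apply/measurable_EFinP; exact: measurable_funM.
  - by move=> x _; rewrite lee_fin ler_wpM2r.
have mh r : measurable (h @^-1` [set r]) by exact: measurable_sfunP.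
rewrite sintegralE.
rewrite [leRHS](_ : _ = \int[mu]_x (\sum_(r \in range h) (r * (\1_(h @^-1` [set r]) x) * g x)%:E))%E; last first.
  apply: eq_integral => x _; rewrite [in LHS](fimfunE h) EFinM -fsumEFin//.
  rewrite ge0_mule_fsuml; last by move=> r; rewrite EFinM nnfun_muleindic_ge0.
  by apply: eq_fsbigr => r _; rewrite -EFinM.
rewrite ge0_integral_fsum//=; last 2 first.
- move=> r; apply/measurable_EFinP; apply: measurable_funM => //.
  by apply: measurable_funM => //; exact: measurable_indic.
- move=> r x _; rewrite EFinM mule_ge0 ?lee_fin//.
  by have := @nnfun_muleindic_ge0 _ _ _ h r x; rewrite -EFinM lee_fin.
rewrite lee_fsum// => r [t _ <-].
rewrite dens// [in leLHS]integral_mkcond/= -ge0_integralZl_EFin//.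
- rewrite le_eqVlt; apply/orP; left; apply/eqP; apply: eq_integral => x _.
  rewrite patchE indicE; case: (x \in _); by rewrite ?mule0 ?mulr1 ?mulr0 ?mul0r -?EFinM.
- move=> x _; rewrite patchE; case: ifP => // _; by rewrite lee_fin.
- apply: (measurable_restrictT _ (mh _)).1.
  by apply/measurable_EFinP/measurable_funTS.
Qed.

End density.

Section normal_moments.
Context {R : realType}.
Implicit Types m s v y : R.

Lemma normal_peak_double s : 0 < s -> normal_peak s = 2 * normal_peak (2 * s).
Proof.
move=> s0; rewrite /normal_peak.
have -> : (2 * s) ^+ 2 * pi *+ 2 = 2 ^+ 2 * (s ^+ 2 * pi *+ 2) :> R.
  by rewrite exprMn mulrnAr mulrA.
rewrite sqrtrM ?exprn_ge0// sqrtr_sqr ger0_norm// invfM mulrA mulfV// mul1r//.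
Qed.

(** Doubling the standard deviation leaves a Gaussian factor to spare.  Exponential
    moments and tails are both read off from it. *)
Lemma normal_pdf_double m s y : 0 < s ->
  normal_pdf m s y = 2 * expR (- (3 * (y - m) ^+ 2 / (8 * s ^+ 2))) * normal_pdf m (2 * s) y.
Proof.
move=> s0; rewrite !normal_pdfE ?gt_eqF ?mulr_gt0// normal_peak_double//.
have -> : normal_fun m s y =
    expR (- (3 * (y - m) ^+ 2 / (8 * s ^+ 2))) * normal_fun m (2 * s) y.
  by rewrite /normal_fun -expRD; congr expR; field; rewrite gt_eqF.
by ring.
Qed.

Lemma normal_peak_le s : 0 < s -> normal_peak s <= (2 * s)^-1.
Proof.
move=> s0; rewrite /normal_peak lef_pV2 ?posrE ?mulr_gt0//; last first.
  by rewrite sqrtr_gt0 mulrn_wgt0// mulr_gt0 ?pi_gt0 ?exprn_gt0.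
rewrite -[leLHS]ger0_norm ?mulr_ge0 ?(ltW s0)// -sqrtr_sqr ler_wsqrtr//.
have := @pi_ge2 R; have : 0 < s ^+ 2 by rewrite exprn_gt0.
by rewrite exprMn -mulr_natl; nra.
Qed.

Lemma normal_prob_itv_le m s v : 0 < s -> 0 < v ->
  (normal_prob m s `[(- (2 * v))%R, (2 * v)%R] <= (2 * v / s)%:E)%E.
Proof.
move=> s0 v0; rewrite /normal_prob.
apply: (@le_trans _ _ (\int[lebesgue_measure]_(x in `[(- (2 * v))%R, (2 * v)%R]) ((2 * s)^-1)%:E)%E).
  apply: ge0_le_integral => //=.
  - by move=> x _; rewrite lee_fin normal_pdf_ge0.
  - by apply/measurable_EFinP/measurable_funTS; exact: measurable_normal_pdf.
  - move=> x _; rewrite lee_fin; apply: le_trans (normal_peak_le s0).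
    by apply: normal_pdf_ub; rewrite gt_eqF.
rewrite integral_cst//= lebesgue_measure_itv/= lte_fin ifT; last by lra.
rewrite -EFinB -EFinM lee_fin le_eqVlt; apply/orP; left; apply/eqP.
by field; rewrite gt_eqF.
Qed.

(** At distance 3 s from the mean the ratio in [normal_pdf_double] is at most
    2 exp (- 27/8) <= 2 / (1 + 27/8) = 16/35. *)
Lemma normal_prob_far m s (A : set R) : 0 < s -> measurable A ->
  (forall y, A y -> 3 * s <= `|y - m|) -> (normal_prob m s A <= (16 / 35)%:E)%E.
Proof.
move=> s0 mA hA; rewrite /normal_prob.
have int1 := integral_normal_pdf m (2 * s).
apply: (@le_trans _ _ (\int[lebesgue_measure]_(x in A) ((16 / 35)%:E * (normal_pdf m (2 * s) x)%:E))%E).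
  apply: ge0_le_integral => //=.
  - by move=> x _; rewrite lee_fin normal_pdf_ge0.
  - by apply/measurable_EFinP/measurable_funTS; exact: measurable_normal_pdf.
  - by apply/measurable_funeM/measurable_EFinP/measurable_funTS; exact: measurable_normal_pdf.
  - move=> x Ax; rewrite -EFinM lee_fin normal_pdf_double// ler_wpM2r ?normal_pdf_ge0//.
    have z : 27 / 8 <= 3 * (x - m) ^+ 2 / (8 * s ^+ 2).
      rewrite ler_pdivlMr ?mulr_gt0 ?exprn_gt0//.
      have : (3 * s) ^+ 2 <= `|x - m| ^+ 2 by rewrite lerXn2r ?nnegrE ?mulr_ge0 ?(ltW s0) ?hA.
      rewrite real_normK ?num_real// exprMn; lra.
    rewrite expRN; have := expR_ge1Dx (3 * (x - m) ^+ 2 / (8 * s ^+ 2)).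
    move: z; move: (3 * _ / _) => z hz ez.
    rewrite ler_pdivrMr ?expR_gt0//; lra.
rewrite ge0_integralZl_EFin//; last 2 first.
- by move=> x _; rewrite lee_fin normal_pdf_ge0.
- by apply/measurable_EFinP/measurable_funTS; exact: measurable_normal_pdf.
rewrite -[leRHS]mule1 lee_wpmul2l// -int1.
apply: ge0_subset_integral => //.
- by apply/measurable_EFinP; exact: measurable_normal_pdf.
- by move=> x _; rewrite lee_fin normal_pdf_ge0.
Qed.

End normal_moments.

Lemma measurable_norm_ge (R : realType) (c : R) : measurable [set y : R | c <= `|y|].
Proof.
rewrite (_ : [set y | _] = [set: R] `&` (Num.norm @^-1` `[c, +oo[)); last first.
  by rewrite setTI; apply/seteqP; split => y /=; rewrite in_itv/= andbT.
apply: (continuous_measurable_fun (@norm_continuous R R)) => //.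
Qed.

(** The line carries two measurable structures with different displays, that of
    V and that of the normal law; V is repackaged for the second one. *)
Lemma integral_normal_law {disp} {T : measurableType disp} {R : realType}
    (P : probability T R) (V : T -> R) (m s : R) (f : R -> \bar R) :
  measurable_fun [set: T] V -> measurable_fun [set: R] f -> (forall x, 0 <= f x)%E ->
  (forall B : set R, measurable B -> P (V @^-1` B) = normal_prob m s B) ->
  (\int[P]_w (f (V w)) = \int[normal_prob m s]_y (f y))%E.
Proof.
move=> mV mf f0 law.
have mV' : measurable_fun [set: T] (V : T -> measurableTypeR R) by exact: mV.
have mf' : measurable_fun [set: measurableTypeR R] f by exact: mf.
pose V' : {mfun T >-> measurableTypeR R} := HB.pack V (@isMeasurableFun.Build _ _ T (measurableTypeR R) V mV').
transitivity (\int[pushforward P V']_y f y)%E.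
  by rewrite (@ge0_integral_pushforward _ _ T (measurableTypeR R)).
apply: eq_measure_integral => B mB _; exact: law.
Qed.

Section gaussian.
Context {disp} {T : measurableType disp} {R : realType} (P : probability T R).

Lemma second_moment_tail (V : T -> R) (v : R) :
  measurable_fun [set: T] V -> 0 < v ->
  (\int[P]_w (V w ^+ 2)%:E <= (v ^+ 2)%:E)%E ->
  (P (V @^-1` [set y | (2 * v <= `|y|)%R]) <= (4^-1)%:E)%E.
Proof.
move=> mV v0 hV; set A := [set y | _].
have mA : measurable (V @^-1` A).
  rewrite -[X in measurable X]setTI; apply: mV => //.
  exact: measurable_norm_ge.
have v2 : 0 < v ^+ 2 by rewrite exprn_gt0.
have : ((4 * v ^+ 2)%:E * P (V @^-1` A) <= (v ^+ 2)%:E)%E.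
  apply: le_trans hV.
  rewrite -[P _]mul1e -integral_cst// -ge0_integralZl_EFin//; last 1 first.
  - by rewrite mulr_ge0// ltW.
  apply: (@le_trans _ _ (\int[P]_(w in V @^-1` A) (V w ^+ 2)%:E)%E).
    apply: ge0_le_integral => //=.
    - by move=> w _; rewrite mule1 lee_fin mulr_ge0// ltW.
    - by apply/measurable_EFinP/measurable_funTS; exact: measurable_funX.
    - move=> w; rewrite /A/= mule1 lee_fin => h.
      rewrite (_ : 4 * v ^+ 2 = (2 * v) ^+ 2); last by ring.
      by rewrite -[leRHS]real_normK ?num_real// lerXn2r ?nnegrE// mulr_ge0// ltW.
  apply: ge0_subset_integral => //.
  - by apply/measurable_EFinP; exact: measurable_funX.
  - by move=> w _; rewrite lee_fin sqr_ge0.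
have : P (V @^-1` A) \is a fin_num by exact: fin_num_measure.
move: (P _) => [r| |] // _; rewrite -EFinM !lee_fin => h.
by rewrite -(ler_pM2l v2) -(@ler_pM2l _ 4)// mulrA; move: h; lra.
Qed.

(** The interval [- 2 v, 2 v] has probability at least 3/4 by Chebyshev.  As the
    density is at most 1 / (2 s), this forces s <= 3 v, and as the law
    charges little beyond 3 s from m, it forces |m| <= 2 v + 3 s <= 11 v.  Then
    y^2 / (48 v^2) is absorbed by the factor of [normal_pdf_double]. *)
Lemma gaussian_exp_moment (V : T -> R) (v : R) :
  measurable_fun [set: T] V -> gaussian_rv P V -> 0 < v ->
  (\int[P]_w (V w ^+ 2)%:E <= (v ^+ 2)%:E)%E ->
  (\int[P]_w (expR (V w ^+ 2 / (48 * v ^+ 2)))%:E <= (2 * expR 6)%:E)%E.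
Proof.
move=> mV [m [s [s0 law]]] v0 hV.
have v2 : 0 < v ^+ 2 by rewrite exprn_gt0.
have tail := second_moment_tail mV v0 hV.
set A := [set y : R | _] in tail.
have mA : measurable A by exact: measurable_norm_ge.
rewrite law// in tail.
pose f (y : R) := expR (y ^+ 2 / (48 * v ^+ 2)).
have mf : measurable_fun [set: R] f.
  by apply: measurableT_comp => //; apply: measurable_funM.
have f0 y : 0 <= f y by exact: expR_ge0.
have [s_eq0|sn0] := eqVneq s 0.
  rewrite /normal_law s_eq0 eqxx in law tail.
  have -> : (\int[P]_w (expR (V w ^+ 2 / (48 * v ^+ 2)))%:E =
      \int[pushforward P V]_y (f y)%:E)%E.
    rewrite ge0_integral_pushforward//.
    - exact/measurable_EFinP.
    - by move=> y _; rewrite lee_fin.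
  have -> : (\int[pushforward P V]_y (f y)%:E = \int[\d_m]_y (f y)%:E)%E.
    by apply: eq_measure_integral => B mB _; exact: law.
  rewrite integral_dirac//=; last exact/measurable_EFinP.
  rewrite diracT mul1e lee_fin /f.
  have mv : `|m| < 2 * v.
    rewrite ltNge; apply/negP => h; move: tail; rewrite diracE mem_set//= lee_fin; lra.
  have m2 : m ^+ 2 <= 4 * v ^+ 2.
    rewrite -real_normK ?num_real// (_ : 4 * v ^+ 2 = (2 * v) ^+ 2); last by ring.
    by rewrite lerXn2r ?nnegrE ?mulr_ge0// ltW.
  have e6 := @expR_gt0 R 6.
  apply: (@le_trans _ _ (expR 6)); last by lra.
  by rewrite ler_expR ler_pdivrMr ?mulr_gt0//; lra.
have sgt0 : 0 < s by rewrite lt_neqAle eq_sym sn0.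
rewrite /normal_law (negbTE sn0) in law tail.
have mAC : measurable (`[(- (2 * v))%R, (2 * v)%R] : set R) by exact: measurable_itv.
have AU : A `|` `[(- (2 * v))%R, (2 * v)%R]%classic = [set: R].
  apply/seteqP; split => // y _; rewrite /A/=; have [h|h] := leP (2 * v) `|y|; [by left|right].
  by rewrite in_itv/= -ler_norml ltW.
(* The two sets cover the line, so the interval has mass at least 3/4. *)
have cover : (1 <= normal_prob m s A + normal_prob m s `[(- (2 * v))%R, (2 * v)%R])%E.
  rewrite -(@probability_setT _ _ _ (normal_prob m s)) -AU.
  exact: measureU2.
have s_le : s <= 3 * v.
  have h := le_trans cover (leeD tail (normal_prob_itv_le m sgt0 v0)).
  move: h; rewrite -EFinD lee_fin => h.
  have : 3 / 4 * s <= 2 * v / s * s by rewrite ler_pM2r//; lra.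
  by rewrite divfK//; lra.
have m_le : `|m| <= 2 * v + 3 * s.
  rewrite leNgt; apply/negP => hm.
  have far : forall y, y \in `[(- (2 * v))%R, (2 * v)%R] -> 3 * s <= `|y - m|.
    move=> y; rewrite in_itv/= -ler_norml => hy.
    by have := lerB_dist m y; rewrite distrC; lra.
  have := le_trans cover (leeD tail (normal_prob_far sgt0 mAC far)).
  by rewrite -EFinD lee_fin; lra.
rewrite (integral_normal_law (f := fun y => (f y)%:E) mV _ _ law); last 2 first.
- exact/measurable_EFinP.
- by move=> y; rewrite lee_fin.
apply: le_trans (ge0_integral_density_le (mu := lebesgue_measure) (g := normal_pdf m s) mf _ f0 _ _) _ => //.
- exact: measurable_normal_pdf.
- by move=> y; exact: normal_pdf_ge0.
have int1 := integral_normal_pdf m (2 * s).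
rewrite -[leRHS]mule1 -int1 -ge0_integralZl_EFin//; first last.
- by apply/measurable_EFinP; exact: measurable_normal_pdf.
- by move=> y _; rewrite lee_fin normal_pdf_ge0.
apply: ge0_le_integral => //=.
- by move=> y _; rewrite lee_fin mulr_ge0// normal_pdf_ge0.
- by apply/measurable_EFinP; apply: measurable_funM => //; exact: measurable_normal_pdf.
- by apply/measurable_funeM/measurable_EFinP; exact: measurable_normal_pdf.
move=> y _; rewrite -EFinM lee_fin normal_pdf_double// mulrA ler_wpM2r ?normal_pdf_ge0//.
rewrite mulrCA ler_pM2l// /f -expRD ler_expR.
have s2 : 0 < s ^+ 2 by rewrite exprn_gt0.
set z := y - m.
have yE : y ^+ 2 <= 2 * z ^+ 2 + 2 * m ^+ 2.
  by have := sqr_ge0 (y - 2 * m); rewrite /z; lra.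
have m2 : m ^+ 2 <= 121 * v ^+ 2.
  rewrite -real_normK ?num_real// (_ : 121 * v ^+ 2 = (11 * v) ^+ 2); last by ring.
  by rewrite lerXn2r ?nnegrE ?mulr_ge0 ?(ltW v0)//; lra.
have s2le : s ^+ 2 <= 9 * v ^+ 2.
  rewrite (_ : 9 * v ^+ 2 = (3 * v) ^+ 2); last by ring.
  by rewrite lerXn2r ?nnegrE ?mulr_ge0 ?(ltW v0)// ltW.
have t1 : y ^+ 2 / (48 * v ^+ 2) <= z ^+ 2 / (24 * v ^+ 2) + 242 / 48.
  rewrite ler_pdivrMr ?mulr_gt0//.
  rewrite (_ : (_ + _) * _ = 2 * z ^+ 2 + 242 * v ^+ 2); last by field; rewrite gt_eqF.
  lra.
have t2 : z ^+ 2 / (24 * v ^+ 2) <= 3 * z ^+ 2 / (8 * s ^+ 2).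
  rewrite ler_pdivrMr ?mulr_gt0// (_ : 3 * z ^+ 2 / _ * _ = z ^+ 2 * (9 * v ^+ 2) / s ^+ 2); last first.
    by field; rewrite gt_eqF.
  by rewrite ler_pdivlMr// ler_wpM2l// sqr_ge0.
by move: t1 t2; lra.
Qed.

End gaussian.

(** * From pointwise variances to the norm *)

Section second_moment.
Context {disp} {T : measurableType disp} {R : realType} {d : nat}
  (P : probability T R) (sigma : R) (Psi : 'rV[R]_d -> R) (Z : 'rV[R]_d -> {RV P >-> R}).
Hypothesis Zgp : stationary_gaussian_process sigma Psi Z.

Lemma product_moment x y :
  (\int[P]_w (Z x w * Z y w)%:E = (sigma ^+ 2 * Psi (x - y))%:E)%E.
Proof.
have [_ _ mean cov] := Zgp.
rewrite -cov covariance.unlock !mean /= unlock.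
apply: eq_integral => w _.
rewrite (_ : (_ * _ : T -> R) w = (Z x w - 0) * (Z y w - 0))// !subr0 //.
Qed.

Lemma integrable_product x y :
  P.-integrable [set: T] (fun w => (Z x w * Z y w)%:E).
Proof.
have sq z : P.-integrable [set: T] (fun w => (Z z w * Z z w)%:E).
  apply/integrableP; split; first by apply/measurable_EFinP; exact: measurable_funM.
  rewrite (_ : integral _ _ _ = (sigma ^+ 2 * Psi (z - z))%:E) ?ltry//.
  rewrite -product_moment; apply: eq_integral => w _.
  by rewrite gee0_abs// lee_fin -expr2 sqr_ge0.
apply: le_integrable (integrableD measurableT (sq x) (sq y)) => //.
  by apply/measurable_EFinP; exact: measurable_funM.
move=> w _; rewrite -EFinD !abse_EFin lee_fin normrM [leRHS]ger0_norm; last first.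
  by rewrite addr_ge0// -expr2 sqr_ge0.
rewrite -!expr2 -[Z x w ^+ 2]real_normK ?num_real// -[Z y w ^+ 2]real_normK ?num_real//.
by have := sqr_ge0 (`|Z x w| - `|Z y w|); have := sqr_ge0 (`|Z x w| + `|Z y w|); nra.
Qed.

Lemma second_moment_combination (n : nat) (x : 'I_n -> 'rV[R]_d) (a : 'I_n -> R) :
  (\int[P]_w ((\sum_i a i * Z (x i) w) ^+ 2)%:E = (sigma ^+ 2 * quadf Psi a x)%:E)%E.
Proof.
transitivity (\int[P]_w \sum_i \sum_j ((a i * a j)%:E * (Z (x i) w * Z (x j) w)%:E))%E.
  apply: eq_integral => w _; rewrite expr2 big_distrlr/= -sumEFin; apply: eq_bigr => i _.
  rewrite -sumEFin; apply: eq_bigr => j _; rewrite -EFinM; congr (_%:E); ring.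
have intc i j : P.-integrable [set: T] (fun w => (a i * a j)%:E * (Z (x i) w * Z (x j) w)%:E)%E.
  by apply: integrableZl => //; exact: integrable_product.
rewrite integral_sum//=; last by move=> i; apply: integrable_sum.
rewrite /quadf mulr_sumr -sumEFin; apply: eq_bigr => i _.
rewrite integral_sum//= mulr_sumr -sumEFin; apply: eq_bigr => j _.
rewrite integralZl//; last exact: integrable_product.
by rewrite product_moment -EFinM; congr (_%:E); ring.
Qed.

End second_moment.

(** With z = |g| / s the claim is z^p <= 1/2 + exp (lam (z^2 - 1/8)).  If z <= 1/2
    the first summand is enough; otherwise z^2 - 1/8 >= z^2 / 2 and
    z <= exp (z^2 / 2). *)
Lemma powR_exp_bound (R : realType) (p g s lam b : R) :
  1 <= p -> 0 < s -> p <= lam -> lam = s ^+ 2 / b -> 0 < b ->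
  `|g| `^ p <= s `^ p * (2^-1 + expR (- (lam / 8)) * expR (g ^+ 2 / b)).
Proof.
move=> p1 s0 pl lamE b0; pose z := `|g| / s.
have z0 : 0 <= z by rewrite divr_ge0// ltW.
have p0 : 0 < p by apply: lt_le_trans p1.
have -> : `|g| = s * z by rewrite /z mulrCA mulfV ?mulr1// gt_eqF.
rewrite powRM ?(ltW s0)// ler_wpM2l ?powR_ge0//.
have [zs|zb] := leP z 2^-1.
  apply: (@le_trans _ _ 2^-1); last by rewrite lerDl mulr_ge0 ?expR_ge0.
  apply: (@le_trans _ _ (2^-1 `^ p)).
    by rewrite ge0_ler_powR ?nnegrE ?(ltW p0).
  by apply: ge1r_powR => //; lra.
apply: (@le_trans _ _ (expR (- (lam / 8)) * expR (g ^+ 2 / b))); last by rewrite lerDr.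
have gE : g ^+ 2 / b = lam * z ^+ 2.
  rewrite lamE /z expr_div_n real_normK ?num_real//; field.
  by rewrite !gt_eqF.
rewrite gE -expRD.
have ze : z <= expR (z ^+ 2 / 2).
  by apply: le_trans (expR_ge1Dx _); have := sqr_ge0 (z - 1); lra.
apply: (@le_trans _ _ (expR (z ^+ 2 / 2) `^ p)).
  by rewrite ge0_ler_powR ?nnegrE ?(ltW p0) ?expR_ge0.
rewrite -expRM ler_expR.
have z2 : 4^-1 <= z ^+ 2 by nra.
have l0 : 0 < lam by apply: lt_le_trans pl.
have : z ^+ 2 / 2 * p <= z ^+ 2 / 2 * lam by rewrite ler_wpM2l// divr_ge0// sqr_ge0.
nra.
Qed.

Lemma markov_le {disp} {T : measurableType disp} {R : realType} (P : probability T R)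
    (J : T -> \bar R) (c k : R) :
  measurable_fun [set: T] J -> (forall w, 0 <= J w)%E -> 0 < c ->
  (\int[P]_w J w <= k%:E)%E ->
  exists2 E : set T, measurable E &
    (forall w, E w -> (J w <= c%:E)%E) /\ ((1 - k / c)%:E <= P E)%E.
Proof.
move=> mJ J0 c0 Jk.
have mE : measurable [set w | (c%:E < J w)%E].
  rewrite -[X in measurable X]setTI.
  by apply: emeasurable_fun_o_infty.
exists (~` [set w | (c%:E < J w)%E]); first exact: measurableC.
split; first by move=> w /= /negP; rewrite -leNgt.
rewrite probability_setC//.
have h : (c%:E * P [set w | (c%:E < J w)%E] <= k%:E)%E.
  apply: le_trans Jk.
  rewrite -integral_cst//.
  apply: (@le_trans _ _ (\int[P]_(w in [set w | (c%:E < J w)%E]) J w)%E).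
    apply: ge0_le_integral => //=.
    - by move=> w _; rewrite lee_fin ltW.
    - exact: measurable_funTS.
    - by move=> w /ltW.
  by apply: ge0_subset_integral.
have : P [set w | (c%:E < J w)%E] \is a fin_num by exact: fin_num_measure.
move: h; move: (P [set w | (c%:E < J w)%E]) => [r| |] // h _.
move: h; rewrite -EFinM -EFinB !lee_fin => h.
by rewrite lerD2l lerN2 ler_pdivlMr// mulrC.
Qed.

(** On the event that the integral of the exponential moments over Omega is at most
    (M / 2) exp (lam / 8), integrating [powR_exp_bound] bounds the p-th power of
    the norm by s^p M.  The factor 32 K in Y makes lam so large that the constant
    in Markov's inequality is absorbed in half of the exponent. *)
Lemma Lp_tail (R : realType) (d : nat) (Omega : set 'rV[R]_d) (p M K M1 Y : R) :
  measurable Omega -> (lebesgue_rV R d Omega <= M%:E)%E -> 0 < M -> 1 <= p -> 0 < K ->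
  M1 = M `^ p^-1 -> Y = 48 * (p + 32 * K) ->
  forall disp (T : measurableType disp) (P : probability T R)
    (G : 'rV[R]_d -> T -> R) (v t : R),
  measurable_fun [set: 'rV[R]_d * T] (fun z => G z.1 z.2) -> 0 < v -> 0 < t ->
  (forall x, Omega x ->
    (\int[P]_w (expR (G x w ^+ 2 / (48 * v ^+ 2)))%:E <= K%:E)%E) ->
  exists2 E : set T, measurable E &
   ((1 - expR (- (t ^+ 2 / (768 * M1 ^+ 2 * v ^+ 2))))%:E <= P E)%E /\
   forall w, E w -> (\int[lebesgue_rV R d]_x (`|G x w| `^ p * \1_Omega x)%:E
     <= ((M1 * Y * v + t) `^ p)%:E)%E.
Proof.
move=> mO vol M0 p1 K0 M1E YE disp T P G v t mG v0 t0 hG.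
have p0 : 0 < p by apply: lt_le_trans p1.
have M10 : 0 < M1 by rewrite M1E powR_gt0.
(* M1 s = M1 Y v + t, and M1^p = M compensates the volume of Omega. *)
pose s := Y * v + t / M1.
have Y1 : 1 <= Y by rewrite YE; lra.
have Y0 : 0 < Y by apply: lt_le_trans Y1.
have Yv0 : 0 < Y * v by rewrite mulr_gt0.
have tM0 : 0 < t / M1 by rewrite divr_gt0.
have s0 : 0 < s by rewrite addr_gt0.
pose b := 48 * v ^+ 2.
have b0 : 0 < b by rewrite mulr_gt0// exprn_gt0.
pose lam := s ^+ 2 / b.
have lam1 : p + 32 * K <= lam.
  rewrite ler_pdivlMr//.
  have h1 : (Y * v) ^+ 2 <= s ^+ 2.
    by rewrite lerXn2r ?nnegrE ?(ltW s0) ?(ltW Yv0)// lerDl ltW.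
  apply: le_trans h1; have v2 : 0 < v ^+ 2 by rewrite exprn_gt0.
  rewrite exprMn /b mulrA ler_pM2r// expr2 {1}YE mulrC -mulrA ler_pM2l//.
  by rewrite ler_peMr//; lra.
have lam2 : t ^+ 2 / (48 * M1 ^+ 2 * v ^+ 2) <= lam.
  rewrite /lam /b.
  have : (t / M1) ^+ 2 <= s ^+ 2.
    by rewrite lerXn2r ?nnegrE ?(ltW s0) ?(ltW tM0)// lerDr ltW.
  have -> : t ^+ 2 / (48 * M1 ^+ 2 * v ^+ 2) = (t / M1) ^+ 2 / b.
    by rewrite /b; field; rewrite !gt_eqF.
  by move=> h; rewrite ler_wpM2r// invr_ge0 ltW.
pose f (z : 'rV[R]_d * T) : \bar R := (expR (G z.1 z.2 ^+ 2 / b) * \1_Omega z.1)%:E.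
have mInd : measurable_fun [set: 'rV[R]_d] (\1_Omega : 'rV[R]_d -> R).
  exact: measurable_indic.
have mf : measurable_fun [set: 'rV[R]_d * T] f.
  apply/measurable_EFinP; apply: measurable_funM.
    apply: measurableT_comp => //; apply: measurable_funM => //.
    exact: measurable_funX.
  exact: measurableT_comp mInd measurable_fst.
have f0 z : (0 <= f z)%E by rewrite lee_fin mulr_ge0 ?expR_ge0.
pose J w := (\int[lebesgue_rV R d]_x f (x, w))%E.
have mJ : measurable_fun [set: T] J.
  exact: measurable_fun_fubini_tonelli_G.
have J0 w : (0 <= J w)%E by exact: integral_ge0.
have EJ : (\int[P]_w J w <= (K * M)%:E)%E.
  rewrite /J -(@fubini_tonelli _ _ _ _ _ (lebesgue_rV R d) P f)//.
  apply: (@le_trans _ _ (\int[lebesgue_rV R d]_x (K%:E * (\1_Omega x)%:E))%E).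
    apply: ge0_le_integral => //=.
    - by move=> x _; exact: integral_ge0.
    - exact: measurable_fun_fubini_tonelli_F.
    - by apply: measurable_funeM; exact/measurable_EFinP.
    - move=> x _; have [xO|xO] := boolP (x \in Omega).
        have I1 : \1_Omega x = 1 :> R by rewrite indicE xO.
        rewrite I1 mule1; apply: le_trans (hG x (set_mem xO)).
        rewrite le_eqVlt; apply/orP; left; apply/eqP; apply: eq_integral => w _.
        by rewrite /f/= I1 mulr1.
      have I0 : \1_Omega x = 0 :> R by rewrite indicE (negbTE xO).
      by rewrite I0 mule0 integral0_eq// => w _; rewrite /f/= I0 mulr0.
  rewrite ge0_integralZl_EFin ?(ltW K0)//; last exact/measurable_EFinP.
  by rewrite integral_indic// setIT EFinM lee_wpmul2l// lee_fin ltW.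
pose c := M / 2 * expR (lam / 8).
have c0 : 0 < c by rewrite mulr_gt0 ?expR_gt0 ?divr_gt0.
have [E mE [hE PE]] := markov_le mJ J0 c0 EJ.
exists E => //; split.
  apply: le_trans PE; rewrite lee_fin lerD2l lerN2.
  have -> : K * M / c = 2 * K * expR (- (lam / 8)).
    rewrite /c expRN; field; rewrite !gt_eqF ?expR_gt0//.
  have e1 : 2 * K <= expR (lam / 16) by apply: le_trans (expR_ge1Dx _); lra.
  apply: (@le_trans _ _ (expR (lam / 16) * expR (- (lam / 8)))).
    by rewrite ler_wpM2r// expR_ge0.
  rewrite -expRD ler_expR.
  have -> : t ^+ 2 / (768 * M1 ^+ 2 * v ^+ 2) = t ^+ 2 / (48 * M1 ^+ 2 * v ^+ 2) / 16.
    by field; rewrite !gt_eqF.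
  by move: lam2; lra.
move=> w Ew.
have mGw : measurable_fun [set: 'rV[R]_d] (fun x => G x w).
  exact: (measurableT_comp mG (measurable_pair2 w)).
have ssp : s `^ p * M = (M1 * Y * v + t) `^ p.
  have -> : M1 * Y * v + t = M1 * s by rewrite /s; field; rewrite gt_eqF.
  rewrite powRM ?(ltW M10) ?(ltW s0)// mulrC; congr (_ * _).
  by rewrite M1E -powRrM mulVf ?gt_eqF// powRr1// ltW.
apply: (@le_trans _ _ ((s `^ p * 2^-1)%:E * \int[lebesgue_rV R d]_x (\1_Omega x)%:E +
   (s `^ p * expR (- (lam / 8)))%:E * \int[lebesgue_rV R d]_x (expR (G x w ^+ 2 / b) * \1_Omega x)%:E)%E).
  apply: integral_le_lin2 => //.
  - apply: measurable_funM => //; apply: (measurableT_comp (measurable_powR _)).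
    exact: measurableT_comp.
  - apply: measurable_funM => //; apply: measurableT_comp => //; apply: measurable_funM => //.
    exact: measurable_funX.
  - by rewrite mulr_ge0 ?powR_ge0.
  - by rewrite mulr_ge0 ?powR_ge0 ?expR_ge0.
  - move=> x; rewrite mulrA -mulrDl ler_wpM2r// -mulrA -mulrDr.
    by apply: powR_exp_bound => //; apply: le_trans lam1; lra.
rewrite integral_indic// setIT -ssp.
apply: (@le_trans _ _ ((s `^ p * 2^-1)%:E * M%:E + (s `^ p * expR (- (lam / 8)))%:E * c%:E)%E).
  apply: leeD; apply: lee_wpmul2l => //.
  - by rewrite lee_fin mulr_ge0 ?powR_ge0.
  - by rewrite lee_fin mulr_ge0 ?powR_ge0 ?expR_ge0.
  - exact: hE.
rewrite -!EFinM -EFinD lee_fin /c expRN le_eqVlt; apply/orP; left; apply/eqP.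
by field; rewrite gt_eqF// expR_gt0.
Qed.

Lemma continuous_sum_fun (R : realType) (d : nat) (I : finType) (F : I -> 'rV[R]_d -> R) :
  (forall i, continuous (F i)) -> continuous (fun x => \sum_i F i x).
Proof.
move=> cF; elim: (index_enum _) => [|k s IHs] x.
  by under eq_fun do rewrite big_nil; exact: cst_continuous.
under eq_fun do rewrite big_cons.
by apply: continuousD; [exact: cF|exact: IHs].
Qed.

Lemma kriging_weights_continuous (R : realType) (d n : nat) (Phi : 'rV[R]_d -> R)
    (X : 'I_n -> 'rV[R]_d) (j : 'I_n) :
  continuous Phi -> continuous (fun x => kriging_weights Phi X x j).
Proof.
move=> cPhi; rewrite [X in continuous X](_ : _ = (fun x : 'rV[R]_d => \sum_k Phi (x - X k) *
    invmx (\matrix_(j, k) Phi (X j - X k) : 'M[R]_n) k j)); last first.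
  by apply/funext => x; rewrite /kriging_weights mxE; apply: eq_bigr => k _; rewrite !mxE.
move: (invmx _) => K; apply: continuous_sum_fun => k x.
apply: (@continuousM _ _ (fun x : 'rV[R]_d => Phi (x - X k))); last exact: cst_continuous.
apply: (@continuous_comp _ _ _ (fun x : 'rV[R]_d => x - X k) Phi); last exact: cPhi.
by apply: continuousB; [exact: cvg_id|exact: cst_continuous].
Qed.

Lemma Lp_norm_le (R : realType) (d : nat) (Omega : set 'rV[R]_d) (p b : R)
    (g : 'rV[R]_d -> R) :
  1 <= p -> 0 <= b ->
  (\int[lebesgue_rV R d]_x (`|g x| `^ p * \1_Omega x)%:E <= (b `^ p)%:E)%E ->
  (Lp_norm Omega p g <= b%:E)%E.
Proof.
move=> p1 b0 h; have p0 : 0 < p by apply: lt_le_trans p1.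
rewrite /Lp_norm unlock /Lnorm.
have -> : b%:E = ((b `^ p)%:E `^ p^-1)%E.
  by rewrite poweR_EFin -powRrM mulfV ?gt_eqF// powRr1.
apply: gt0_ler_poweR.
- by rewrite invr_ge0 ltW.
- by rewrite in_itv/= leey andbT; apply: integral_ge0 => x _; exact: poweR_ge0.
- by rewrite in_itv/= leey andbT lee_fin powR_ge0.
apply: le_trans h; rewrite le_eqVlt; apply/orP; left; apply/eqP.
apply: eq_integral => x _; rewrite patchE indicE; case: (x \in Omega).
  by rewrite mulr1 -poweR_EFin.
by rewrite mulr0 abse0 poweR0r// gt_eqF.
Qed.

Theorem theorem3p5 (R : realType) (d : nat) (d_gt0 : (0 < d)%N)
    (Omega : set 'rV[R]_d)
    (Omega_compact : compact Omega)
    (Omega_lipschitz : lipschitz_boundary Omega)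
    (Omega_cone : interior_cone_condition Omega)
    (Psi Phi fPsi fPhi : 'rV[R]_d -> R)
    (Psi_corr : correlation_function Psi)
    (Phi_corr : correlation_function Phi)
    (Psi_spec : spectral_density Psi fPsi)
    (Phi_spec : spectral_density Phi fPhi)
    (c1 c2 c3 c4 nu0 nu : R)
    (c1_gt0 : 0 < c1) (c1_le_c2 : c1 <= c2)
    (c3_gt0 : 0 < c3) (c3_le_c4 : c3 <= c4)
    (nu0_gt0 : 0 < nu0) (nu_gt0 : 0 < nu)
    (fPsi_bounds : forall w : 'rV[R]_d,
       c1 * (1 + enorm w ^+ 2) `^ (- (nu0 + d%:R / 2)) <= fPsi w
         <= c2 * (1 + enorm w ^+ 2) `^ (- (nu0 + d%:R / 2)))
    (fPhi_bounds : forall w : 'rV[R]_d,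
       c3 * (1 + enorm w ^+ 2) `^ (- (nu + d%:R / 2)) <= fPhi w
         <= c4 * (1 + enorm w ^+ 2) `^ (- (nu + d%:R / 2)))
    (p : R) (p_ge1 : 1 <= p)
    (nu0_lt_nu : nu0 < nu) :
  exists C1 C2 h0 : R,
    [/\ 0 < C1, 0 < C2, 0 < h0 <= 1 &
        forall (disp : measure_display) (T : measurableType disp)
          (P : probability T R) (sigma : R) (Z : 'rV[R]_d -> {RV P >-> R}),
          0 < sigma ->
          stationary_gaussian_process sigma Psi Z ->
        forall (n : nat) (X : 'I_n -> 'rV[R]_d) (t : R),
          design Omega X -> fill_distance Omega X <= h0 -> 0 < t ->
          with_probability_ge P
            (1 - expR (- (t ^+ 2 /
               (C1 * sigma ^+ 2 * fill_distance Omega X `^ (2 * nu0)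
                  * mesh_ratio Omega X `^ (2 * (nu - nu0))))))
            (fun w =>
               (Lp_norm Omega p
                  (fun x => (Z x w - kriging Phi X (fun y => Z y w) x)%R)
                <= (C2 * sigma * fill_distance Omega X `^ nu0
                      * mesh_ratio Omega X `^ (nu - nu0) + t)%:E)%E)].
Proof.
have c2_gt0 : 0 < c2 := lt_le_trans c1_gt0 c1_le_c2.
have c4_gt0 : 0 < c4 := lt_le_trans c3_gt0 c3_le_c4.
have fPsib (w : 'rV[R]_d) : 0 <= fPsi w <= c2 * sobolev_weight nu0 w.
  have /andP[l ->] := fPsi_bounds w; rewrite andbT; apply: le_trans l.
  by rewrite mulr_ge0 ?powR_ge0// ltW.
have [C [h0 [C0 h01 var]]] := kriging_variance_bound d_gt0 Omega_compact Omega_cone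
  Phi_corr Psi_spec Phi_spec nu0_gt0 nu0_lt_nu c2_gt0 c3_gt0 c4_gt0 fPsib fPhi_bounds.
have mO : measurable Omega.
  by apply: closed_measurable_rV; exact: compact_closed (@norm_hausdorff _ _) Omega_compact.
have [M M0 vol] := compact_finite_volume Omega_compact.
have [K KE K0] : exists2 K : R, K = 2 * expR 6 & 0 < K.
  by exists (2 * expR 6) => //; rewrite mulr_gt0 ?expR_gt0.
have [M1 M1E M10] : exists2 M1 : R, M1 = M `^ p^-1 & 0 < M1.
  by exists (M `^ p^-1); rewrite ?powR_gt0.
have [Y YE Y0] : exists2 Y : R, Y = 48 * (p + 32 * K) & 0 < Y.
  by exists (48 * (p + 32 * K)) => //; move: p_ge1 K0; lra.
have tail := Lp_tail mO vol M0 p_ge1 K0 M1E YE.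
have sC : 0 < Num.sqrt C by rewrite sqrtr_gt0.
exists (768 * M1 ^+ 2 * C), (M1 * Y * Num.sqrt C), h0; split.
- exact: mulr_gt0 (mulr_gt0 (ltr0Sn R 767) (exprn_gt0 2 M10)) C0.
- exact: mulr_gt0 (mulr_gt0 M10 Y0) sC.
- exact: h01.
move=> disp T P sigma Z sigma0 Zgp n X t des hh0 t0.
have [hpos rhopos varx] := var n X des hh0.
have [_ Xinj _] := des.
set h := fill_distance Omega X in hpos varx *.
set rho := mesh_ratio Omega X in rhopos varx *.
have [v vE v0] : exists2 v, v = Num.sqrt C * sigma * h `^ nu0 * rho `^ (nu - nu0) & 0 < v.
  by eexists; [reflexivity|rewrite !mulr_gt0 ?powR_gt0].
have v2 : v ^+ 2 = C * sigma ^+ 2 * h `^ (2 * nu0) * rho `^ (2 * (nu - nu0)).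
  have sq (a b : R) : (a `^ b) ^+ 2 = a `^ (2 * b).
    by rewrite -powR_mulrn ?powR_ge0// -powRrM mulrC.
  by rewrite vE !exprMn !sq sqr_sqrtr// ltW.
have [gp [N [mN PN0 Nc]] _ _] := Zgp.
have [cPhi _ Pe Ppd _] := Phi_corr.
(* Sample paths are discontinuous only on the null set N; there the error is
   replaced by 0, so that it is continuous in x for every w. *)
pose G (x : 'rV[R]_d) (w : T) : R :=
  \1_(~` N) w * (Z x w - \sum_j kriging_weights Phi X x j * Z (X j) w).
have cZ w : ~ N w -> continuous (fun x => Z x w).
  by move=> nN; apply: contrapT => h'; apply: nN; exact: Nc.
have mZ x : measurable_fun [set: T] (Z x) by exact: measurable_funP.
have mG : measurable_fun [set: 'rV[R]_d * T] (fun z => G z.1 z.2).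
  apply: measurable_caratheodory => [w|x]; last first.
    apply: measurable_funM; first exact: measurable_indic (measurableC mN).
    apply: measurable_funB => //; apply: measurable_sum => j.
    exact: measurable_funM.
  rewrite /G indicE; have [wN|wN] := pselect (N w).
    have -> : (w \in ~` N) = false by apply/negbTE; rewrite notin_setE/=; exact.
    by under eq_fun do rewrite mul0r; exact: cst_continuous.
  rewrite mem_set// => x; under eq_fun do rewrite mul1r.
  apply: continuousB; first exact: cZ.
  apply: continuous_sum_fun => j {}x; apply: continuousM; last exact: cst_continuous.
  exact: kriging_weights_continuous.
have hG x : Omega x ->
    (\int[P]_w (expR (G x w ^+ 2 / (48 * v ^+ 2)))%:E <= K%:E)%E.
  move=> Ox; set u := kriging_weights Phi X x.
  pose V w := \sum_i residual_coef u i * Z (residual_pts x X i) w.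
  have mV : measurable_fun [set: T] V.
    by apply: measurable_sum => i; exact: measurable_funM.
  have VE w : V w = Z x w - \sum_j kriging_weights Phi X x j * Z (X j) w.
    exact: (sum_residual u x X (fun y => Z y w)).
  have gV : gaussian_rv P V by exact: gp.
  have V2 : (\int[P]_w (V w ^+ 2)%:E <= (v ^+ 2)%:E)%E.
    rewrite (second_moment_combination Zgp) lee_fin v2.
    have := ler_wpM2l (sqr_ge0 sigma) (varx x Ox).
    by move=> h'; apply: le_trans h' _; rewrite le_eqVlt; apply/orP; left; apply/eqP; ring.
  rewrite KE; apply: le_trans (gaussian_exp_moment mV gV v0 V2).
  apply: ge0_le_integral => //=.
  - apply/measurable_EFinP; apply: measurableT_comp => //; apply: measurable_funM => //.
    apply: measurable_funX; exact: (measurableT_comp mG (measurable_pair1 x)).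
  - apply/measurable_EFinP; apply: measurableT_comp => //; apply: measurable_funM => //.
    exact: measurable_funX.
  - move=> w _; rewrite lee_fin ler_expR ler_wpM2r ?invr_ge0 ?mulr_ge0 ?exprn_ge0 ?(ltW v0)//.
    rewrite /G -VE exprMn ler_piMl ?sqr_ge0// indicE.
have [E mE [PE hE]] := tail disp T P G v t mG v0 t0 hG.
exists (E `&` ~` N); split.
- by apply: measurableI => //; exact: measurableC.
- move=> w [Ew /= Nw].
  have -> : M1 * Y * Num.sqrt C * sigma * h `^ nu0 * rho `^ (nu - nu0) + t = M1 * Y * v + t.
    by rewrite vE; ring.
  apply: Lp_norm_le => //.
    by rewrite addr_ge0 ?(ltW t0)// !mulr_ge0// ltW.
  apply: le_trans (hE w Ew); rewrite le_eqVlt; apply/orP; left; apply/eqP.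
  have I1 : \1_(~` N) w = 1 :> R by rewrite indicE mem_set.
  by apply: eq_integral => x _; rewrite krigingE /G I1 mul1r.
- have -> : t ^+ 2 / (768 * M1 ^+ 2 * C * sigma ^+ 2 * h `^ (2 * nu0) * rho `^ (2 * (nu - nu0)))
      = t ^+ 2 / (768 * M1 ^+ 2 * v ^+ 2).
    by rewrite v2; congr (_ / _); ring.
  apply: le_trans PE _.
  have PEN : P (E `&` N) = 0%E.
    by apply: (subset_measure0 _ mN) => //; exact: measurableI.
  have U : (P ((E `&` N) `|` (E `&` ~` N)) <= P (E `&` N) + P (E `&` ~` N))%E.
    by apply: measureU2; apply: measurableI => //; exact: measurableC.
  by move: U; rewrite PEN add0e -setIUr setUv setIT.
Qed.
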